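(* Let $1<s<2$. Then $(\mathbb R_{\mathcal G},x^s)$ defines the function $W_s'/W_s\colon(0,\infty)\to\mathbb R$, and $(\mathbb R_{\mathcal G},e^x)$ defines the function $W_s\colon(0,\infty)\to\mathbb R$. Here $x^s$ is the power function on $(0,\infty)$ and $e^x$ the exponential function on $\mathbb R$.
   Context: $\overline{\mathbb R}=(\mathbb R,+,\cdot,(r)_{r\in\mathbb R})$ is the real field with a constant for each real number. ''Defines'' means first-order definable (parameters from $\mathbb R$ allowed), functions being identified with their graphs; $(\mathfrak R,f)$ is the expansion of the structure $\mathfrak R$ by the function $f$. $\mathbb N$ is the set of nonnegative integers. For $1<s$, $W_s(x)=\prod_{n>0}\left(1+\frac{x}{n^s}\right)$ for $x\in(0,\infty)$ (the canonical Weierstrass product of the sequence $(-n^s)_{n>0}$, restricted to $(0,\infty)$). The structure $\mathbb R_{\mathcal G}$ (van den Dries–Speissegger, ''The field of reals with multisummable series and the exponential function''). Let $m\ge1$ and $\tau=(K,R,r,\varphi)$ with $K\subseteq[0,\infty)^m$ finite nonempty, $R\in(0,\infty)^m$, $r>1$, $\varphi\in(\pi/2,\pi)$. Put $D(R)=\{z\in\mathbb C^m: |z_i|<R_i,\ i=1,\dots,m\}$ and use principal arguments $\arg\in(-\pi,\pi]$ with the convention $\arg 0=0$ (and $0^0=1$). For $k\in K$ and $p\in\mathbb N$ put $S^k=\{z\in D(R):\sum_i k_i|\arg z_i|<\varphi\}$, $D^k_p=\{z\in D(R):\prod_i|z_i|^{k_i}<\frac{1}{p+1}\prod_iR_i^{k_i}\}$,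 $S_p(\tau)=\bigcap_{k\in K}(S^k\cup D^k_p)$, and $S(\tau)=\bigcap_{p}S_p(\tau)$. Let $\mathcal G_\tau$ be the set of functions $f\colon S(\tau)\to\mathbb C$ such that $f=\sum_{p\in\mathbb N}f_p$ on $S(\tau)$ for some bounded holomorphic $f_p\colon S_p(\tau)\to\mathbb C$ with $\sum_p r^p\sup_{S_p(\tau)}|f_p|<\infty$. Then $\mathbb R_{\mathcal G}$ is the expansion of $\overline{\mathbb R}$ by all functions $\tilde f\colon\mathbb R^m\to\mathbb R$ ($m\ge1$) where $f\in\mathcal G_\tau$ for some $\tau=(K,R,r,\varphi)$ with $K\subseteq[0,\infty)^m$ finite nonempty, $R\in(0,\infty)^m$ such that $R_i>1$ for all $i$, $r>1$ and $\varphi\in(\pi/2,\pi)$, $f$ is real-valued on $S(\tau)\cap\mathbb R^m$, and $\tilde f=f$ on $[0,1]^m$, $\tilde f=0$ elsewhere. In particular, up to definability, the unary primitives include the functions on $(0,1)$ that extend holomorphically to some $\{0<|z|<\rho,\ |\arg z|<\kappa\varphi\}$ with $\rho>1$, $0<\kappa<1$, $\varphi\in(\pi/2,\pi)$ and satisfy there $|f^{(n)}(z)|/n!\le AB^n(n!)^\kappa$ for all $n\in\mathbb N$ and some $A,B>0$. It is known that $\mathbb R_{\mathcal G}$ is o-minimal, polynomially bounded, has field of exponents $\mathbb Q$, and expands $\mathbb R_{\mathrm{an}}$ (the expansion of $\overline{\mathbb R}$ by all restrictions to $[0,1]^m$, $m\geq 1$, of real-analytic functions on neighbourhoods of $[0,1]^m$).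 *)

(* Defs.v *)
From mathcomp Require Import all_boot all_order all_algebra.
From mathcomp Require Import all_classical all_reals all_analysis.
From mathcomp Require Import complex.

Set Implicit Arguments.
Unset Strict Implicit.
Unset Printing Implicit Defensive.

Import Order.TTheory GRing.Theory Num.Theory.
Import numFieldNormedType.Exports.
Import ComplexField.

Local Open Scope classical_set_scope.
Local Open Scope ring_scope.

(* An expansion of the field R (with a constant for each real number) is given
   by its additional primitive relations; a function is a primitive through its
   graph. *)
Definition expansion (R : realType) := forall n, set 'rV[R]_n -> Prop.

Inductive term (R : realType) : Type :=
| TVar of nat
| TConst of R
| TAdd of term R & term R
| TMul of term R & term R.

Inductive formula (R : realType) (E : expansion R) : Type :=
| FEq of term R & term R
| FRel n (A : set 'rV[R]_n) of E n A & ('I_n -> term R)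
| FNot of formula E
| FAnd of formula E & formula E
| FEx of nat & formula E.

Fixpoint teval (R : realType) (e : nat -> R) (t : term R) : R :=
  match t with
  | TVar i => e i
  | TConst c => c
  | TAdd t1 t2 => teval e t1 + teval e t2
  | TMul t1 t2 => teval e t1 * teval e t2
  end.

Fixpoint sat (R : realType) (E : expansion R) (e : nat -> R)
    (phi : formula E) : Prop :=
  match phi with
  | FEq t1 t2 => teval e t1 = teval e t2
  | FRel n A _ ts => A (\row_i teval e (ts i))
  | FNot phi1 => ~ sat e phi1
  | FAnd phi1 phi2 => sat e phi1 /\ sat e phi2
  | FEx i phi1 =>
      exists x : R, sat (fun j => if j == i then x else e j) phi1
  end.

(* Variables of index >= n take the value 0, which is harmless since every
   real is a constant of the language. *)
Definition valuation (R : realType) n (x : 'rV[R]_n) (j : nat) : R :=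
  if insub j is Some i then x 0 i else 0.

Definition defines (R : realType) (E : expansion R) n (A : set 'rV[R]_n) :=
  exists phi : formula E, forall x, A x <-> sat (valuation x) phi.

Definition graph (R : realType) n (D : set 'rV[R]_n) (f : 'rV[R]_n -> R) :
    set 'rV[R]_(n + 1) :=
  [set z | D (lsubmx z) /\ rsubmx z 0 0 = f (lsubmx z)].

Definition graph1 (R : realType) (D : set R) (f : R -> R) :
    set 'rV[R]_(1 + 1) :=
  graph [set x : 'rV_1 | D (x 0 0)] (fun x => f (x 0 0)).

Inductive expand_by (R : realType) (E : expansion R) k (B : set 'rV[R]_k) :
    expansion R :=
| expand_old n A of E n A : expand_by E B A
| expand_new : expand_by E B B.

(* R[i]^o is R[i] with its normed module structure over itself; with complex
   scalars, differentiable means complex differentiable. *)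
Local Notation C R := (R[i]^o).

Definition toC (R : realType) n (x : 'rV[R]_n) : 'rV[C R]_n :=
  map_mx (real_complex R) x.

(* The principal argument, in ]-pi, pi], with carg 0 = 0. *)
Definition carg (R : realType) (z : C R) : R :=
  if z == 0 then 0
  else if 0 <= complex.Im z then acos (complex.Re z / Normc.normc z)
  else - acos (complex.Re z / Normc.normc z).

Record datum (R : realType) (m : nat) := Datum {
  dK : set 'rV[R]_m;
  dR : 'rV[R]_m;
  dr : R;
  dphi : R }.

Definition admissible (R : realType) m (tau : datum R m) : Prop :=
  [/\ [/\ finite_set (dK tau), dK tau !=set0 &
          forall k, dK tau k -> forall i, 0 <= k 0 i],
      forall i, 0 < dR tau 0 i,
      1 < dr tau &
      pi / 2 < dphi tau < pi].

Section Domains.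
Variables (R : realType) (m : nat) (tau : datum R m).
Implicit Types (k : 'rV[R]_m) (p : nat) (z : 'rV[C R]_m).

Definition polydisc : set 'rV[C R]_m :=
  [set z | forall i, Normc.normc (z 0 i) < dR tau 0 i].

Definition sectorS k : set 'rV[C R]_m :=
  [set z | polydisc z /\ \sum_i k 0 i * `|carg (z 0 i)| < dphi tau].

(* The library's power satisfies 0 `^ 0 = 1 and 0 `^ a = 0 for a != 0. *)
Definition discD k p : set 'rV[C R]_m :=
  [set z | polydisc z /\
    \prod_i (Normc.normc (z 0 i) `^ k 0 i)
      < (p.+1%:R)^-1 * \prod_i (dR tau 0 i `^ k 0 i)].

Definition domS p : set 'rV[C R]_m :=
  \bigcap_(k in dK tau) (sectorS k `|` discD k p).

Definition domSinf : set 'rV[C R]_m := \bigcap_p domS p.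

(* The sets domS p are open, so a function on domS p is holomorphic iff any
   extension of it to C^m is complex differentiable at each point of domS p. *)
Definition holomorphic_on (U : set 'rV[C R]_m) (g : 'rV[C R]_m -> C R) :=
  forall z, U z -> differentiable g z.

(* Functions on domSinf and on domS p are represented by total functions,
   whose values elsewhere are irrelevant. *)
Definition calG (f : 'rV[C R]_m -> C R) : Prop :=
  exists g : nat -> 'rV[C R]_m -> C R,
    [/\ forall p, holomorphic_on (domS p) (g p),
        forall p, exists M : R,
          forall z, domS p z -> Normc.normc (g p z) <= M,
        cvgn (series (fun p =>
          dr tau ^+ p * sup [set Normc.normc (g p z) | z in domS p])) &
        forall z, domSinf z -> series (fun p => g p z) @ \oo --> f z].

End Domains.

Definition restrict01 (R : realType) m (f : 'rV[C R]_m -> C R)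
    (x : 'rV[R]_m) : R :=
  if [forall i, 0 <= x 0 i <= 1] then complex.Re (f (toC x)) else 0.

Inductive RG (R : realType) : expansion R :=
| RG_prim m (tau : datum R m) (f : 'rV[C R]_m -> C R) of
    (0 < m)%N & admissible tau & (forall i, 1 < dR tau 0 i) & calG tau f &
    (forall x : 'rV[R]_m, domSinf tau (toC x) -> complex.Im (f (toC x)) = 0) :
    RG (graph setT (restrict01 f)).

Definition W (R : realType) (s x : R) : R :=
  limn (fun N => \prod_(1 <= n < N.+1) (1 + x / (n%:R `^ s))).

(* Main.v *)
Require Import Defs.
From mathcomp Require Import all_boot all_order all_algebra.
From mathcomp Require Import all_classical all_reals all_analysis.
From mathcomp Require Import complex ring lra zify.

(** Put logW = ln W_s, so logW x = \sum_(m >= 1) ln (1 + x / m^s).  The terms of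
    2 logW x - logW (2^s x) are those of an alternating series, and logW x is
    recovered from the values at the points 2^(s k) x of that series, up to a
    term which is homogeneous, hence equal to D x^(1/s).  In the variable z = 1/x
    the alternating series is, up to a multiple of ln z, the sum of
    (-1)^m Log (z + m^-s).  Its Euler transform, with the number of differences
    growing linearly with the starting index N, has steps that decay
    geometrically in N, uniformly both in a sector of half-opening greater than
    s pi / 2 and in the disc |z| < c N^-s: for M <= c' N the M-th difference of
    Log (z + t^-s) at t = N is bounded, as one sees from the discrete Leibniz
    formula.  Each step is a finite combination of logarithms, so for x >= 1
      logW x = D x^(1/s) - (ln x) / 2 - s ln 2 + f (1 / x)
    with f in the class G for K = {1/s}; for x <= 1 the function
    logW x - ln (1 + x) is in the class G for K = {0}.  This gives W_s = exp logW,
    and W_s' / W_s = logW' is obtained from the definable functions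
    logW x + (ln x) / 2 and logW x - ln (1 + x) by a first-order definition of
    the derivative. *)

Set Implicit Arguments.
Unset Strict Implicit.
Unset Printing Implicit Defensive.
Import Order.TTheory GRing.Theory Num.Theory.
Import numFieldNormedType.Exports.
Import ComplexField.
Local Open Scope classical_set_scope.
Local Open Scope ring_scope.


(** * The complex logarithm *)

Local Notation normc := Normc.normc.
Local Notation Re := complex.Re.
Local Notation Im := complex.Im.

(** The terms in [z] are singular at the points [- m^-s], which accumulate at 0: no disc around 0 is
    free of them, and the class G only asks that the [p]-th piece be holomorphic on a disc of radius
    of order [(p + 1)^-s]. Hence a piece may involve only indices [m] up to a multiple of [p]. The
    alternating signs make Euler's transform available: it supplies the factor [2^-M], so that
    bounded [M]-th differences already give geometric decay. To bound them, note that the derivative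
    in [t] of [Log (z + t^-s)] is [- s / e] with [e = t + z t^(s+1)]; Leibniz's formula for the
    product of [e] and [1 / e], which is 1, bounds the differences of [1 / e] through those of the
    two powers in [e], and the index stays real. The class wants [phi > pi / 2], hence for
    [K = {1/s}] a sector with [|arg z|] beyond [s pi / 2]; it can avoid the negative half-line
    because [s < 2]. In the first structure no logarithm is at hand, so the logarithmic terms are
    moved to the side of [logW] and turned into rational functions by differentiation. *)

Lemma sqr_normcE (R : realType) (w : R[i]) : normc w ^+ 2 = Re w ^+ 2 + Im w ^+ 2.
Proof. by case: w => a b /=; rewrite sqr_sqrtr // addr_ge0 // sqr_ge0. Qed.

Lemma normc_ge0 (R : realType) (w : R[i]) : 0 <= normc w.
Proof. by case: w => a b; exact: sqrtr_ge0. Qed.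

Lemma normc_gt0 (R : realType) (w : R[i]) : (0 < normc w) = (w != 0).
Proof.
rewrite lt_neqAle normc_ge0 andbT eq_sym; congr (~~ _).
by apply/eqP/eqP => [/Normc.eq0_normc|->] //; rewrite Normc.normc0.
Qed.

Lemma normcD (R : realType) (v w : R[i]) : normc (v + w) <= normc v + normc w.
Proof. exact: le_normcD. Qed.

Lemma normcB (R : realType) (v w : R[i]) : normc (v - w) <= normc v + normc w.
Proof. by rewrite -(normcN w); exact: le_normcD. Qed.

Lemma normcX (R : realType) (w : R[i]) n : normc (w ^+ n) = normc w ^+ n.
Proof.
by elim: n => [|n IH]; rewrite ?Normc.normc1 // !exprS Normc.normcM IH.
Qed.

Lemma normcR (R : realType) (x : R) : normc (x%:C)%C = `|x|.
Proof. by rewrite /= expr0n /= addr0 sqrtr_sqr. Qed.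

Lemma normc_sum (R : realType) (I : Type) (r : seq I) (P : pred I) (F : I -> R[i]) :
  normc (\sum_(i <- r | P i) F i) <= \sum_(i <- r | P i) normc (F i).
Proof.
apply: (big_ind2 (fun u v => normc u <= v)) => //.
- by rewrite Normc.normc0.
- by move=> u a v b ua vb; apply: le_trans (normcD _ _) (lerD ua vb).
Qed.

Lemma Re_le_normc (R : realType) (w : R[i]) : `|Re w| <= normc w.
Proof.
rewrite -(ler_pXn2r (n := 2)) ?nnegrE ?normc_ge0 // real_normK ?num_real //.
by rewrite sqr_normcE lerDl sqr_ge0.
Qed.

Lemma Im_le_normc (R : realType) (w : R[i]) : `|Im w| <= normc w.
Proof.
rewrite -(ler_pXn2r (n := 2)) ?nnegrE ?normc_ge0 // real_normK ?num_real //.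
by rewrite sqr_normcE lerDr sqr_ge0.
Qed.

Lemma normc_le_ReIm (R : realType) (w : R[i]) : normc w <= `|Re w| + `|Im w|.
Proof.
rewrite -(ler_pXn2r (n := 2)) ?nnegrE ?addr_ge0 ?normc_ge0 // sqr_normcE.
rewrite -(real_normK (num_real (Re w))) -(real_normK (num_real (Im w))).
have := mulr_ge0 (normr_ge0 (Re w)) (normr_ge0 (Im w)); nra.
Qed.

Definition slit (R : realType) (w : R[i]) := (Im w != 0) || (0 < Re w).

Lemma slit_neq0 (R : realType) (w : R[i]) : slit w -> w != 0.
Proof. by apply: contraTneq => ->; rewrite /slit /= eqxx ltxx. Qed.

Lemma Re_div_normc (R : realType) (w : R[i]) : w != 0 -> -1 <= Re w / normc w <= 1.
Proof.
by rewrite -normc_gt0 => w0; rewrite -ler_norml normrM normfV (gtr0_norm w0)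
  ler_pdivrMr // mul1r Re_le_normc.
Qed.

Lemma cos_carg (R : realType) (w : R[i]) : w != 0 -> cos (carg w) = Re w / normc w.
Proof.
move=> w0; have h := Re_div_normc w0.
by rewrite /carg (negbTE w0); case: ifP => _; rewrite ?cosN acosK ?in_itv.
Qed.

Lemma sin_carg (R : realType) (w : R[i]) : w != 0 -> sin (carg w) = Im w / normc w.
Proof.
move=> w0; have h := Re_div_normc w0.
have n0 : 0 < normc w by rewrite normc_gt0.
have E : Num.sqrt (1 - (Re w / normc w) ^+ 2) = `|Im w| / normc w.
  rewrite -[RHS]ger0_norm ?divr_ge0 ?normc_ge0 // -sqrtr_sqr; congr Num.sqrt.
  rewrite !expr_div_n real_normK ?num_real // -[X in X - _](divff (_ : normc w ^+ 2 != 0)).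
    by rewrite -mulrBl sqr_normcE addrC addKr.
  by rewrite expf_neq0 // gt_eqF.
rewrite /carg (negbTE w0); case: ifPn => i0; rewrite ?sinN sin_acos // E.
  by rewrite ger0_norm.
by rewrite ltr0_norm ?ltNge // mulNr opprK.
Qed.

Lemma carg_le_pi (R : realType) (w : R[i]) : `|carg w| <= pi.
Proof.
have [->|w0] := eqVneq w 0; first by rewrite /carg eqxx normr0 pi_ge0.
have h := Re_div_normc w0.
have : `|acos (Re w / normc w)| <= pi by rewrite ger0_norm ?acos_ge0 // acos_lepi.
by rewrite /carg (negbTE w0); case: ifP => _; rewrite ?normrN.
Qed.

Lemma carg_lt_pi (R : realType) (w : R[i]) : slit w -> `|carg w| < pi.
Proof.
move=> sw; have w0 := slit_neq0 sw.
rewrite lt_neqAle carg_le_pi andbT; apply/eqP => E.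
have n0 : 0 < normc w by rewrite normc_gt0.
have c : cos (carg w) = -1 by rewrite -cos_norm E cospi.
have si : sin (carg w) = 0.
  by apply/eqP; rewrite -sqrf_eq0 sin2cos2 c sqrrN expr1n subrr.
move: c si sw; rewrite cos_carg // sin_carg // /slit => c si.
have -> : Im w = 0 by apply: (mulIf (invr_neq0 (lt0r_neq0 n0))); rewrite si mul0r.
have -> : Re w = - normc w by rewrite -[LHS](divfK (lt0r_neq0 n0)) c mulN1r.
by rewrite eqxx /= oppr_gt0 ltNge ltW.
Qed.

(** The half difference has sine 0 and absolute value less than [pi], so it vanishes. *)
Lemma angle_uniq (R : realType) (a b : R) :
  cos a = cos b -> sin a = sin b -> `|a - b| < pi *+ 2 -> a = b.
Proof.
move=> cab sab ab; apply/eqP; rewrite -subr_eq0.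
set d := a - b in ab *.
have : cos d = 1 by rewrite cosB cab sab -!expr2 cos2Dsin2.
have d2 : d = (d / 2) *+ 2 by rewrite -mulr_natr divfK.
rewrite d2 cos_mulr2n cos2sin2 => c1.
have s0 : sin `|d / 2| = 0.
  have : sin (d / 2) = 0 by apply/eqP; rewrite -sqrf_eq0; apply/eqP; lra.
  by case: (ger0P (d / 2)) => // _; rewrite sinN => ->; rewrite oppr0.
have [//|dn0] := eqVneq (d / 2 *+ 2) 0.
suff : 0 < sin `|d / 2| by rewrite s0 ltxx.
apply: sin_gt0_pi; rewrite normr_gt0; apply/andP; split.
  by apply: contraNneq dn0 => ->; rewrite mul0rn.
rewrite normrM [`|2^-1|]gtr0_norm ?invr_gt0 // ltr_pdivrMr //.
by rewrite mulr_natr.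
Qed.

Lemma sin_atanE (R : realType) (x : R) : sin (atan x) = x * cos (atan x).
Proof.
have c0 : cos (atan x) != 0.
  by rewrite gt_eqF // cos_gt0_pihalf // atan_gtNpi2 atan_ltpi2.
by rewrite -{2}[x]atanK /tan divfK.
Qed.

Lemma carg_atan (R : realType) (w : R[i]) : 0 < Re w -> carg w = atan (Im w / Re w).
Proof.
move=> r0.
have sw : slit w by rewrite /slit r0 orbT.
have w0 := slit_neq0 sw; have n0 : 0 < normc w by rewrite normc_gt0.
have C : cos (atan (Im w / Re w)) = Re w / normc w.
  rewrite cos_atan; apply: invr_inj; rewrite invrK invf_div.
  rewrite -[RHS]ger0_norm ?divr_ge0 ?normc_ge0 ?ltW // -sqrtr_sqr; congr Num.sqrt.
  rewrite !expr_div_n sqr_normcE mulrDl divff //.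
  by rewrite expf_neq0 // gt_eqF.
apply: angle_uniq.
- by rewrite cos_carg.
- by rewrite sin_carg // sin_atanE C mulrA divfK // gt_eqF.
- rewrite mulr2n; apply: le_lt_trans (ler_normB _ _) _; apply: ltrD; first exact: carg_lt_pi.
  rewrite ltr_norml; have := atan_gtNpi2 (Im w / Re w); have := atan_ltpi2 (Im w / Re w).
  by have := @pi_gt0 R; move=> ? ? ?; apply/andP; split; lra.
Qed.

Definition clog (R : realType) (w : R[i]) : R[i] := (ln (normc w) +i* carg w)%C.

Lemma carg_pos (R : realType) (x : R) : 0 < x -> carg (x%:C)%C = 0.
Proof. by move=> x0; rewrite carg_atan //= mul0r atan0. Qed.

Lemma clog_real (R : realType) (x : R) : 0 < x -> clog (x%:C)%C = ((ln x)%:C)%C.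
Proof. by move=> x0; rewrite /clog normcR gtr0_norm // carg_pos. Qed.

Lemma Re_clog (R : realType) (w : R[i]) : Re (clog w) = ln (normc w). Proof. by []. Qed.
Lemma Im_clog (R : realType) (w : R[i]) : Im (clog w) = carg w. Proof. by []. Qed.

(** The bound keeps the sum of the arguments in the principal range, so no multiple of [2 pi]
    intervenes. *)
Lemma clogM (R : realType) (v w : R[i]) : v != 0 -> w != 0 ->
  `|carg v| + `|carg w| < pi -> clog (v * w) = clog v + clog w.
Proof.
move=> v0 w0 h.
have vw0 : v * w != 0 by rewrite mulf_neq0.
have nv : normc v != 0 by rewrite gt_eqF // normc_gt0.
have nw : normc w != 0 by rewrite gt_eqF // normc_gt0.
rewrite /clog Normc.normcM lnM ?posrE ?normc_gt0 //.
suff -> : carg (v * w) = carg v + carg w by [].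
apply: angle_uniq.
- rewrite cosD !cos_carg // !sin_carg // Normc.normcM.
  by case: (v) (w) nv nw => a b [c d] /= nv nw; field; rewrite nv nw.
- rewrite sinD !cos_carg // !sin_carg // Normc.normcM.
  by case: (v) (w) nv nw => a b [c d] /= nv nw; field; rewrite nv nw.
- rewrite mulr2n; apply: le_lt_trans (ler_normB _ _) _; apply: ler_ltD; first exact: carg_le_pi.
  exact: le_lt_trans (ler_normD _ _) h.
Qed.

Lemma atan_MVT (R : realType) (x : R) : exists2 c : R, `|c| <= `|x| & atan x = x / (1 + c ^+ 2).
Proof.
have [x0|x0|->] := ltgtP x 0; last by exists 0; rewrite ?atan0 ?mul0r.
- have [|c] := @MVT R (@atan R) (fun y => (1 + y ^+ 2)^-1) x 0 x0.
  + by apply: continuous_subspaceT => y; exact: continuous_atan.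
  rewrite in_itv /= atan0 sub0r => /andP[xc c0] E; exists c.
    by rewrite (ltr0_norm c0) (ltr0_norm x0) lerN2 ltW.
  by apply: oppr_inj; rewrite E sub0r mulrC mulNr.
- have [|c] := @MVT R (@atan R) (fun y => (1 + y ^+ 2)^-1) 0 x x0.
  + by apply: continuous_subspaceT => y; exact: continuous_atan.
  rewrite in_itv /= atan0 !subr0 => /andP[xc c0] E; exists c.
    by rewrite !gtr0_norm // ltW.
  by rewrite E mulrC.
Qed.

Lemma atan_le (R : realType) (x : R) : `|atan x| <= `|x|.
Proof.
have [c _ ->] := atan_MVT x.
have c1 : 1 <= 1 + c ^+ 2 by rewrite lerDl sqr_ge0.
rewrite normrM normfV (ger0_norm (le_trans ler01 c1)) ler_pdivrMr ?(lt_le_trans ltr01) //.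
by rewrite ler_peMr.
Qed.

Lemma atan_sub (R : realType) (x : R) : `|atan x - x| <= `|x| ^+ 3.
Proof.
have [c cx ->] := atan_MVT x.
have c1 : 1 <= 1 + c ^+ 2 by rewrite lerDl sqr_ge0.
have c0 : 0 < 1 + c ^+ 2 by apply: lt_le_trans c1.
have -> : x / (1 + c ^+ 2) - x = - x * c ^+ 2 / (1 + c ^+ 2) by field; rewrite gt_eqF.
rewrite normrM normfV (gtr0_norm c0) ler_pdivrMr // normrM normrN normrX.
apply: le_trans (_ : `|x| * `|x| ^+ 2 <= _).
  by rewrite ler_wpM2l // lerXn2r ?nnegrE.
by rewrite -exprS ler_peMr // exprn_ge0.
Qed.

Lemma ln_le_sub1 (R : realType) (x : R) : 0 < x -> ln x <= x - 1.
Proof.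
by move=> x0; have := @le_ln1Dx R (x - 1); rewrite subrKC; apply; lra.
Qed.

Lemma ln_ge_sub1 (R : realType) (x : R) : 0 < x -> 1 - x^-1 <= ln x.
Proof.
move=> x0; rewrite -lerN2 opprB -lnV ?posrE //.
by apply: ln_le_sub1; rewrite invr_gt0.
Qed.

Lemma ln1D_sub (R : realType) (u : R) : - (1 / 2) <= u -> `|ln (1 + u) - u| <= 2 * u ^+ 2.
Proof.
move=> u2; have u1 : 0 < 1 + u by lra.
have h1 := ln_le_sub1 u1; have h2 := ln_ge_sub1 u1.
have E : u - (1 - (1 + u)^-1) <= 2 * u ^+ 2.
  have -> : u - (1 - (1 + u)^-1) = u ^+ 2 / (1 + u) by field; rewrite gt_eqF.
  by rewrite ler_pdivrMr //; have := sqr_ge0 u; nra.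
have := sqr_ge0 u; rewrite ler_norml => ?; apply/andP; split; lra.
Qed.

Lemma ReD (R : realType) (v w : R[i]) : Re (v + w) = Re v + Re w.
Proof. by case: v w => a b []. Qed.
Lemma ImD (R : realType) (v w : R[i]) : Im (v + w) = Im v + Im w.
Proof. by case: v w => a b []. Qed.
Lemma ReN (R : realType) (w : R[i]) : Re (- w) = - Re w.
Proof. by case: w. Qed.
Lemma ImN (R : realType) (w : R[i]) : Im (- w) = - Im w.
Proof. by case: w. Qed.

(** The radius [3/4] is the one met for small arguments, where [h] is [m^-s v] with [m >= 2] and
    [normc v < 3/2]. *)
Lemma clog1D_le (R : realType) (h : R[i]) : normc h <= 3 / 4 ->
  normc (clog (1 + h)) <= 8 * normc h.
Proof.
move=> h34; have h0 := normc_ge0 h.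
have r := Re_le_normc h; have i := Im_le_normc h.
have R0 : 1 / 4 <= Re (1 + h).
  by rewrite ReD /=; move: r; rewrite ler_norml => /andP[? ?]; lra.
have nU : normc (1 + h) <= 1 + normc h by have := normcD 1 h; rewrite Normc.normc1.
have nL : 1 - normc h <= normc (1 + h).
  by rewrite lerBlDr; have := normcB (1 + h) h; rewrite addrK Normc.normc1.
have n0 : 0 < normc (1 + h) by lra.
apply: le_trans (normc_le_ReIm _) _; rewrite Re_clog Im_clog.
have -> : 8 * normc h = 4 * normc h + 4 * normc h by ring.
apply: lerD.
  have l1 := ln_le_sub1 n0; have l2 := ln_ge_sub1 n0.
  have : (normc (1 + h))^-1 <= 1 + 4 * normc h.
    rewrite -[leLHS]mul1r ler_pdivrMr //; nra.
  by move=> ?; rewrite ler_norml; apply/andP; split; lra.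
rewrite carg_atan; last by lra.
apply: le_trans (atan_le _) _; rewrite normrM normfV (@ger0_norm _ (Re _)); last by lra.
rewrite ler_pdivrMr; last by lra.
have -> : Im (1 + h) = Im h by rewrite ImD add0r.
apply: le_trans i _; nra.
Qed.

(** The real part is half the logarithm of [1 + (2 Re h + |h|^2)]; the imaginary part is
    [atan (b / (1 + a))], compared first with [b / (1 + a)] and then with [b]. *)
Lemma clog1D_sub (R : realType) (h : R[i]) : normc h <= 1 / 5 ->
  normc (clog (1 + h) - h) <= 10 * normc h ^+ 2.
Proof.
move=> h5; have h0 := normc_ge0 h.
have r := Re_le_normc h; have i := Im_le_normc h.
have sq := sqr_normcE h.
set n := normc h in sq r i h0 h5 *.
set a := Re h in sq r i *; set b := Im h in sq r i *.
have ra : Re (1 + h) = 1 + a by rewrite ReD.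
have ib : Im (1 + h) = b by rewrite ImD add0r.
move: (r) (i); rewrite !ler_norml => /andP[a1 a2] /andP[b1 b2].
apply: le_trans (normc_le_ReIm _) _; rewrite !(ReD, ReN, ImD, ImN) Re_clog Im_clog -/a -/b.
have -> : 10 * n ^+ 2 = 6 * n ^+ 2 + 4 * n ^+ 2 by ring.
have n2 : n ^+ 2 <= n / 5 by nra.
apply: lerD.
  have E : ln (normc (1 + h)) = ln (1 + (2 * a + n ^+ 2)) / 2.
    apply: (mulIf (_ : (2 : R) != 0)) => //; rewrite divfK // mulr_natr -lnXn; last first.
      by rewrite normc_gt0 slit_neq0 // /slit ra; apply/orP; right; lra.
    by rewrite sqr_normcE ra ib sq; congr ln; ring.
  have := @ln1D_sub R (2 * a + n ^+ 2).
  have -> : - (1 / 2) <= 2 * a + n ^+ 2 by have := sqr_ge0 n; lra.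
  move=> /(_ isT); rewrite E => /ler_normlP [h1 h2].
  have : (2 * a + n ^+ 2) ^+ 2 <= 5 * n ^+ 2.
    have : - (11 / 5 * n) <= 2 * a + n ^+ 2 <= 11 / 5 * n by apply/andP; have := sqr_ge0 n; split; lra.
    by move=> /andP[? ?]; nra.
  by move=> ?; rewrite ler_norml; have := sqr_ge0 n; move=> ?; apply/andP; split; lra.
rewrite carg_atan ra ?ib; last by lra.
have v : `|b / (1 + a)| <= 5 / 4 * n.
  rewrite normrM normfV (@ger0_norm _ (1 + a)); last by lra.
  rewrite ler_pdivrMr; last by lra.
  apply: le_trans i _; nra.
have e1 := atan_sub (b / (1 + a)).
have e2 : `|b / (1 + a) - b| <= 5 / 4 * n ^+ 2.
  have -> : b / (1 + a) - b = - (b * a) / (1 + a) by field; rewrite gt_eqF //; lra.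
  rewrite normrM normfV (@ger0_norm _ (1 + a)); last by lra.
  rewrite ler_pdivrMr; last by lra.
  rewrite normrN normrM.
  have : `|b| * `|a| <= n * n by rewrite ler_pM.
  have := sqr_ge0 n; rewrite expr2; nra.
have e3 : `|b / (1 + a)| ^+ 3 <= 5 / 2 * n ^+ 2.
  apply: le_trans (_ : (5 / 4 * n) ^+ 3 <= _); first by rewrite lerXn2r ?nnegrE //; lra.
  rewrite exprMn exprS; have := sqr_ge0 n; rewrite [n ^+ 3]exprS; nra.
rewrite -(subrKA (b / (1 + a))); apply: le_trans (ler_normD _ _) _.
by have := sqr_ge0 n; lra.
Qed.

(** * Forward differences *)

Section ForwardDifference.
Variables (R : realType) (V : zmodType).
Fixpoint fd (k : nat) (b : R -> V) (t : R) : V :=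
  if k is k'.+1 then fd k' b (t + 1) - fd k' b t else b t.
End ForwardDifference.

Section FiniteDifferences.
Variable R : realType.
Implicit Types (t : R) (k n i j : nat).

Lemma natrS1 t k : t + 1 + k%:R = t + k.+1%:R.
Proof. by rewrite -addrA -(natrD _ 1 k). Qed.

Lemma fd_ext (V : zmodType) k (b c : R -> V) t :
  (forall j, (j <= k)%N -> b (t + j%:R) = c (t + j%:R)) -> fd k b t = fd k c t.
Proof.
elim: k t => [|k IH] t H /=; first by have := H 0%N isT; rewrite addr0.
congr (_ - _); apply: IH => j jk; last by apply: H; rewrite leqW.
by rewrite natrS1; apply: H.
Qed.

Lemma fdD (V : zmodType) k (b c : R -> V) t :
  fd k (fun u => b u + c u) t = fd k b t + fd k c t.
Proof. by elim: k t => [//|k IH] t /=; rewrite !IH opprD addrACA. Qed.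

Lemma fdZ (A : pzRingType) k (a : A) (b : R -> A) t :
  fd k (fun u => a * b u) t = a * fd k b t.
Proof. by elim: k t => [//|k IH] t /=; rewrite !IH mulrBr. Qed.

Lemma fd_const (V : zmodType) k (a : V) t : fd k.+1 (fun=> a) t = 0.
Proof.
elim: k t => [|k IH] t; first exact: subrr.
by rewrite -[LHS]/(fd k.+1 (fun=> a) (t + 1) - fd k.+1 (fun=> a) t) !IH subrr.
Qed.

Lemma fd_morph (V W : zmodType) (f : {additive V -> W}) k (b : R -> V) t :
  fd k (fun u => f (b u)) t = f (fd k b t).
Proof. by elim: k t => [//|k IH] t /=; rewrite !IH raddfB. Qed.

Lemma fd_leibniz (A : comPzRingType) n (f g : R -> A) t :
  fd n (fun u => f u * g u) t =
  \sum_(k < n.+1) (fd k f t * fd (n - k) g (t + k%:R)) *+ 'C(n, k).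
Proof.
elim: n t => [|n IH] t; first by rewrite big_ord1 /= addr0.
rewrite [LHS]/= !IH.
pose F k := fd k f t; pose G k j := fd j g (t + k%:R).
(* The difference of [f] at [t + 1] splits as [F k.+1 + F k]. The second half combines with the sum
   at [t] into differences of [g] of one order more, and Pascal's rule merges the two sums. *)
have -> : \sum_(k < n.+1) (fd k f (t + 1) * fd (n - k) g (t + 1 + k%:R)) *+ 'C(n, k)
  = \sum_(k < n.+1) (F k.+1 * G k.+1 (n - k)%N) *+ 'C(n, k)
   + \sum_(k < n.+1) (F k * G k.+1 (n - k)%N) *+ 'C(n, k).
  rewrite -big_split; apply: eq_bigr => k _ /=.
  by rewrite natrS1 -mulrnDl -mulrDl /F /= subrK.
rewrite -addrA -sumrB.
under [X in _ + X]eq_bigr => k _ do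
  rewrite -mulrnBl -mulrBr /G -natrS1 addrAC -[_ - _]/(fd (n - k).+1 g (t + k%:R)) -subSn -1?ltnS //.
rewrite -[X in _ + X]/(\sum_(k < n.+1) (F k * G k (n.+1 - k)%N) *+ 'C(n, k)).
rewrite [RHS]big_ord_recl bin0 mulr1n subn0.
rewrite [in RHS](eq_bigr (fun k : 'I_n.+1 => (F k.+1 * G k.+1 (n - k)%N) *+ 'C(n, k.+1)
   + (F k.+1 * G k.+1 (n - k)%N) *+ 'C(n, k))); last first.
  by move=> k _; rewrite /= /bump /= add1n subSS binS mulrnDr.
rewrite big_split /= addrA addrC; congr (_ + _).
rewrite big_ord_recl bin0 mulr1n subn0 [in RHS]big_ord_recr /= bin_small //.
congr (_ + _); rewrite mulr0n addr0.
by apply: eq_bigr => k _; rewrite /bump /= add1n subSS.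
Qed.

Lemma fd_derive k (b b' : R -> R) t :
  (forall j, (j <= k)%N -> is_derive (t + j%:R) 1 b (b' (t + j%:R))) ->
  is_derive t 1 (fd k b) (fd k b' t).
Proof.
elim: k t => [|k IH] t H.
  have := H 0%N isT; rewrite addr0 => h.
  by rewrite (_ : fd 0 b = b).
have h1 : is_derive (t + 1) 1 (fd k b) (fd k b' (t + 1)).
  by apply: IH => j jk; rewrite natrS1; apply: H.
have h2 : is_derive t 1 (fd k b) (fd k b' t).
  by apply: IH => j jk; apply: H; rewrite leqW.
rewrite (_ : fd k.+1 b = (fd k b \o (fun u => u + 1)) - fd k b); last first.
  by apply/funext => u.
have h3 : is_derive t 1 (fd k b \o (fun u => u + 1)) (fd k b' (t + 1)).
  rewrite -[fd k b' (t + 1)]mulr1; apply: is_derive1_comp.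
  by rewrite -[X in is_derive _ _ _ X]addr0; apply: is_deriveD.
exact: is_deriveB.
Qed.

Definition falling (a : R) n : R := \prod_(j < n) (a - j%:R).

Lemma fallingS a n : falling a n.+1 = a * falling (a - 1) n.
Proof.
rewrite /falling big_ord_recl subr0; congr (_ * _); apply: eq_bigr => j _.
by rewrite lift0 -natr1; lra.
Qed.

(** The range covers the exponents [1] and [s + 1] used later. Every factor [a - j] with [j >= 1] is
    at most [j + 1] in absolute value; the first factor costs the constant 3. *)
Lemma falling_le a n : 0 <= a <= 3 -> `|falling a n| <= 3 * n`!%:R.
Proof.
move=> /andP[a0 a3]; rewrite /falling; elim: n => [|n IH].
  by rewrite big_ord0 normr1 fact0 mulr1 ler1n.
rewrite big_ord_recr /= normrM factS natrM.
case: n IH => [|n] IH; first by rewrite big_ord0 normr1 mul1r subr0 !mulr1 ger0_norm.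
rewrite mulrC mulrCA ler_pM //.
rewrite ler_norml -!natr1; have : 0 <= n%:R :> R by []. 
by move=> ?; apply/andP; split; lra.
Qed.

(** The mean value theorem, applied [i] times: [falling a i * x^(a - i)] is the [i]-th derivative of
    the power at an intermediate point. *)
Lemma fd_powR (a : R) i t : 0 < t -> exists2 x, t <= x <= t + i%:R &
  fd i (fun u => u `^ a) t = falling a i * x `^ (a - i%:R).
Proof.
elim: i a t => [|i IH] a t t0.
  by exists t; rewrite ?addr0 ?lexx // /falling big_ord0 mul1r subr0.
pose g' u := a * fd i (fun v => v `^ (a - 1)) u.
have D (u : R) : 0 < u -> is_derive u 1 (fd i (fun v => v `^ a)) (g' u).
  move=> u0; rewrite /g' -fdZ; apply: fd_derive => j _.
  by apply: is_derive1_powR; rewrite ltr_pwDl.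
have [|||y] := @MVT R (fd i (fun v => v `^ a)) g' t (t + 1).
- by rewrite ltrDl.
- by move=> y; rewrite in_itv /= => /andP[ty _]; apply: D; exact: lt_trans ty.
- apply: derivable_within_continuous => y; rewrite in_itv /= => /andP[ty _].
  by have [] := D _ (lt_le_trans t0 ty).
rewrite in_itv /= => /andP[ty yt] ->; rewrite /g'.
have [x /andP[yx xy] ->] := IH (a - 1) y (lt_trans t0 ty).
exists x.
  rewrite (le_trans (ltW ty)) //= (le_trans xy) // -natrS1 lerD2r ltW //.
have -> : t + 1 - t = 1 by ring.
by rewrite fallingS mulr1 -natr1 [i%:R + 1]addrC opprD addrA mulrA.
Qed.

(** The two powers are estimated at opposite ends of the sampled interval; the right end [m] is
    where [fd_inv_le] compares with the value of [e]. *)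
Lemma fd_powR_le (a : R) i t (m : R) : 0 <= a <= 3 -> 0 < t -> t + i%:R <= m ->
  `|fd i (fun u => u `^ a) t| <= 3 * i`!%:R * t ^- i * m `^ a.
Proof.
move=> a3 t0 tm; have [x /andP[tx xt] ->] := fd_powR a i t0.
have x0 : 0 < x by exact: lt_le_trans tx.
rewrite normrM -[leRHS]mulrA ler_pM ?falling_le //.
rewrite ger0_norm ?powR_ge0 // powRD; last by rewrite (gt_eqF x0) implybT.
rewrite powRN powR_mulrn ?(ltW x0) // mulrC ler_pM ?invr_ge0 ?exprn_ge0 ?powR_ge0 ?(ltW x0) //.
  by rewrite lef_pV2 ?posrE ?exprn_gt0 // lerXn2r ?nnegrE ?(ltW x0) ?(ltW t0).
apply: ge0_ler_powR; rewrite ?nnegrE ?(ltW x0) //; first by case/andP: a3.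
  by apply: le_trans tm; rewrite addr_ge0 // ltW.
exact: le_trans tm.
Qed.

Lemma sum_geom_lt (B : R) n : B * \sum_(k < n) (1 + B) ^+ k = (1 + B) ^+ n - 1.
Proof. by rewrite subrX1 addrAC subrr add0r. Qed.

(* The finite-difference counterpart of Cauchy's estimates for 1 / e. *)
Lemma fd_inv_le (e f : R -> R[i]) t M (B : R) : 0 <= B -> 0 < t ->
  (forall j, (j <= M)%N -> f (t + j%:R) * e (t + j%:R) = 1) ->
  (forall i j, (0 < i)%N -> (i + j <= M)%N ->
     normc (fd i e (t + j%:R)) <= B * i`!%:R * t ^- i * normc (e (t + (i + j)%:R))) ->
  normc (fd M f t) <= normc (f t) * M`!%:R * ((1 + B) / t) ^+ M.
Proof.
move=> B0 t0 fe He.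
have [n nM] := ubnP M; elim: n M nM fe He => // n IH M; rewrite ltnS => Mn fe He.
case: M Mn fe He => [|M] Mn fe He; first by rewrite /= fact0 expr0 !mulr1.
have eM0 : 0 < normc (e (t + M.+1%:R)).
  rewrite normc_gt0; apply/eqP => e0; have := fe _ (leqnn _).
  by rewrite e0 mulr0 => /esym /eqP; rewrite oner_eq0.
rewrite -(ler_pM2r eM0) -Normc.normcM.
(* Differences of the constant 1 vanish, so the last term of Leibniz's formula, the top difference
   of [f] times [e (t + M + 1)], is minus the sum of the others, which contain only lower
   differences of [f]. *)
have : fd M.+1 (fun u => f u * e u) t = 0.
  by rewrite (@fd_ext _ _ _ (fun=> 1)) ?fd_const.
rewrite fd_leibniz big_ord_recr /= subnn binn mulr1n => /eqP.
rewrite addrC addr_eq0 => /eqP ->; rewrite normcN.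
apply: le_trans (normc_sum _ _ _) _.
have Q k : (k <= M)%N -> normc ((fd k f t * fd (M.+1 - k) e (t + k%:R)) *+ 'C(M.+1, k)) <=
   normc (f t) * M.+1`!%:R * t ^- M.+1 * normc (e (t + M.+1%:R)) * (B * (1 + B) ^+ k).
  move=> kM; rewrite normcMn Normc.normcM.
  have h1 : normc (fd k f t) <= normc (f t) * k`!%:R * ((1 + B) / t) ^+ k.
    apply: IH; first by apply: leq_ltn_trans Mn.
      by move=> j jk; apply: fe; rewrite (leq_trans jk) // leqW.
    by move=> i j i0 ij; apply: He; rewrite // (leq_trans ij) // leqW.
  have h2 : normc (fd (M.+1 - k) e (t + k%:R)) <=
      B * (M.+1 - k)`!%:R * t ^- (M.+1 - k) * normc (e (t + M.+1%:R)).
    have := He (M.+1 - k)%N k; rewrite subnK ?(leqW kM) // subn_gt0 ltnS kM leqnn.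
    by apply.
  rewrite -[leLHS]mulr_natr.
  have := ler_pM (normc_ge0 _) (normc_ge0 _) h1 h2.
  have c0 : (0 : R) <= 'C(M.+1, k)%:R by [].
  move=> /(ler_wpM2r c0) /le_trans; apply; rewrite le_eqVlt; apply/orP; left; apply/eqP.
  have := bin_fact (leqW kM) => /(congr1 (fun u => u%:R : R)).
  rewrite !natrM => <-.
  have -> : t ^- M.+1 = t ^- k * t ^- (M.+1 - k).
    by rewrite -invfM -exprD subnKC // leqW.
  rewrite expr_div_n; ring.
set W := normc (f t) * M.+1`!%:R * t ^- M.+1 * normc (e (t + M.+1%:R)) in Q.
apply: le_trans (_ : \sum_(k < M.+1) W * (B * (1 + B) ^+ k) <= _).
  by apply: ler_sum => k _; apply: Q; rewrite -ltnS.
(* The terms [B (1 + B)^k] add up to [(1 + B)^(M + 1) - 1]: the rate [1 + B] reproduces itself. *)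
rewrite -!mulr_sumr sum_geom_lt.
rewrite expr_div_n.
have -> : normc (f t) * M.+1`!%:R * ((1 + B) ^+ M.+1 / t ^+ M.+1) * normc (e (t + M.+1%:R))
  = W * (1 + B) ^+ M.+1 by rewrite /W; ring.
rewrite ler_wpM2l ?gerBl //; rewrite !mulr_ge0 ?normc_ge0 ?invr_ge0 ?exprn_ge0 ?(ltW t0) //.
Qed.

End FiniteDifferences.

(** Writing [w + h = w (1 + h / w)] reduces the expansion at [w] to the one at 1. *)
Lemma clog_expand (R : realType) (w : R[i]) : slit w ->
  exists2 d : R, 0 < d & forall h, normc h <= d ->
    normc (clog (w + h) - clog w - h / w) <= 10 / normc w ^+ 2 * normc h ^+ 2.
Proof.
move=> sw; have w0 := slit_neq0 sw; have n0 : 0 < normc w by rewrite normc_gt0.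
have a0 := carg_lt_pi sw.
(* The bound [1/5] serves [clog1D_sub]; the other one makes [8 |u|], which bounds the argument of
   [1 + u], at most half of [pi - |carg w|], so that [clogM] applies. *)
pose d1 : R := Num.min (1 / 5) ((pi - `|carg w|) / 16).
have d10 : 0 < d1 by rewrite lt_min; apply/andP; split; [lra|rewrite divr_gt0 //; lra].
exists (normc w * d1); first by rewrite mulr_gt0.
move=> h hd; have h0 := normc_ge0 h; set u := h / w.
have nu : normc u = normc h / normc w by rewrite Normc.normcM Normc.normcV.
have u1 : normc u <= d1 by rewrite nu ler_pdivrMr // mulrC.
have [u5 u16] : normc u <= 1 / 5 /\ normc u <= (pi - `|carg w|) / 16.
  by split; apply: le_trans u1 _; rewrite ge_min lexx ?orbT.
have c8 : `|carg (1 + u)| <= 8 * normc u.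
  apply: le_trans (clog1D_le _); last by lra.
  by rewrite -Im_clog Im_le_normc.
have R0 : 0 < Re (1 + u).
  by have := Re_le_normc u; rewrite ReD /= ler_norml => /andP[? ?]; lra.
have -> : w + h = w * (1 + u) by rewrite mulrDr mulr1 mulrC divfK.
rewrite clogM //; first last.
- by lra.
- by rewrite slit_neq0 // /slit R0 orbT.
rewrite [clog w + _]addrC addrK; apply: le_trans (clog1D_sub u5) _.
by rewrite nu expr_div_n mulrA mulrAC.
Qed.

Lemma normC_normc (R : realType) (z : R[i]) : `|z| = ((normc z)%:C)%C.
Proof. by rewrite normc_def; case: z. Qed.

Lemma clog_differentiable (R : realType) (w : R[i]^o) : slit w ->
  differentiable (@clog R : R[i]^o -> R[i]^o) w.
Proof.
move=> sw; have w0 := slit_neq0 sw.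
have n0 : 0 < normc w by rewrite normc_gt0.
have [d d0 Hd] := clog_expand sw.
apply/derivable1_diffP/cvg_ex; exists (w^-1).
apply/cvgrPdist_le => e e0.
(* In the order of [R[i]], a positive element is a positive real. *)
have [r r0 er] : exists2 r : R, 0 < r & e = (r%:C)%C.
  exists (Re e); first by move: e0; rewrite ltcE => /andP[].
  by move: e0; rewrite ltcE => /andP[/eqP i0 _]; case: e i0 => ? ? /= ->.
have B0 : 0 < 10 / normc w ^+ 2 by rewrite divr_gt0 // exprn_gt0.
pose m := Num.min d (r / (10 / normc w ^+ 2)).
have m0 : 0 < m by rewrite lt_min d0 divr_gt0.
have mC : 0 < (m%:C)%C :> R[i] by rewrite ltcR.
near=> h.
have hn0 : h != 0 by near: h; exact: nbhs_dnbhs_neq.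
have hm : `|h| <= (m%:C)%C.
  by near: h; apply: dnbhs0_le.
have hN : 0 < normc h by rewrite normc_gt0.
move: hm; rewrite normC_normc lecR le_min => /andP[hd hr].
rewrite distrC normC_normc er lecR.
have -> : h^-1 *: (clog (h *: 1 + w) - clog w) - w^-1 =
   h^-1 * (clog (w + h) - clog w - h / w).
  have -> : h *: 1 + w = w + h by rewrite addrC; congr (_ + _); exact: mulr1.
  rewrite [RHS]mulrBr mulKf //.
rewrite Normc.normcM Normc.normcV mulrC ler_pdivrMr //.
apply: le_trans (Hd _ hd) _; rewrite expr2 mulrA ler_wpM2r ?normc_ge0 //.
by rewrite mulrC -ler_pdivlMr.
Unshelve. all: by end_near. Qed.

(** * Differences of logarithms *)

(** A quadratic error bound passes through sums and limits, so the series [logW] can be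
    differentiated with it term by term. *)
Lemma is_derive_quad (R : realType) (f : R -> R) (x l d K : R) : 0 < d ->
  (forall h, `|h| <= d -> `|f (x + h) - f x - l * h| <= K * h ^+ 2) ->
  is_derive x 1 f l.
Proof.
move=> d0 H.
have K0 : 0 <= K.
  have := le_trans (normr_ge0 _) (H d _); rewrite gtr0_norm // => /(_ (lexx _)).
  by rewrite pmulr_lge0 // exprn_gt0.
have C : h^-1 *: (f (h *: 1 + x) - f x) @[h --> 0^'] --> l.
  apply/cvgrPdist_le => e e0; near=> h.
  have hn0 : h != 0 by near: h; exact: nbhs_dnbhs_neq.
  have hd : `|h| <= d by near: h; apply: dnbhs0_le.
  have hK : `|h| <= e / (K + 1).
    by near: h; apply: dnbhs0_le; rewrite divr_gt0 // ltr_wpDl.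
  have h0 : 0 < `|h| by rewrite normr_gt0.
  have -> : h *: 1 + x = x + h by rewrite addrC; congr (_ + _); exact: mulr1.
  have -> : l - h^-1 *: (f (x + h) - f x) = - (h^-1 * (f (x + h) - f x - l * h)).
    by rewrite [in RHS]mulrBr mulrCA mulVf // mulr1 opprB.
  rewrite normrN normrM normfV mulrC ler_pdivrMr //.
  apply: le_trans (H _ hd) _; rewrite -(real_normK (num_real h)) expr2 mulrA ler_pM2r //.
  move: hK; rewrite ler_pdivlMr ?ltr_wpDl // mulrC mulrDl mul1r; apply: le_trans.
  by rewrite lerDl.
by split; [apply/cvg_ex; exists l|apply: cvg_lim].
Unshelve. all: by end_near. Qed.

Section ClogAlongReals.
Variables (R : realType) (z : R[i]) (x : R).
Hypothesis zx : slit (z + (x%:C)%C).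

Let expand : exists d K, 0 < d /\ forall h : R, `|h| <= d ->
  normc (clog (z + ((x + h)%:C)%C) - clog (z + (x%:C)%C) - (h%:C)%C / (z + (x%:C)%C))
    <= K * h ^+ 2.
Proof.
have [d d0 H] := clog_expand zx.
exists d, (10 / normc (z + (x%:C)%C) ^+ 2); split=> // h hd.
have := H (h%:C)%C; rewrite normcR real_normK ?num_real // => /(_ hd).
by rewrite rmorphD /= addrA.
Qed.

Lemma is_derive_Re_clog : is_derive x 1 (fun u => Re (clog (z + (u%:C)%C))) (Re (z + (x%:C)%C)^-1).
Proof.
have [d [K [d0 H]]] := expand; apply: (is_derive_quad d0 (K := K)) => h hd.
apply: le_trans (H h hd); apply: le_trans (Re_le_normc _).
rewrite le_eqVlt; apply/orP; left; apply/eqP; congr (`| _ |).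
rewrite !(ReD, ReN); congr (_ - _).
by case: (_^-1) => a b /=; rewrite mul0r subr0 mulrC.
Qed.

Lemma is_derive_Im_clog : is_derive x 1 (fun u => Im (clog (z + (u%:C)%C))) (Im (z + (x%:C)%C)^-1).
Proof.
have [d [K [d0 H]]] := expand; apply: (is_derive_quad d0 (K := K)) => h hd.
apply: le_trans (H h hd); apply: le_trans (Im_le_normc _).
rewrite le_eqVlt; apply/orP; left; apply/eqP; congr (`| _ |).
rewrite !(ImD, ImN); congr (_ - _).
by case: (_^-1) => a b /=; rewrite mul0r addr0 mulrC.
Qed.
End ClogAlongReals.

Lemma Re_fd (R : realType) k (b : R -> R[i]) t : Re (fd k b t) = fd k (fun u => Re (b u)) t.
Proof. by elim: k t => [//|k IH] t /=; rewrite ReD ReN !IH. Qed.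
Lemma Im_fd (R : realType) k (b : R -> R[i]) t : Im (fd k b t) = fd k (fun u => Im (b u)) t.
Proof. by elim: k t => [//|k IH] t /=; rewrite ImD ImN !IH. Qed.

Lemma Re_scale (R : realType) (a : R) (w : R[i]) : Re ((a%:C)%C * w) = a * Re w.
Proof. by case: w => u v /=; rewrite mul0r subr0. Qed.
Lemma Im_scale (R : realType) (a : R) (w : R[i]) : Im ((a%:C)%C * w) = a * Im w.
Proof. by case: w => u v /=; rewrite mul0r addr0. Qed.

Lemma realMVT_le (R : realType) (f f' : R -> R) (t K : R) :
  (forall u, t <= u <= t + 1 -> is_derive u 1 f (f' u)) ->
  (forall u, t <= u <= t + 1 -> `|f' u| <= K) -> `|f (t + 1) - f t| <= K.
Proof.
move=> D H; have [|||y] := @MVT R f f' t (t + 1).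
- by rewrite ltrDl.
- by move=> y; rewrite in_itv /= => /andP[ty yt]; apply: D; rewrite !ltW.
- apply: derivable_within_continuous => y; rewrite in_itv /= => ty.
  by have [] := D _ ty.
rewrite in_itv /= => /andP[ty yt] ->; have -> : t + 1 - t = 1 by ring.
by rewrite mulr1; apply: H; rewrite !ltW.
Qed.

(* Shifting by [t^-s] instead of multiplying by [t^s] only changes the
   logarithm by [-s ln t], and keeps it bounded as [z] tends to [0]. *)
Definition shifted_log (R : realType) (s : R) (z : R[i]) (t : R) : R[i] :=
  clog (z + ((t `^ (- s))%:C)%C).

(** Quantitative distance from the singularity [- t^-s], rescaled by [t^s]. Being relative to
    [1 + |z| t^s], it is uniform for small and for large [z t^s]. *)
Definition separated (R : realType) (s c : R) (z : R[i]) (t : R) : Prop :=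
  slit (1 + z * ((t `^ s)%:C)%C) /\
  c * (1 + normc z * t `^ s) <= normc (1 + z * ((t `^ s)%:C)%C).

(** * Bounded differences of [shifted_log] in its index *)

Section BlogDifferences.
Variables (R : realType) (s c : R).
Hypotheses (s12 : 0 <= s <= 2) (c0 : 0 < c).
Implicit Types (z : R[i]) (t u : R).

Lemma shift_factor z t : 0 < t ->
  z + ((t `^ (- s))%:C)%C = ((t `^ (- s))%:C)%C * (1 + z * ((t `^ s)%:C)%C).
Proof.
move=> t0; rewrite mulrDr mulr1 mulrCA -rmorphM -powRD ?addNr ?powRr0 ?mulr1 ?rmorph1 ?mulr1 1?addrC //.
by rewrite (gt_eqF t0) implybT.
Qed.

Lemma slit_pos (a : R) (w : R[i]) : 0 < a -> slit ((a%:C)%C * w) = slit w.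
Proof.
by move=> a0; rewrite /slit Re_scale Im_scale mulf_eq0 (gt_eqF a0) /= pmulr_rgt0.
Qed.

Lemma separated_slit z t : 0 < t -> separated s c z t -> slit (z + ((t `^ (- s))%:C)%C).
Proof. by move=> t0 [sl _]; rewrite shift_factor // slit_pos // powR_gt0. Qed.

(** The derivative of [shifted_log] in [t] is [- s / e]. Writing [t] as a power with exponent 1 lets
    [fd_powR_le] treat both terms alike. *)
Let e z t : R[i] := ((t `^ 1)%:C)%C + z * ((t `^ (s + 1))%:C)%C.

Lemma eE z t : 0 < t -> e z t = (t%:C)%C * (1 + z * ((t `^ s)%:C)%C).
Proof.
move=> t0; rewrite /e powRr1 ?ltW // mulrDr mulr1 mulrCA -rmorphM /=; congr (_ + _ * (_)%:C%C).
by rewrite addrC powRD ?powRr1 ?ltW // (gt_eqF t0) implybT.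
Qed.

Lemma is_derive_shift t : 0 < t ->
  is_derive t 1 (fun v => v `^ (- s)) (- s * t `^ (- s - 1)).
Proof. by move=> t0; exact: is_derive1_powR. Qed.

Lemma shift_e z t : 0 < t -> separated s c z t ->
  ((- s * t `^ (- s - 1))%:C)%C * (z + ((t `^ (- s))%:C)%C)^-1 = ((- s)%:C)%C * (e z t)^-1.
Proof.
move=> t0 g; have w0 : 1 + z * ((t `^ s)%:C)%C != 0 by case: g => /slit_neq0.
rewrite shift_factor // eE // rmorphM /= -mulrA; congr (_ * _).
rewrite !invfM mulrA; congr (_ * _).
rewrite -(fmorphV (real_complex R)) -(fmorphV (real_complex R)) -rmorphM; congr (_%:C)%C.
by rewrite -powRN opprK -powRD ?(addrAC _ _ s) ?addNr ?add0r ?powR_inv1 ?ltW // (gt_eqF t0) implybT.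
Qed.

Lemma is_derive_Re_shifted_log z t : 0 < t -> separated s c z t ->
  is_derive t 1 (fun v => Re (shifted_log s z v)) (- s * Re (e z t)^-1).
Proof.
move=> t0 g; rewrite -Re_scale -(shift_e t0 g) Re_scale mulrC.
apply: (@is_derive1_comp _ (fun u => Re (clog (z + (u%:C)%C))) (fun v => v `^ (- s))).
  by apply: is_derive_Re_clog; exact: separated_slit.
exact: is_derive_shift.
Qed.

Lemma is_derive_Im_shifted_log z t : 0 < t -> separated s c z t ->
  is_derive t 1 (fun v => Im (shifted_log s z v)) (- s * Im (e z t)^-1).
Proof.
move=> t0 g; rewrite -Im_scale -(shift_e t0 g) Im_scale mulrC.
apply: (@is_derive1_comp _ (fun u => Im (clog (z + (u%:C)%C))) (fun v => v `^ (- s))).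
  by apply: is_derive_Im_clog; exact: separated_slit.
exact: is_derive_shift.
Qed.

Lemma normc_e_ge z t : 0 < t -> separated s c z t ->
  c * (t * (1 + normc z * t `^ s)) <= normc (e z t).
Proof.
move=> t0 [_ g]; rewrite eE // Normc.normcM normcR gtr0_norm // mulrCA.
by rewrite ler_wpM2l // ltW.
Qed.

(** The two terms of [e] are bounded separately, giving [m (1 + |z| m^s)] at the right end [m];
    [separated] says that they do not cancel there, so this is at most [|e z m| / c]. *)
Lemma fd_e_le z t i j : 0 < t -> separated s c z (t + (i + j)%:R) ->
  normc (fd i (e z) (t + j%:R)) <=
    3 / c * i`!%:R * t ^- i * normc (e z (t + (i + j)%:R)).
Proof.
move=> t0 g; set m := t + (i + j)%:R in g *.
have m0 : 0 < m by rewrite ltr_pwDl.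
have tj0 : 0 < t + j%:R by rewrite ltr_pwDl.
have tm : t + j%:R + i%:R <= m by rewrite /m natrD addrA addrAC.
rewrite fdD fdZ (fd_morph (real_complex R)) (fd_morph (real_complex R)).
apply: le_trans (normcD _ _) _; rewrite Normc.normcM !normcR.
have /andP[s0 s2] := s12.
have h1 := @fd_powR_le R 1 i (t + j%:R) m _ tj0 tm.
have h2 := @fd_powR_le R (s + 1) i (t + j%:R) m _ tj0 tm.
have {}h1 := h1 (_ : 0 <= 1 <= 3); have {}h2 := h2 (_ : 0 <= s + 1 <= 3).
apply: le_trans (lerD (h1 _) (ler_wpM2l (normc_ge0 _) (h2 _))) _; first lra.
  by apply/andP; split; lra.
have -> : 3 * i`!%:R / (t + j%:R) ^+ i * m `^ 1 +
  normc z * (3 * i`!%:R / (t + j%:R) ^+ i * m `^ (s + 1)) =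
  3 * i`!%:R / (t + j%:R) ^+ i * (m * (1 + normc z * m `^ s)).
  rewrite powRD ?(gt_eqF m0) ?implybT // powRr1 ?ltW //; ring.
have := normc_e_ge m0 g; rewrite -ler_pdivlMl // => h3.
have -> : 3 / c * i`!%:R / t ^+ i * normc (e z m) =
   (3 * i`!%:R / t ^+ i) * (c^-1 * normc (e z m)) by ring.
have p : 0 <= normc z * m `^ s by rewrite mulr_ge0 ?normc_ge0 ?powR_ge0.
apply: ler_pM => //.
- by rewrite !mulr_ge0 ?invr_ge0 ?exprn_ge0 ?ltW.
- by rewrite mulr_ge0 ?ltW //; lra.
rewrite ler_wpM2l ?mulr_ge0 // lef_pV2 ?posrE ?exprn_gt0 // lerXn2r ?nnegrE ?(ltW t0) ?(ltW tj0) //.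
by rewrite lerDl.
Qed.

Lemma fact_le_expn M : (M`! <= M ^ M)%N.
Proof.
elim: M => // M IH; rewrite factS expnS leq_mul2l /=.
by apply: leq_trans IH _; case: M => // M; rewrite leq_exp2r.
Qed.

(** With [B = 3 / c], the factor [M! ((1 + B) / t)^M] from [fd_inv_le] is at most 1, because
    [M! <= M^M] and [(1 + B) M <= t]. *)
Lemma fd_inv_e_le z t M : 1 <= t -> (1 + 3 / c) * M%:R <= t ->
  (forall j, (j <= M)%N -> separated s c z (t + j%:R)) ->
  normc (fd M (fun u => (e z u)^-1) t) <= c^-1.
Proof.
move=> t1 tM g; have t0 : 0 < t by lra.
have B0 : 0 <= 3 / c by rewrite divr_ge0 // ltW.
have e0 j : (j <= M)%N -> e z (t + j%:R) != 0.
  move=> jM; have tj0 : 0 < t + j%:R by rewrite ltr_pwDl.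
  rewrite eE // mulf_neq0 //.
    by rewrite -normc_gt0 normcR normr_gt0 gt_eqF.
  by have [/slit_neq0] := g _ jM.
apply: le_trans (@fd_inv_le _ (e z) _ t M _ B0 t0 _ _) _.
- by move=> j jM /=; rewrite mulVf // e0.
- by move=> i j i0 ij; apply: fd_e_le => //; apply: g.
have n1 : normc ((e z t)^-1) <= c^-1.
  have := normc_e_ge t0 (_ : separated s c z t); rewrite Normc.normcV.
  have := g 0%N isT; rewrite addr0 => g0 /(_ g0) h.
  have p : 0 <= normc z * t `^ s by rewrite mulr_ge0 ?normc_ge0 ?powR_ge0.
  rewrite lef_pV2 ?posrE //; last first.
    by rewrite normc_gt0; have := e0 0%N isT; rewrite addr0.
  apply: le_trans h; rewrite ler_peMr ?(ltW c0) // mulrDr mulr1.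
  by have := mulr_ge0 (ltW t0) p; lra.
rewrite -[leRHS]mulr1 -mulrA; apply: ler_pM; rewrite ?normc_ge0 //.
  by rewrite mulr_ge0 // exprn_ge0 // divr_ge0 ?ltW // ltr_pwDl.
case: M tM {g e0} => [|M] tM; first by rewrite fact0 expr0 mulr1.
rewrite expr_div_n mulrA ler_pdivrMr ?exprn_gt0 // mul1r.
apply: le_trans (_ : ((1 + 3 / c) * M.+1%:R) ^+ M.+1 <= _); last first.
  by rewrite lerXn2r ?nnegrE ?mulr_ge0 ?(ltW t0) ?addr_ge0.
rewrite exprMn mulrC ler_wpM2l ?exprn_ge0 ?addr_ge0 //.
by rewrite -natrX ler_nat fact_le_expn.
Qed.

(** The last difference is turned into a derivative by the mean value theorem. As that theorem is
    real, real and imaginary parts are treated apart, whence the factor 2. *)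
Lemma fd_shifted_log_le z t M : 1 <= t -> (1 + 3 / c) * M%:R <= t ->
  (forall u, t <= u <= t + M.+1%:R -> separated s c z u) ->
  normc (fd M.+1 (shifted_log s z) t) <= 2 * s / c.
Proof.
move=> t1 tM g.
have D u j : t <= u <= t + 1 -> (j <= M)%N -> 0 < u + j%:R /\ separated s c z (u + j%:R).
  move=> /andP[tu ut] jM; split; first by rewrite ltr_pwDl //; lra.
  have : j%:R <= M%:R :> R by rewrite ler_nat.
  have : (0 : R) <= j%:R by [].
  by move=> ? ?; apply: g; rewrite -natr1; apply/andP; split; lra.
have K u : t <= u <= t + 1 -> normc (fd M (fun u => (e z u)^-1) u) <= c^-1.
  move=> tu; case/andP: (tu) => tu1 _; apply: fd_inv_e_le => [||j jM].
  - exact: le_trans tu1.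
  - exact: le_trans tu1.
  - by have [] := D u j tu jM.
have s0 : 0 <= s by case/andP: s12.
have -> : 2 * s / c = s / c + s / c by ring.
apply: le_trans (normc_le_ReIm _) _; apply: lerD; rewrite (ReD, ImD) (ReN, ImN).
  apply: (@realMVT_le _ (fun u => Re (fd M (shifted_log s z) u))
     (fun u => - s * Re (fd M (fun u => (e z u)^-1) u))) => u tu.
    rewrite (_ : (fun u => _) = fd M (fun v => Re (shifted_log s z v))); last by apply/funext => v; rewrite Re_fd.
    rewrite Re_fd -fdZ; apply: fd_derive => j jM.
    by have [] := D u j tu jM; exact: is_derive_Re_shifted_log.
  rewrite normrM normrN (ger0_norm s0); apply: ler_wpM2l => //.
  exact: le_trans (Re_le_normc _) (K _ tu).
apply: (@realMVT_le _ (fun u => Im (fd M (shifted_log s z) u))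
   (fun u => - s * Im (fd M (fun u => (e z u)^-1) u))) => u tu.
  rewrite (_ : (fun u => _) = fd M (fun v => Im (shifted_log s z v))); last by apply/funext => v; rewrite Im_fd.
  rewrite Im_fd -fdZ; apply: fd_derive => j jM.
  by have [] := D u j tu jM; exact: is_derive_Im_shifted_log.
rewrite normrM normrN (ger0_norm s0); apply: ler_wpM2l => //.
exact: le_trans (Im_le_normc _) (K _ tu).
Qed.

End BlogDifferences.

(** * The Euler transform *)

Section EulerTransform.
Variables (R : realType) (F : numFieldType).
Implicit Types (b : R -> F) (t : R) (M N q : nat).

(** The truncated Euler transform of [\sum_(j >= 0) (-1)^j b (t + j)]. *)
Definition euler_tail M b t : F := 2^-1 * \sum_(k < M) (- 2^-1) ^+ k * fd k b t.

(* The Euler transform of [\sum_(m >= 1) (-1)^m b m], applied from index [N]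
   on and truncated after [N %/ q] terms. *)
Definition euler_sum q b N : F :=
  \sum_(1 <= m < N) (-1) ^+ m * b m%:R + (-1) ^+ N * euler_tail (N %/ q)%N b N%:R.

(** The full tail [T] of an alternating series satisfies [T t + T (t + 1) = b t]; the truncated
    transform satisfies it up to one difference of order [M]. *)
Lemma euler_tail_step M b t :
  euler_tail M b t + euler_tail M b (t + 1) = b t - (- 2^-1) ^+ M * fd M b t.
Proof.
elim: M => [|M IH]; first by rewrite /euler_tail !big_ord0 !mulr0 addr0 expr0 mul1r subrr.
have E u : euler_tail M.+1 b u = euler_tail M b u + 2^-1 * ((- 2^-1) ^+ M * fd M b u).
  by rewrite /euler_tail big_ord_recr /= mulrDr.
rewrite !E addrACA IH exprS /=.
have h : (2^-1 : F) = 1 - 2^-1 by field.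
rewrite [in X in _ + (X * _ + _)]h; ring.
Qed.

Lemma euler_sum0 q b : euler_sum q b 0 = 0.
Proof. by rewrite /euler_sum big_geq // div0n /euler_tail big_ord0 !mulr0 addr0. Qed.

Lemma euler_sum1 q b : (1 < q)%N -> euler_sum q b 1 = 0.
Proof. by move=> q1; rewrite /euler_sum big_geq // divn_small // /euler_tail big_ord0 !mulr0 addr0. Qed.

Lemma divn_step N q : (0 < q)%N ->
  (N.+1 %/ q = N %/ q \/ N.+1 %/ q = (N %/ q).+1)%N.
Proof. by move=> q0; rewrite divnS //; case: dvdn; [right|left]. Qed.

(** [d] records whether the number of differences grows between [N] and [N + 1]. Either way only
    differences of order [N %/ q] remain, with the matching power of [1/2]. *)
Lemma euler_sum_step q b N : (0 < q)%N -> (0 < N)%N -> exists2 d : bool, true &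
  euler_sum q b N.+1 - euler_sum q b N =
   (-1) ^+ N * ((- 2^-1) ^+ (N %/ q)%N * fd (N %/ q)%N b N%:R)
   - d%:R * ((-1) ^+ N * (2^-1 * ((- 2^-1) ^+ (N %/ q)%N * fd (N %/ q)%N b N.+1%:R))).
Proof.
move=> q0 N0; set M := (N %/ q)%N.
have st := euler_tail_step M b N%:R.
have S : euler_sum q b N.+1 = \sum_(1 <= m < N) (-1) ^+ m * b m%:R + (-1) ^+ N * b N%:R
   - (-1) ^+ N * euler_tail (N.+1 %/ q)%N b N.+1%:R.
  by rewrite /euler_sum big_nat_recr //= exprS mulN1r mulNr.
have e1 : b N%:R = euler_tail M b N%:R + euler_tail M b N.+1%:R + (- 2^-1) ^+ M * fd M b N%:R.
  by rewrite natr1 in st; rewrite st subrK.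
rewrite S /euler_sum -/M e1; have [->|->] := divn_step N q0; rewrite -/M.
  by exists false => //; rewrite mul0r subr0; ring.
exists true => //.
have -> : euler_tail M.+1 b N.+1%:R =
    euler_tail M b N.+1%:R + 2^-1 * ((- 2^-1) ^+ M * fd M b N.+1%:R).
  by rewrite /euler_tail big_ord_recr /= mulrDr.
by rewrite mul1r; ring.
Qed.

Lemma euler_sumD q b c N : euler_sum q (fun t => b t + c t) N = euler_sum q b N + euler_sum q c N.
Proof.
rewrite /euler_sum /euler_tail addrACA -big_split /=; congr (_ + _).
  by apply: eq_bigr => m _; rewrite mulrDr.
rewrite -mulrDr -mulrDr -big_split /=; congr (_ * (_ * _)).
by apply: eq_bigr => k _; rewrite fdD mulrDr.
Qed.

(** [- 1/2] is the Abel value of [\sum_(m >= 1) (-1)^m]; [q <= N] guarantees that the tail has its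
    first term. This is the source of the term [(ln x) / 2]. *)
Lemma euler_sum_cst q (a : F) N : (0 < q <= N)%N -> euler_sum q (fun=> a) N = - (2^-1 * a).
Proof.
move=> /andP[q0 qN]; rewrite /euler_sum /euler_tail.
have : (0 < N %/ q)%N by rewrite divn_gt0.
case: (N %/ q)%N => // M _; rewrite big_ord_recl [X in _ * (_ * (_ + X))]big1 ?addr0; last first.
  by move=> k _; rewrite lift0 fd_const mulr0.
rewrite expr0 mul1r /=.
have {qN} : (0 < N)%N by exact: leq_trans qN.
elim: N => // N IH _; case: N IH => [|N] IH; first by rewrite big_geq // add0r expr1 mulN1r.
rewrite big_nat_recr //= exprS -[RHS]IH //.
have h : (a : F) = 2^-1 * a + 2^-1 * a by field.
set S := \sum_(1 <= i < N.+1) _; set g := 2^-1 * a in h *.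
have -> : -1 * (-1) ^+ N * a = -1 * (-1) ^+ N * (g + g) by rewrite -h.
by rewrite !exprS; ring.
Qed.

Lemma eq_euler_sum q b c N : (forall m, (0 < m)%N -> b m%:R = c m%:R) -> euler_sum q b N = euler_sum q c N.
Proof.
move=> bc; case: N => [|N]; first by rewrite !euler_sum0.
congr (_ + _ * _).
  by rewrite big_nat_cond [RHS]big_nat_cond; apply: eq_bigr => m /andP[/andP[m1 _] _]; rewrite bc.
congr (_ * _); apply: eq_bigr => k _; congr (_ * _); apply: fd_ext => j _.
by rewrite -natrD bc // addSn.
Qed.

End EulerTransform.

Lemma euler_sum_morph (R : realType) (F G : numFieldType) (f : {rmorphism F -> G}) q (b : R -> F) N :
  euler_sum q (fun t => f (b t)) N = f (euler_sum q b N).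
Proof.
rewrite /euler_sum /euler_tail rmorphD rmorph_sum rmorphM rmorphXn rmorphN1; congr (_ + _).
  by apply: eq_bigr => m _; rewrite rmorphM rmorphXn rmorphN1.
rewrite rmorphM fmorphV rmorph_nat rmorph_sum; congr (_ * (_ * _)).
by apply: eq_bigr => k _; rewrite (fd_morph f) rmorphM rmorphXn rmorphN fmorphV rmorph_nat.
Qed.

Lemma normcVn (R : realType) n : normc ((n%:R)^-1 : R[i]) = (n%:R)^-1.
Proof. by rewrite Normc.normcV -(rmorph_nat (real_complex R)) normcR normr_nat. Qed.

Lemma normc_euler_sum_step (R : realType) q (b : R -> R[i]) N : (0 < q)%N -> (0 < N)%N ->
  normc (euler_sum q b N.+1 - euler_sum q b N) <=
  2^-1 ^+ (N %/ q)%N * (normc (fd (N %/ q)%N b N%:R) + normc (fd (N %/ q)%N b N.+1%:R)).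
Proof.
move=> q0 N0; have [d _ ->] := euler_sum_step b q0 N0.
have n1 k : normc ((-1 : R[i]) ^+ k) = 1 by rewrite normcX normcN Normc.normc1 expr1n.
have n2 k : normc ((- 2^-1 : R[i]) ^+ k) = 2^-1 ^+ k by rewrite normcX normcN normcVn.
have p k : 0 <= (2^-1 : R) ^+ k by rewrite exprn_ge0.
apply: le_trans (normcB _ _) _; rewrite mulrDr; apply: lerD.
  by rewrite !Normc.normcM n1 n2 mul1r.
rewrite !Normc.normcM n1 n2 normcVn mul1r.
have := mulr_ge0 (p (N %/ q)%N) (normc_ge0 (fd (N %/ q)%N b N.+1%:R)).
have d1 : normc (d%:R : R[i]) <= 1 by case: d; rewrite ?mulr1n ?mulr0n ?Normc.normc1 ?Normc.normc0.
move=> h; rewrite -[leRHS]mul1r; apply: ler_pM; rewrite ?normc_ge0 ?mulr_ge0 ?normc_ge0 //.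
by lra.
Qed.

(** * Geometric decay of the Euler steps *)

Section EulerBlog.
Variables (R : realType) (s c : R).
Hypotheses (s12 : 0 <= s <= 2) (c01 : 0 < c).

(** Serves the initial indices [N < q], where no difference is taken yet. *)
Lemma normc_shifted_log_le (z : R[i]) (t T : R) : 1 <= t <= T -> normc z <= 1 -> separated s c z t ->
  normc (shifted_log s z t) <= `|ln c| + 2 * ln T + 1 + pi.
Proof.
move=> /andP[t1 tT] z1 g; have t0 : 0 < t by lra.
have [s0 s2] := andP s12.
have w0 := slit_neq0 (separated_slit t0 g).
apply: le_trans (normc_le_ReIm _) _; apply: lerD; last exact: carg_le_pi.
rewrite Re_clog; have n0 : 0 < normc (z + ((t `^ (- s))%:C)%C) by rewrite normc_gt0.
have lt0 : 0 <= ln t by exact: ln_ge0.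
have lT : ln t <= ln T by rewrite ler_ln ?posrE //; lra.
have U : ln (normc (z + ((t `^ (- s))%:C)%C)) <= 1.
  apply: le_trans (ln_le_sub1 n0) _; rewrite lerBlDr.
  apply: le_trans (normcD _ _) _; rewrite normcR ger0_norm ?powR_ge0 // lerD //.
  by rewrite -(powRr0 t) ler_powR // lerNl oppr0.
have L : ln c - s * ln t <= ln (normc (z + ((t `^ (- s))%:C)%C)).
  rewrite shift_factor // Normc.normcM normcR gtr0_norm ?powR_gt0 //.
  rewrite lnM ?posrE ?powR_gt0 ?normc_gt0 //; last by case: g => /slit_neq0.
  rewrite ln_powR mulNr addrC lerD2l ler_ln ?posrE ?normc_gt0 //; last by case: g => /slit_neq0.
  case: g => _; apply: le_trans; rewrite ler_peMr ?(ltW c01) // lerDl mulr_ge0 ?normc_ge0 ?powR_ge0 //.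
have sl : s * ln t <= 2 * ln T by apply: ler_pM.
have := ler_norm (ln c); have := ler_norm (- ln c); rewrite normrN => ? ?.
by rewrite ler_norml; apply/andP; split; lra.
Qed.

(** The bound on [q] makes the order of the differences small enough against [N] for
    [fd_shifted_log_le]; the sampled points stay below [2 N + 2] because that order is at most
    [N]. *)
Lemma euler_sum_shifted_log_le q : 1 + 3 / c <= q%:R -> exists2 C : R, 0 <= C &
  forall N (z : R[i]), (0 < N)%N -> normc z <= 1 ->
  (forall u, 1 <= u <= (2 * N + 2)%:R -> separated s c z u) ->
  normc (euler_sum q (shifted_log s z) N.+1 - euler_sum q (shifted_log s z) N) <= C * 2^-1 ^+ (N %/ q)%N.
Proof.
move=> qc; have c3 : 0 < 3 / c by rewrite divr_gt0.
have q0 : (0 < q)%N by rewrite -(ltr_nat R); lra.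
have [s0 s2] := andP s12.
pose D : R := `|ln c| + 2 * ln q.+1%:R + 1 + pi.
have D0 : 0 <= D.
  have := @ln_ge0 R q.+1%:R; rewrite ler1n => /(_ isT) l0.
  by have := normr_ge0 (ln c); have := @pi_ge0 R; rewrite /D; lra.
exists (2 * (D + 2 * s / c)).
  by rewrite mulr_ge0 // addr_ge0 // divr_ge0 ?mulr_ge0 ?(ltW c01).
move=> N z N0 z1 g; apply: le_trans (normc_euler_sum_step _ q0 N0) _.
rewrite mulrC ler_wpM2r ?exprn_ge0 //.
have N1 : 1 <= N%:R :> R by rewrite ler1n.
suff H n : (N <= n <= N.+1)%N -> normc (fd (N %/ q)%N (shifted_log s z) n%:R) <= D + 2 * s / c.
  have := H N; have := H N.+1; rewrite !leqnn !leqnSn => /(_ isT) h1 /(_ isT) h2; lra.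
move=> /andP[Nn nN].
have n1 : 1 <= n%:R :> R by rewrite ler1n (leq_trans N0).
case E : (N %/ q)%N => [|M].
  have Nq : (N < q)%N by move/eqP: E; rewrite -leqn0 leqNgt divn_gt0 // -ltnNge.
  apply: le_trans (_ : D <= _); last by rewrite lerDl divr_ge0 ?mulr_ge0 ?(ltW c01).
  apply: normc_shifted_log_le => //.
    by rewrite n1 ler_nat (leq_trans nN) // ltnW // ltnS.
  by apply: g; rewrite n1 ler_nat; move: nN; clear; lia.
apply: le_trans (_ : 2 * s / c <= _); last by rewrite lerDr.
have MN : (M.+1 * q <= N)%N by rewrite -E leq_trunc_div.
apply: fd_shifted_log_le => //.
  apply: le_trans (_ : q%:R * M%:R <= _); first by rewrite ler_wpM2r.
  by rewrite -natrM ler_nat (leq_trans _ Nn) // (leq_trans _ MN) // mulnC leq_mul2r leqnSn orbT.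
move=> u /andP[nu un]; apply: g; rewrite (le_trans n1 nu) /= (le_trans un) //.
rewrite -natrD ler_nat; have h0 : (M.+1 <= M.+1 * q)%N by rewrite leq_pmulr.
move/(fun h => leq_trans h MN): (h0) => MN'; move: nN MN'; clear; lia.
Qed.

End EulerBlog.

(** * The logarithm of W *)

Lemma cvgn_le (T : nat -> nat) : (forall n, (n <= T n)%N) -> T @ \oo --> \oo.
Proof.
move=> H; apply/cvgnyPge => A; near=> n; apply: leq_trans (H n).
by near: n; exact: nbhs_infty_ge.
Unshelve. all: by end_near. Qed.

Section LogOfW.
Variables (R : realType) (s : R).
Hypothesis (s1 : 1 < s).
Implicit Types (x y : R) (m n N p q : nat).

Let s0 : 0 < s. Proof. exact: lt_trans s1. Qed.

Definition weight m : R := m%:R `^ (- s).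

Lemma weight_ge0 m : 0 <= weight m. Proof. exact: powR_ge0. Qed.

Lemma weight_anti m n : (0 < m <= n)%N -> weight n <= weight m.
Proof.
move=> /andP[m0 mn]; rewrite /weight !powRN.
have m0' : 0 < m%:R :> R by rewrite ltr0n.
have n0' : 0 < n%:R :> R by rewrite ltr0n (leq_trans m0).
rewrite lef_pV2 ?posrE ?powR_gt0 //; apply: ge0_ler_powR; rewrite ?nnegrE ?(ltW s0) //.
by rewrite ler_nat.
Qed.

Lemma weight_le1 m : weight m <= 1.
Proof.
case: m => [|m]; first by rewrite /weight powR0 // oppr_eq0 gt_eqF.
by apply: le_trans (weight_anti (_ : 0 < 1 <= m.+1)%N) _; rewrite // /weight powR1.
Qed.

Let r : R := 2 `^ (1 - s).

Lemma block_ratio : 0 < r < 1.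
Proof.
rewrite /r powR_gt0 // -[X in _ < X](powRr0 2) /=.
rewrite /powR pnatr_eq0 /= ltr_expR ltr_pM2r ?ln_gt0 ?ltr1n //.
by rewrite subr_lt0.
Qed.

Lemma weight_block p : \sum_(2 ^ p <= m < 2 ^ p.+1) weight m <= r ^+ p.
Proof.
apply: le_trans (_ : \sum_(2 ^ p <= m < 2 ^ p.+1) weight (2 ^ p) <= _).
  by apply: ler_sum_nat => m /andP[pm _]; apply: weight_anti; rewrite expn_gt0.
rewrite sumr_const_nat expnS mul2n -addnn addnK -mulr_natl /weight -[X in X * _](powRr1 (ler0n _ _)).
rewrite -powRD; last by rewrite pnatr_eq0 expn_eq0 implybT.
by rewrite natrX -[2 ^+ p](powR_mulrn p (ler0n _ 2)) -powRrM mulrC powRrM powR_mulrn ?powR_ge0.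
Qed.

(** Cauchy condensation: the dyadic blocks are bounded by a geometric series. *)
Lemma weight_sum_bound : exists2 Z : R, 0 <= Z & forall N, \sum_(1 <= m < N.+1) weight m <= Z.
Proof.
have /andP[r0 r1] := block_ratio.
exists (1 / (1 - r)); first by rewrite divr_ge0 // subr_ge0 ltW.
move=> N; apply: le_trans (_ : \sum_(1 <= m < 2 ^ N.+1) weight m <= _).
  have h : (N.+1 <= 2 ^ N.+1)%N by rewrite ltnW // ltn_expl.
  rewrite [leRHS](big_cat_nat (n := N.+1)) //= lerDl.
  by apply: sumr_ge0 => m _; exact: weight_ge0.
apply: le_trans (_ : \sum_(p < N.+1) r ^+ p <= _).
  elim: {N}N.+1 => [|N IH]; first by rewrite expn0 big_geq // big_ord0.
  rewrite (big_cat_nat (n := 2 ^ N)) ?expn_gt0 ?leq_exp2l //= big_ord_recr /=.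
  by apply: lerD => //; exact: weight_block.
have : (1 - r) * \sum_(p < N.+1) r ^+ p <= 1.
  by rewrite -opprB mulNr -subrX1 opprB gerBl exprn_ge0 ?(ltW r0) //.
by rewrite ler_pdivlMr ?subr_gt0 // mulrC.
Qed.

Definition log_partial x N : R := \sum_(1 <= m < N.+1) ln (1 + x * weight m).
Definition logW x : R := limn (log_partial x).

Lemma log_arg_ge1 x m : 0 <= x -> 1 <= 1 + x * weight m.
Proof. by move=> x0; rewrite lerDl mulr_ge0 ?weight_ge0. Qed.

Lemma log_term_ge0 x m : 0 <= x -> 0 <= ln (1 + x * weight m).
Proof. by move=> x0; rewrite ln_ge0 // log_arg_ge1. Qed.

Lemma log_term_le x m : 0 <= x -> ln (1 + x * weight m) <= x * weight m.
Proof. by move=> x0; apply: le_ln1Dx; apply: lt_le_trans (mulr_ge0 x0 (weight_ge0 m)); rewrite ltrN10. Qed.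

Lemma log_partial_nd x : 0 <= x -> {homo log_partial x : n m / (n <= m)%N >-> n <= m}.
Proof.
move=> x0; apply/nondecreasing_seqP => n.
by rewrite /log_partial [leRHS]big_nat_recr //= lerDl log_term_ge0.
Qed.

Lemma log_partial_cvg x : 0 <= x -> cvgn (log_partial x).
Proof.
move=> x0; apply: nondecreasing_is_cvgn; first exact: log_partial_nd.
have [Z _ HZ] := weight_sum_bound; exists (x * Z) => _ [N _ <-].
apply: le_trans (ler_wpM2l x0 (HZ N)); rewrite mulr_sumr; apply: ler_sum => m _.
exact: log_term_le.
Qed.

Lemma log_partial_logW x : 0 <= x -> log_partial x @ \oo --> logW x.
Proof. by move=> x0; exact: log_partial_cvg. Qed.

Lemma log_partial_le_logW x N : 0 <= x -> log_partial x N <= logW x.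
Proof. by move=> x0; apply: nondecreasing_cvgn_le; [exact: log_partial_nd|exact: log_partial_cvg]. Qed.

Lemma logW_ge0 x : 0 <= x -> 0 <= logW x.
Proof. by move=> x0; apply: le_trans (log_partial_le_logW 0 x0); rewrite /log_partial big_geq. Qed.

Lemma logW_le x y : 0 <= x <= y -> logW x <= logW y.
Proof.
move=> /andP[x0 xy]; have y0 := le_trans x0 xy.
apply: ler_cvg_to (log_partial_logW x0) (log_partial_logW y0) _; near=> N.
apply: ler_sum => m _; rewrite ler_ln ?posrE ?(lt_le_trans ltr01) ?log_arg_ge1 //.
by rewrite lerD2l ler_wpM2r ?weight_ge0.
Unshelve. all: by end_near. Qed.

Lemma W_expR_logW x : 0 <= x -> W s x = expR (logW x).
Proof.
move=> x0; rewrite /W; apply: cvg_lim => //.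
rewrite (_ : (fun N => _) = expR \o log_partial x).
  by apply: continuous_cvg (log_partial_logW x0); exact: continuous_expR.
apply/funext => N /=; rewrite /log_partial expR_sum; apply: eq_bigr => m _.
by rewrite lnK ?posrE ?(lt_le_trans ltr01) ?log_arg_ge1 // /weight powRN.
Qed.

Lemma logW_derivable x : 0 < x -> derivable logW x 1.
Proof.
move=> x0.
pose dp N := \sum_(1 <= m < N.+1) weight m / (1 + x * weight m).
have p0 m : 0 < 1 + x * weight m by rewrite (lt_le_trans ltr01) // log_arg_ge1 // ltW.
have q0 m : 0 <= weight m / (1 + x * weight m) by rewrite divr_ge0 ?weight_ge0 // ltW.
have [Z Z0 HZ] := weight_sum_bound.
have qw m : weight m / (1 + x * weight m) <= weight m.
  by rewrite ler_pdivrMr // ler_peMr ?weight_ge0 // log_arg_ge1 // ltW.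
have dpc : cvgn dp.
  apply: nondecreasing_is_cvgn.
    by apply/nondecreasing_seqP => n; rewrite /dp [leRHS]big_nat_recr //= lerDl.
  exists Z => _ [N _ <-]; apply: le_trans (HZ N); apply: ler_sum => m _; exact: qw.
suff [] : is_derive x 1 logW (limn dp) by [].
(* For [|h| <= x / 2] the relative increment [u] of each factor is at least [- 1/2], so [ln1D_sub]
   bounds each remainder by [2 u^2 <= 2 h^2 weight m], and the weights sum to at most [Z]. *)
apply: (@is_derive_quad _ _ _ _ (x / 2) (2 * Z)); first by rewrite divr_gt0.
move=> h hx; have [hx1 hx2] := andP (etrans (esym (ler_norml _ _)) hx).
have xh0 : 0 <= x + h by lra.
have C : (fun N => `|log_partial (x + h) N - log_partial x N - dp N * h|) @ \oo -->
    `|logW (x + h) - logW x - limn dp * h|.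
  apply: cvg_norm; apply: cvgB; last exact: cvgMr_tmp dpc.
  by apply: cvgB; [exact: log_partial_logW|apply: log_partial_logW; exact: ltW].
apply: (cvgr_to_le C); near=> N.
rewrite /log_partial /dp mulr_suml -!sumrB.
apply: le_trans (ler_norm_sum _ _ _) _.
apply: le_trans (_ : \sum_(1 <= m < N.+1) 2 * h ^+ 2 * weight m <= _); last first.
  rewrite -mulr_sumr mulrAC ler_wpM2r ?sqr_ge0 // ler_wpM2l //.
apply: ler_sum => m _.
have wm := weight_ge0 m; have w1 := weight_le1 m.
set u := weight m / (1 + x * weight m) * h.
have E : 1 + (x + h) * weight m = (1 + x * weight m) * (1 + u).
  by rewrite /u; field; rewrite gt_eqF.
have u2 : - (1 / 2) <= u.
  rewrite /u mulrAC ler_pdivlMr //; have := mulr_ge0 (ltW x0) wm; nra.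
have u1 : 0 < 1 + u by lra.
rewrite E lnM; [|by rewrite posrE p0|by rewrite posrE].
rewrite [ln _ + _]addrC addrK; apply: le_trans (ln1D_sub u2) _.
rewrite -mulrA ler_wpM2l // mulrC /u exprMn ler_wpM2r ?sqr_ge0 // expr2.
apply: le_trans (_ : weight m * weight m <= _); last by rewrite ler_piMr.
by apply: ler_pM => //.
Unshelve. all: by end_near. Qed.

Lemma weight_scale q m y : (0 < q)%N -> (0 < m)%N ->
  (q%:R `^ s * y) * weight (q * m) = y * weight m.
Proof.
move=> q0 m0; rewrite /weight natrM powRM // mulrACA -powRD ?subrr ?powRr0 ?mul1r //.
by rewrite pnatr_eq0 -lt0n q0 implybT.
Qed.

(** Each of the [q] indices [m] in []q N, q (N + 1)]] has [q^s m^-s >= (N + 1)^-s], so [q] terms on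
    the right dominate [q] copies of one term on the left. *)
Lemma logW_ge_muln q y : (0 < q)%N -> 0 <= y -> q%:R * logW y <= logW (q%:R `^ s * y).
Proof.
move=> q0 y0; have Y0 : 0 <= q%:R `^ s * y by rewrite mulr_ge0 ?powR_ge0.
have C : (fun N => q%:R * log_partial y N) @ \oo --> q%:R * logW y.
  by apply: cvgMl_tmp; exact: log_partial_logW.
suff H N : q%:R * log_partial y N <= log_partial (q%:R `^ s * y) (q * N).
  by apply: (cvgr_to_le C); near=> N; apply: le_trans (log_partial_le_logW (q * N) Y0); exact: H.
elim: N => [|N IH]; first by rewrite muln0 /log_partial !big_geq // mulr0.
rewrite {1}/log_partial big_nat_recr //= mulrDr -/(log_partial y N) mulnS addnC.
rewrite [leRHS]/log_partial (big_cat_nat (n := (q * N).+1)) //=; last by rewrite ltnS leq_addr.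
apply: lerD => //.
apply: le_trans (_ : \sum_((q * N).+1 <= m < (q * N + q).+1) ln (1 + y * weight N.+1) <= _).
  by rewrite sumr_const_nat subSS addKn mulr_natl.
apply: ler_sum_nat => m /andP[m1 m2].
rewrite ler_ln ?posrE ?(lt_le_trans ltr01) ?log_arg_ge1 // lerD2l -(@weight_scale q N.+1) //.
rewrite ler_wpM2l // weight_anti //; apply/andP; split; first by apply: leq_ltn_trans m1.
by rewrite mulnS addnC.
Unshelve. all: by end_near. Qed.

(** Rounding [q] down loses less than 1; the loss disappears in the limit taken in
    [leading_coef_at_ge]. *)
Lemma logW_growth (q : R) y : 0 <= q -> 0 <= y -> (q - 1) * logW y <= logW (q `^ s * y).
Proof.
move=> q0 y0; have l0 := logW_ge0 y0.
have L0 : 0 <= logW (q `^ s * y) by rewrite logW_ge0 // mulr_ge0 ?powR_ge0.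
have [q1|q1] := ltrP q 1; first by apply: le_trans L0; rewrite mulr_le0_ge0 // subr_le0 ltW.
have /andP[t1 t2] := truncn_itv q0.
set n := Num.truncn q in t1 t2.
have n0 : (0 < n)%N by rewrite -(ltr_nat R) -[X in X < _]/(0%:R); move: t2; rewrite -natr1; lra.
apply: le_trans (_ : n%:R * logW y <= _).
  by rewrite ler_wpM2r //; move: t2; rewrite -natr1; lra.
apply: le_trans (logW_ge_muln n0 y0) _; apply: logW_le.
rewrite mulr_ge0 ?powR_ge0 //= ler_wpM2r //.
by apply: ge0_ler_powR; rewrite ?nnegrE ?(ltW s0).
Qed.

(** The even terms of the series at [2^s x] are the terms of the series at [x], since
    [2^s (2 m)^-s = m^-s]; doubling them and subtracting the whole series produces the signs. *)
Lemma alt_sum_log_partial x N : 0 <= x ->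
  \sum_(1 <= m < (2 * N).+1) (-1) ^+ m * ln (1 + 2 `^ s * x * weight m) =
  2 * log_partial x N - log_partial (2 `^ s * x) (2 * N).
Proof.
move=> x0; elim: N => [|N IH]; first by rewrite muln0 /log_partial !big_geq // mulr0 subrr.
have -> : (2 * N.+1).+1 = (2 * N).+3 by rewrite mulnS.
have -> : (2 * N.+1)%N = (2 * N).+2 by rewrite mulnS.
rewrite big_nat_recr //= big_nat_recr //= IH [in log_partial x N.+1]/log_partial [in RHS]big_nat_recr //= -/(log_partial x N).
rewrite [in log_partial _ (2 * N).+2]/log_partial [X in _ = _ - X]big_nat_recr //= [X in _ = _ - (X + _)]big_nat_recr //=.
rewrite -/(log_partial (2 `^ s * x) (2 * N)).
have -> : weight (2 * N).+2 = weight (2 * N.+1) by congr weight; rewrite mulnS.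
have e0 : (-1) ^+ (2 * N) = 1 :> R by rewrite exprM sqrrN !expr1n.
rewrite (@weight_scale 2 N.+1) // !exprS e0.
ring.
Qed.

Lemma fd_le_bound (b : R -> R) (A t : R) k :
  (forall j, (j <= k)%N -> `|b (t + j%:R)| <= A) -> `|fd k b t| <= 2 ^+ k * A.
Proof.
elim: k t => [|k IH] t H /=; first by have := H 0%N isT; rewrite addr0 mul1r.
apply: le_trans (ler_normB _ _) _; rewrite exprS -mulrA mulrDl !mul1r.
apply: lerD; apply: IH => j jk; last by apply: H; rewrite leqW.
by rewrite natrS1; apply: H.
Qed.

(** The growth [2^k] of a [k]-th difference is absorbed by the coefficient [2^-k]. The crude factor
    [M] is harmless, because it will meet [N weight N], which tends to 0. *)
Lemma euler_tail_le (b : R -> R) (A t : R) M :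
  (forall j, (j <= M)%N -> `|b (t + j%:R)| <= A) -> `|euler_tail M b t| <= M%:R * A.
Proof.
move=> H; have A0 : 0 <= A by apply: le_trans (H 0%N isT).
rewrite /euler_tail normrM; apply: le_trans (_ : 1 * \sum_(k < M) A <= _); last first.
  by rewrite mul1r sumr_const card_ord mulr_natl.
apply: ler_pM => //; first by rewrite ger0_norm //; lra.
apply: le_trans (ler_norm_sum _ _ _) _; apply: ler_sum => k _.
rewrite normrM normrX normrN normfV (ger0_norm (ler0n _ 2)) exprVn mulrC.
rewrite ler_pdivrMr ?exprn_gt0 // mulrC.
by apply: fd_le_bound => j jk; apply: H; rewrite (leq_trans jk) // ltnW.
Qed.

Lemma cvg_muln_weight : (fun N => N%:R * weight N) @ \oo --> (0 : R).
Proof.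
apply/cvgr0Pnorm_le => e e0; near=> N.
have N0 : 0 < N%:R :> R.
  by rewrite (lt_le_trans ltr01) //; near: N; exact: nbhs_infty_ger.
have NX : e `^ ((1 - s)^-1) <= N%:R by near: N; exact: nbhs_infty_ger.
rewrite ger0_norm ?mulr_ge0 ?weight_ge0 // /weight -[X in X * _](powRr1 (ler0n _ _)).
rewrite -powRD ?(gt_eqF N0) ?implybT //.
have E : e = (e `^ ((1 - s)^-1)) `^ (1 - s).
  by rewrite -powRrM mulVf ?powRr1 ?(ltW e0) // lt_eqF // subr_lt0.
have P : 0 < e `^ ((1 - s)^-1) by rewrite powR_gt0.
rewrite [leRHS]E -[1 - s]opprB !powRN lef_pV2 ?posrE ?powR_gt0 //.
by apply: ge0_ler_powR; rewrite ?nnegrE ?powR_ge0 ?(ltW N0) ?subr_ge0 ?(ltW s1) // opprB.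
Unshelve. all: by end_near. Qed.

Lemma cvg_sub0 (u v : nat -> R) (l : R) : u @ \oo --> l ->
  (fun n => v n - u n) @ \oo --> 0 -> v @ \oo --> l.
Proof.
move=> ul h; rewrite -[l]add0r (_ : v = (fun n => v n - u n) \+ u).
  exact: cvgD.
by apply/funext => n /=; rewrite subrK.
Qed.


Lemma alt_even_cvg x : 0 <= x ->
  (fun N => \sum_(1 <= m < (2 * N).+1) (-1) ^+ m * ln (1 + 2 `^ s * x * weight m)) @ \oo -->
  2 * logW x - logW (2 `^ s * x).
Proof.
move=> x0; have X0 : 0 <= 2 `^ s * x by rewrite mulr_ge0 ?powR_ge0.
rewrite (_ : (fun N => _) = (fun N => 2 * log_partial x N - log_partial (2 `^ s * x) (2 * N))); last first.
  by apply/funext => N; rewrite alt_sum_log_partial.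
apply: cvgB; first by apply: cvgMl_tmp; exact: log_partial_logW.
apply: (cvg_comp (fun N => (2 * N)%N) (log_partial (2 `^ s * x))); last exact: log_partial_logW.
by apply: cvgn_le => n; rewrite leq_pmull.
Qed.

(** With [y = 2^s x], the terms are [ln (1 + y t^-s) - ln y]: the constant contributes [(ln y) / 2]
    by [euler_sum_cst], and the transformed tail tends to 0. At the odd index [2 K + 1] the
    untransformed part is the even partial sum of [alt_even_cvg]. *)
Lemma euler_sum_ln_cvg q x : (0 < q)%N -> 0 < x ->
  (fun K => euler_sum q (fun t => ln ((2 `^ s * x)^-1 + t `^ (- s))) (2 * K).+1) @ \oo -->
  2 * logW x - logW (2 `^ s * x) + ln (2 `^ s * x) / 2.
Proof.
move=> q0 x0; set y := 2 `^ s * x; have y0 : 0 < y by rewrite mulr_gt0 ?powR_gt0.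
pose a (t : R) := ln (1 + y * t `^ (- s)).
have E N : (q <= N)%N ->
    euler_sum q (fun t => ln (y^-1 + t `^ (- s))) N = euler_sum q a N + ln y / 2.
  move=> qN; rewrite (@eq_euler_sum _ _ q _ (fun t => a t + - ln y)).
    by rewrite euler_sumD euler_sum_cst ?q0 //; congr (_ + _); ring.
  move=> m m0; rewrite /a -lnV ?posrE // -lnM ?posrE ?invr_gt0 //.
    by congr ln; rewrite mulrDl mul1r mulrAC divff ?mul1r // gt_eqF.
  by rewrite (lt_le_trans ltr01) // log_arg_ge1 // ltW.
apply: cvg_sub0.
  apply: cvgD; last exact: cvg_cst.
  exact: alt_even_cvg (ltW x0).
rewrite -/y; apply/cvgr0Pnorm_le => e e0; near=> K.
have qK : (q <= (2 * K).+1)%N.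
  by rewrite leqW // (@leq_trans K) ?leq_pmull //; near: K; exact: nbhs_infty_ge.
rewrite /= E // opprD addrACA subrr addr0 /euler_sum addrAC subrr add0r.
rewrite normrM normrX normrN1 expr1n mul1r.
set N := (2 * K).+1; have N0 : (0 < N)%N by [].
apply: le_trans (@euler_tail_le _ (y * weight N) _ _ _) _.
  move=> j _; rewrite -natrD /a -/(weight (N + j)) ger0_norm ?log_term_ge0 ?(ltW y0) //.
  apply: le_trans (log_term_le _ (ltW y0)) _; rewrite ler_wpM2l ?(ltW y0) // weight_anti //.
  by rewrite N0 leq_addr.
apply: le_trans (_ : y * (N%:R * weight N) <= _).
  rewrite mulrCA ler_wpM2l ?(ltW y0) // ler_wpM2r ?weight_ge0 // ler_nat leq_div //.
apply: le_trans (ler_norm _) _; rewrite /N; near: K.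
have /cvgr0Pnorm_le : (fun K => y * ((2 * K).+1%:R * weight (2 * K).+1)) @ \oo --> 0.
  rewrite -[X in _ --> X](mulr0 y); apply: cvgMl_tmp.
  apply: (cvg_comp (fun K => (2 * K).+1) (fun N => N%:R * weight N)); last exact: cvg_muln_weight.
  by apply: cvgn_le => n; rewrite leqW // leq_pmull.
exact.
Unshelve. all: by end_near. Qed.
End LogOfW.

(** * Holomorphic pieces *)

(** Trades the floor in the exponent for a true geometric rate, at the price of a factor 2. *)
Lemma pow_floor_le (R : realType) (q : nat) (rho : R) n : (0 < q)%N -> 0 <= rho <= 1 ->
  rho ^+ q = 2^-1 -> 2^-1 ^+ (n %/ q)%N <= 2 * rho ^+ n.
Proof.
move=> q0 /andP[r0 r1] rq.
rewrite {2}(divn_eq n q) exprD mulnC exprM rq mulrCA ler_peMr ?exprn_ge0 //.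
rewrite -[leLHS](mulfV (_ : (2 : R) != 0)) // ler_wpM2l // -rq.
by rewrite ler_wiXn2l // ltnW // ltn_mod.
Qed.

Lemma root_half (R : realType) (q : nat) : (0 < q)%N ->
  exists2 rho : R, 0 < rho < 1 & rho ^+ q = 2^-1.
Proof.
move=> q0; exists (2^-1 `^ (q%:R^-1)); last first.
  by rewrite -powR_mulrn ?powR_ge0 // -powRrM mulVf ?powRr1 // pnatr_eq0 -lt0n.
rewrite powR_gt0 //= -[X in _ < X](powRr0 2^-1) /powR invr_eq0 pnatr_eq0 /= ltr_expR mul0r.
by rewrite pmulr_rlt0 ?invr_gt0 ?ltr0n // lnV ?posrE // oppr_lt0 ln_gt0 // ltr1n.
Qed.

Lemma sum_geom_le (R : realType) (x : R) n : 0 <= x < 1 -> \sum_(k < n) x ^+ k <= (1 - x)^-1.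
Proof.
move=> /andP[x0 x1]; have d0 : 0 < 1 - x by rewrite subr_gt0.
rewrite -[leRHS]mul1r ler_pdivlMr // mulrC.
by rewrite -opprB mulNr -subrX1 opprB gerBl exprn_ge0.
Qed.

Lemma cvg_geometric_steps (R : realType) (u : nat -> R) (C x : R) : 0 <= x < 1 -> 0 <= C ->
  (forall n, `|u n.+1 - u n| <= C * x ^+ n) ->
  cvgn u /\ forall n, `|u n - limn u| <= C * x ^+ n / (1 - x).
Proof.
move=> x01 C0 H; have /andP[x0 x1] := x01.
have S n m : `|u (n + m)%N - u n| <= C * x ^+ n / (1 - x).
  apply: le_trans (_ : C * x ^+ n * \sum_(k < m) x ^+ k <= _); last first.
    by rewrite ler_wpM2l ?mulr_ge0 ?exprn_ge0 ?sum_geom_le.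
  elim: m => [|m IH]; first by rewrite addn0 subrr normr0 big_ord0 mulr0.
  rewrite addnS big_ord_recr /= mulrDr -(subrKA (u (n + m)%N)) addrC.
  apply: le_trans (ler_normD _ _) _; apply: lerD => //.
  by rewrite -mulrA -exprD.
have cu : cvgn u.
  have -> : u = (fun n => u 0%N + series (fun n => u n.+1 - u n) n).
    by apply/funext => n; rewrite /series /= telescope_sumr // addrCA subrr addr0.
  apply: is_cvgD; first exact: is_cvg_cst.
  apply: normed_cvg; apply: (@series_le_cvg _ _ (geometric C x)) => //.
  - by move=> n; exact: normr_ge0.
  - by move=> n; rewrite /geometric /= mulr_ge0 ?exprn_ge0.
  - by apply: is_cvg_geometric_series; rewrite ger0_norm.
split=> // n; have c : (fun m => `|u n - u (n + m)%N|) @ \oo --> `|u n - limn u|.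
  apply: cvg_norm; apply: cvgB; first exact: cvg_cst.
  apply: (cvg_comp (fun m => (n + m)%N) u); last exact: cu.
  by apply: cvgn_le => m; rewrite leq_addl.
by apply: (cvgr_to_le c); near=> m; rewrite distrC.
Unshelve. all: by end_near. Qed.

Section Differentiability.
Variables (R : realType) (K : numFieldType).

Lemma differentiable_bigsum (I : Type) (r : seq I) (P : pred I) (F : I -> K^o -> K^o) (v : K^o) :
  (forall i, P i -> differentiable (F i) v) ->
  differentiable (fun u => \sum_(i <- r | P i) F i u) v.
Proof.
move=> H; elim: r => [|i r IH].
  rewrite (_ : (fun u => _) = cst 0); first exact: differentiable_cst.
  by apply/funext => u; rewrite big_nil.
have [Pi|Pi] := boolP (P i).
  rewrite (_ : (fun u => _) = F i + (fun u => \sum_(i <- r | P i) F i u)).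
    by apply: differentiableD => //; exact: H.
  by apply/funext => u; rewrite big_cons Pi.
rewrite (_ : (fun u => _) = (fun u => \sum_(i <- r | P i) F i u)) //.
by apply/funext => u; rewrite big_cons (negbTE Pi).
Qed.

Lemma differentiable_mull (a : K) (f : K^o -> K^o) (v : K^o) :
  differentiable f v -> differentiable (fun u => a * f u : K^o) v.
Proof.
by move=> df; exact: (@differentiableZ _ _ _ f a v).
Qed.

Lemma differentiable_fd (b : R -> K^o -> K^o) k n (v : K^o) :
  (forall m, (n <= m <= n + k)%N -> differentiable (b m%:R) v) ->
  differentiable (fun u => fd k (b^~ u) n%:R : K^o) v.
Proof.
elim: k n => [|k IH] n H; first by apply: H; rewrite leqnn leq_addr.
rewrite (_ : (fun u => _) = (fun u => fd k (b^~ u) n.+1%:R : K^o) - (fun u => fd k (b^~ u) n%:R : K^o)).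
  apply: differentiableB; apply: IH => m /andP[nm mn]; apply: H.
    by rewrite (leq_trans _ nm) //= -addSnnS.
  by rewrite nm (leq_trans mn) // leq_add2l.
by apply/funext => u; rewrite /= natr1.
Qed.

Lemma differentiable_euler_sum (b : R -> K^o -> K^o) Q N (v : K^o) : (0 < Q)%N ->
  (forall m, (1 <= m <= 2 * N)%N -> differentiable (b m%:R) v) ->
  differentiable (fun u => euler_sum Q (b^~ u) N : K^o) v.
Proof.
move=> Q0 H; case: N H => [|N] H.
  rewrite (_ : (fun u => _) = cst 0); first exact: differentiable_cst.
  by apply/funext => u; rewrite euler_sum0.
rewrite (_ : (fun u => _) = (fun u => \sum_(1 <= m < N.+1 | (m < N.+1)%N && (0 < m)%N) (-1) ^+ m * b m%:R u : K^o) +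
   (fun u => (-1) ^+ N.+1 * (2^-1 * \sum_(k < N.+1 %/ Q) (- 2^-1) ^+ k * fd k (b^~ u) N.+1%:R) : K^o)).
  apply: differentiableD.
    apply: differentiable_bigsum => m /andP[mN m0]; apply: differentiable_mull; apply: H.
    by rewrite m0 (leq_trans (ltnW mN)) // leq_pmull.
  apply: differentiable_mull; apply: differentiable_mull.
  apply: differentiable_bigsum => k _; apply: differentiable_mull.
  apply: differentiable_fd => m /andP[nm mn]; apply: H.
  rewrite (leq_trans _ nm) //= (leq_trans mn) // mul2n -addnn leq_add2l.
  by rewrite (leq_trans (ltnW (ltn_ord k))) // leq_div.
apply/funext => u; rewrite /euler_sum /euler_tail; congr (_ + _).
rewrite big_nat_cond [RHS]big_nat_cond; apply: eq_bigl => m.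
by case: (0 < m)%N; case: (m < N.+1)%N.
Qed.

End Differentiability.

(** * Sectors, discs and the pieces of the function at infinity *)

Section Pieces.
Variables (R : realType) (s : R).
Hypotheses (s1 : 1 < s) (s2 : s < 2).
Implicit Types (z v : R[i]) (p k j N : nat).

Let s0 : 0 < s. Proof. exact: lt_trans s1. Qed.
Let s02 : 0 <= s <= 2. Proof. by rewrite !ltW. Qed.

(* Halfway between the least opening allowed by the class [calG] and the one
   for which the sector reaches the negative half-line. *)
Definition opening : R := (pi / 2 + pi / s) / 2.

Lemma opening_bounds : pi / 2 < opening < pi /\ s * opening < pi.
Proof.
have p0 := @pi_gt0 R.
have h1 : pi / 2 < pi / s by rewrite ltr_pM2l // ltf_pV2 ?posrE.
have h2 : pi / s < pi by rewrite ltr_pdivrMr // ltr_pMr.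
split; first by rewrite /opening; apply/andP; split; lra.
rewrite mulrC -ltr_pdivlMr // /opening; lra.
Qed.

(** Minus the cosine of the extreme angle of the sector; it is below 1 because that angle is below
    [pi]. *)
Definition sector_slope : R := - cos (s * opening).

Lemma sector_slope_lt1 : sector_slope < 1.
Proof.
have [/andP[f1 f2] sf] := opening_bounds; have p0 := @pi_gt0 R.
rewrite /sector_slope ltrNl -cospi ltr_cos ?in_itv /= ?lexx ?pi_ge0 //.
by rewrite (ltW sf) andbT mulr_ge0 ?(ltW s0) //; lra.
Qed.

(** The divisor 6 suits both regions: in the sector the square of the gap is at most
    [(1 - sector_slope) / 2], and in the disc a gap of at most [1/3] gives
    [sector_gap (1 + 1/2) <= 1/2]. *)
Definition sector_gap : R := (1 - sector_slope) / 6.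

Lemma sector_gap_gt0 : 0 < sector_gap. Proof. by rewrite /sector_gap divr_gt0 // subr_gt0 sector_slope_lt1. Qed.
Lemma sector_slope_geN1 : -1 <= sector_slope. Proof. by rewrite /sector_slope lerN2 cos_le1. Qed.
Lemma sector_gap_le : sector_gap <= 1 / 3. Proof. by have := sector_slope_geN1; rewrite /sector_gap; lra. Qed.

Lemma sector_Re z : s^-1 * `|carg z| < opening -> - sector_slope * normc z <= Re z.
Proof.
move=> h; have [->|z0] := eqVneq z 0; first by rewrite Normc.normc0 mulr0.
have [/andP[f1 f2] sf] := opening_bounds; have p0 := @pi_gt0 R.
have n0 : 0 < normc z by rewrite normc_gt0.
rewrite /sector_slope opprK -ler_pdivlMr // -cos_carg // -[leRHS]cos_norm ltW //.
rewrite ltr_cos ?in_itv /= ?normr_ge0 ?carg_le_pi //.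
  by rewrite mulrC ltr_pdivrMr // mulrC in h.
by rewrite (ltW sf) andbT mulr_ge0 ?(ltW s0) //; lra.
Qed.

Lemma separated_sector z t : 0 < t -> - sector_slope * normc z <= Re z -> separated s sector_gap z t.
Proof.
move=> t0 h; set ts := t `^ s; have ts0 : 0 < ts by rewrite powR_gt0.
have g1 := sector_slope_lt1; have c0 := sector_gap_gt0; have gN := sector_slope_geN1.
have rE : Re (1 + z * (ts%:C)%C) = 1 + Re z * ts by rewrite ReD mulrC Re_scale mulrC.
have iE : Im (1 + z * (ts%:C)%C) = Im z * ts by rewrite ImD mulrC Im_scale mulrC add0r.
have n0 := normc_ge0 z; have sq := sqr_normcE z.
split.
  rewrite /slit rE iE mulf_eq0 (gt_eqF ts0) orbF; case: eqVneq => //= i0.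
  have [r0|r0] := ltrP (Re z) 0; last by rewrite ltr_pwDl // mulr_ge0 // ltW.
  exfalso; have nE : normc z = - Re z.
    move: sq; rewrite i0 expr0n /= addr0 => /eqP; rewrite eqf_sqr => /orP[]/eqP // e.
    by move: r0; rewrite -e ltNge n0.
  move: h; rewrite nE; nra.
rewrite -(ler_pXn2r (n := 2)) ?nnegrE ?normc_ge0 //; last first.
  by rewrite mulr_ge0 ?(ltW c0) // addr_ge0 // mulr_ge0 // ltW.
rewrite sqr_normcE rE iE.
have -> : (1 + Re z * ts) ^+ 2 + (Im z * ts) ^+ 2 = 1 + 2 * (Re z * ts) + (normc z * ts) ^+ 2.
  by rewrite [in RHS]exprMn sq; ring.
set tau := normc z * ts; have tau0 : 0 <= tau by rewrite mulr_ge0 // ltW.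
have rt : - sector_slope * tau <= Re z * ts by rewrite /tau mulrA ler_wpM2r // ltW.
have E : sector_gap ^+ 2 <= (1 - sector_slope) / 2.
  have cE : (1 - sector_slope) / 2 = 3 * sector_gap by rewrite /sector_gap; field.
  have := sector_gap_le; rewrite cE expr2; nra.
apply: le_trans (_ : (1 - sector_slope) / 2 * (1 + tau) ^+ 2 <= _).
  by rewrite exprMn ler_wpM2r ?sqr_ge0.
(* With [g] the slope, [1 - 2 g tau + tau^2] equals [(1 - g) / 2 (1 + tau)^2 + (1 + g) / 2 (1 -
   tau)^2]. *)
have : 0 <= (1 + sector_slope) / 2 * (1 - tau) ^+ 2 by rewrite mulr_ge0 ?sqr_ge0 //; lra.
by nra.
Qed.

Lemma separated_disc z t : normc z * t `^ s <= 1 / 2 -> separated s sector_gap z t.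
Proof.
set ts := t `^ s => h; have ts0 : 0 <= ts by rewrite powR_ge0.
have c0 := sector_gap_gt0; have c3 := sector_gap_le; have n0 := normc_ge0 z.
have rE : Re (1 + z * (ts%:C)%C) = 1 + Re z * ts by rewrite ReD mulrC Re_scale mulrC.
have : `|Re z * ts| <= 1 / 2.
  by rewrite normrM (ger0_norm ts0); apply: le_trans h; rewrite ler_wpM2r ?Re_le_normc.
rewrite ler_norml => /andP[h1 h2].
split; first by rewrite /slit rE; apply/orP; right; lra.
rewrite -/ts; apply: le_trans (_ : 1 / 2 <= _).
  have : 0 <= normc z * ts by rewrite mulr_ge0.
  by move: (normc z * ts) h => tau h tau0; nra.
apply: le_trans (Re_le_normc _); rewrite rE ger0_norm; lra.
Qed.

(** The form [.+2] makes [1 < euler_block], which [euler_sum1] needs, true by computation. *)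
Definition euler_block : nat := (Num.truncn (1 + 3 / sector_gap)).+2.

Lemma euler_block_ge : 1 + 3 / sector_gap <= euler_block%:R.
Proof.
have h : 0 <= 1 + 3 / sector_gap by rewrite addr_ge0 // divr_ge0 // ltW // sector_gap_gt0.
have /andP[_ /ltW] := truncn_itv h; move/le_trans; apply.
by rewrite ler_nat.
Qed.

(* Advancing only at every third index makes the discs of radius
   [3/2 * (p + 1)^-s] avoid the singularities of the pieces. *)
Definition spaced_sum j z : R[i] := euler_sum euler_block (shifted_log s z) (j %/ 3)%N.
Definition dyadic_scale k : R := 2 `^ (- s * k.+1%:R).
Definition spaced_incr k j v : R[i] := spaced_sum j.+1 ((dyadic_scale k)%:C%C * v) - spaced_sum j ((dyadic_scale k)%:C%C * v).
(** The diagonal [j + k = p] of the double series over dyadic scales [k] and steps [j]: no step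
    beyond [p] occurs, which is what the disc of level [p] allows. *)
Definition log_piece p v : R[i] := \sum_(k < p.+1) ((2^-1 ^+ k.+1)%:C)%C * spaced_incr k (p - k) v.

(* Contains the image of [domS p] for [K = {1/s}] and [R = 3/2]. *)
Definition plane_dom p v := normc v < 3 / 2 /\
  (- sector_slope * normc v <= Re v \/ normc v * p.+1%:R `^ s < 3 / 2).

Lemma dyadic_scale_gt0 k : 0 < dyadic_scale k. Proof. exact: powR_gt0. Qed.

Lemma dyadic_scale_le k : dyadic_scale k <= 2 `^ (- s).
Proof. by rewrite /dyadic_scale ler_powR ?ler1n // mulNr lerN2 ler_peMr ?ler1n // ltW. Qed.

Lemma dyadic_scale_le_half k : dyadic_scale k <= 1 / 2.
Proof.
apply: le_trans (dyadic_scale_le k) _; rewrite mul1r -[leRHS](powR_inv1 (ler0n _ 2)).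
by rewrite ler_powR ?ler1n // lerN2 ltW.
Qed.

Lemma normc_dyadic_scale k v : normc ((dyadic_scale k)%:C%C * v) = dyadic_scale k * normc v.
Proof. by rewrite Normc.normcM normcR gtr0_norm // dyadic_scale_gt0. Qed.

(** In the disc case the scale, at most [2^-s], cancels the [2^s] of [(2 (N + 1))^s]; from
    [|v| (3 (N + 1))^s < 3/2] and [3 <= 3^s] there remains [|v| (N + 1)^s <= 1/2], the hypothesis of
    [separated_disc]. *)
Lemma plane_dom_separated p k N v t : (k <= p)%N -> plane_dom p v -> (3 * N.+1 <= p.+1)%N ->
  1 <= t <= (2 * N + 2)%:R -> separated s sector_gap ((dyadic_scale k)%:C%C * v) t.
Proof.
move=> kp [v32 [h|h]] Np /andP[t1 tN].
  apply: separated_sector; first by exact: lt_le_trans t1.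
  by rewrite normc_dyadic_scale Re_scale mulrCA ler_pM2l // dyadic_scale_gt0.
apply: separated_disc; rewrite normc_dyadic_scale.
have n0 := normc_ge0 v.
apply: le_trans (_ : 2 `^ (- s) * normc v * (2 * N.+1%:R) `^ s <= _).
  apply: ler_pM; rewrite ?mulr_ge0 ?powR_ge0 // ?(ltW (dyadic_scale_gt0 _)) //.
    by rewrite ler_wpM2r // dyadic_scale_le.
  have t0 : 0 <= t by lra.
  apply: ge0_ler_powR; rewrite ?nnegrE ?(ltW s0) ?mulr_ge0 //.
  by apply: le_trans tN _; rewrite -natrM ler_nat mulnS addnC.
rewrite powRM // mulrACA -powRD ?addNr ?eqxx ?pnatr_eq0 // powRr0 mul1r.
have h3 : normc v * (3 * N.+1%:R) `^ s < 3 / 2.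
  apply: le_lt_trans h; rewrite ler_wpM2l //.
  by apply: ge0_ler_powR; rewrite ?nnegrE ?(ltW s0) ?mulr_ge0 // -natrM ler_nat.
move: h3; rewrite powRM // mulrCA => h3.
have : 3 * (normc v * N.+1%:R `^ s) <= 3 `^ s * (normc v * N.+1%:R `^ s).
  rewrite ler_wpM2r ?mulr_ge0 ?powR_ge0 // le1r_powR ?ler1n // ltW //.
by move=> h4; lra.
Qed.

Lemma spaced_incr_cases k j v : spaced_incr k j v = 0 \/ exists2 N, (0 < N)%N & [/\ (j %/ 3 = N)%N, (3 * N.+1 <= j.+1)%N &
   spaced_incr k j v = euler_sum euler_block (shifted_log s ((dyadic_scale k)%:C%C * v)) N.+1 - euler_sum euler_block (shifted_log s ((dyadic_scale k)%:C%C * v)) N].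
Proof.
rewrite /spaced_incr /spaced_sum; set N := (j %/ 3)%N; have [->|E] := divn_step j (isT : (0 < 3)%N).
  by left; rewrite subrr.
case: (posnP N) => N0.
  by left; rewrite E -/N N0 euler_sum0 euler_sum1 // subrr.
right; exists N => //; split => //; last by rewrite E.
by rewrite -/N in E; rewrite -E mulnC leq_trunc_div.
Qed.

Lemma spaced_incr_le : exists2 C : R, 0 <= C & forall p k v, (k <= p)%N -> plane_dom p v ->
  normc (spaced_incr k (p - k) v) <= C * 2^-1 ^+ ((p - k) %/ (3 * euler_block))%N.
Proof.
have [C C0 H] := euler_sum_shifted_log_le s02 sector_gap_gt0 euler_block_ge; exists C => // p k v kp pv.
have [->|[N N0 [jN Nj ->]]] := spaced_incr_cases k (p - k) v.
  by rewrite Normc.normc0 mulr_ge0 // exprn_ge0.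
rewrite divnMA jN; apply: H => //.
  rewrite normc_dyadic_scale; have [vn _] := pv; have := dyadic_scale_le_half k; have := dyadic_scale_gt0 k.
  by have := normc_ge0 v; nra.
move=> u hu; apply: (plane_dom_separated (N := N) (p := p)) => //.
by apply: leq_trans Nj _; rewrite ltnS leq_subr.
Qed.

Lemma log_piece_le : exists C rho : R, [/\ 0 <= C, 0 < rho < 1, 2^-1 <= rho ^+ 2 & forall p v, plane_dom p v ->
  normc (log_piece p v) <= C * rho ^+ p /\
  forall k, (k <= p)%N -> normc (spaced_incr k (p - k) v) <= C * rho ^+ (p - k)].
Proof.
have [C C0 H] := spaced_incr_le.
have [rho /andP[r0 r1] rq] := @root_half R (3 * euler_block) isT.
have r01 : 0 <= rho <= 1 by rewrite !ltW.
(* One factor [rho^k] completes [rho^(p - k)] to [rho^p]; the other makes the sum over the scales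
   converge. *)
have h k : (2^-1 : R) ^+ k <= rho ^+ k * rho ^+ k.
  rewrite -exprMn lerXn2r ?nnegrE ?mulr_ge0 ?(ltW r0) // -rq -expr2.
  by rewrite ler_wiXn2l // ?(ltW r0) ?(ltW r1).
have H' p v k : plane_dom p v -> (k <= p)%N -> normc (spaced_incr k (p - k) v) <= 2 * C * rho ^+ (p - k).
  move=> pv kp; apply: le_trans (H p k v kp pv) _; rewrite [2 * C]mulrC -mulrA ler_wpM2l //.
  exact: (pow_floor_le _ (isT : (0 < 3 * euler_block)%N) r01 rq).
have i1 : 1 <= (1 - rho)^-1 by rewrite invf_ge1 ?subr_gt0 // gerBl ltW.
exists (2 * C * (1 - rho)^-1), rho; split.
- by rewrite !mulr_ge0 // invr_ge0 subr_ge0 ltW.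
- by rewrite r0.
- by rewrite -[leLHS]expr1 expr2 -[in X in _ <= X](expr1 rho); exact: h 1%N.
move=> p v pv; split; last first.
  move=> k kp; apply: le_trans (H' p v k pv kp) _.
  by rewrite ler_wpM2r ?exprn_ge0 ?(ltW r0) // ler_peMr // mulr_ge0.
apply: le_trans (normc_sum _ _ _) _.
apply: le_trans (_ : \sum_(k < p.+1) 2 * C * rho ^+ p * rho ^+ k <= _); last first.
  rewrite -mulr_sumr [leRHS]mulrAC ler_wpM2l ?mulr_ge0 ?exprn_ge0 ?(ltW r0) //.
  by apply: sum_geom_le; rewrite (ltW r0).
apply: ler_sum => k _; have kp : (k <= p)%N by rewrite -ltnS.
rewrite Normc.normcM normcR ger0_norm ?exprn_ge0 //.
apply: le_trans (_ : rho ^+ k * rho ^+ k * (2 * C * rho ^+ (p - k)) <= _).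
  apply: ler_pM; rewrite ?normc_ge0 ?exprn_ge0 //; last exact: H'.
  apply: le_trans (h k); rewrite exprS ler_piMl ?exprn_ge0 //; lra.
have -> : rho ^+ p = rho ^+ k * rho ^+ (p - k) by rewrite -exprD subnKC.
by rewrite le_eqVlt; apply/orP; left; apply/eqP; ring.
Qed.

(** Adding up the diagonals telescopes the steps at each scale, which stop at index [P - k]. *)
Lemma sum_log_piece P v : \sum_(p < P) log_piece p v = \sum_(k < P) ((2^-1 ^+ k.+1)%:C)%C * spaced_sum (P - k) ((dyadic_scale k)%:C%C * v).
Proof.
elim: P => [|P IH]; first by rewrite !big_ord0.
rewrite big_ord_recr /= IH /log_piece [in X in X + _](_ : \sum_(k < P) _ =
   \sum_(k < P.+1) ((2^-1 ^+ k.+1)%:C)%C * spaced_sum (P - k) ((dyadic_scale k)%:C%C * v)); last first.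
  by rewrite big_ord_recr /= subnn /spaced_sum div0n euler_sum0 mulr0 addr0.
rewrite -big_split /=; apply: eq_bigr => k _; rewrite -mulrDr /spaced_incr subrKC.
by rewrite subSn // -ltnS.
Qed.

Lemma differentiable_shifted_log (a t : R) (v : R[i]^o) : slit ((a%:C)%C * v + ((t `^ (- s))%:C)%C) ->
  differentiable (fun u : R[i]^o => shifted_log s ((a%:C)%C * u) t : R[i]^o) v.
Proof.
move=> sl; apply: (@differentiable_comp _ _ _ _ (fun u : R[i]^o => (a%:C)%C * u + ((t `^ (- s))%:C)%C : R[i]^o)
  (@clog R : R[i]^o -> R[i]^o)); last exact: clog_differentiable.
apply: (@differentiableD _ _ _ (fun u : R[i]^o => (a%:C)%C * u : R[i]^o) (cst (((t `^ (- s))%:C)%C : R[i]^o))).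
  by apply: (@differentiable_mull _ _ id).
exact: differentiable_cst.
Qed.

Lemma differentiable_spaced_incr p k (v : R[i]^o) : (k <= p)%N -> plane_dom p v ->
  differentiable (spaced_incr k (p - k) : R[i]^o -> R[i]^o) v.
Proof.
move=> kp pv; rewrite /spaced_incr /spaced_sum; set j := (p - k)%N.
have [->|E] := divn_step j (isT : (0 < 3)%N).
  rewrite (_ : (fun u => _) = cst 0); first exact: differentiable_cst.
  by apply/funext => u; rewrite subrr.
set N := (j %/ 3)%N in E *.
have H n : (n <= N.+1)%N ->
    differentiable (fun u : R[i]^o => euler_sum euler_block (shifted_log s ((dyadic_scale k)%:C%C * u)) n : R[i]^o) v.
  move=> nN; apply: (@differentiable_euler_sum _ _ (fun t u => shifted_log s ((dyadic_scale k)%:C%C * u) t)) => // m /andP[m1 m2].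
  apply: differentiable_shifted_log; apply: (@separated_slit _ s sector_gap); first by rewrite ltr0n.
  apply: (@plane_dom_separated p k N) => //.
    by rewrite -E mulnC (leq_trans (leq_trunc_div _ _)) // ltnS leq_subr.
  rewrite ler1n m1 ler_nat (leq_trans m2) // (leq_trans (leq_mul (leqnn 2) nN)) //.
  by rewrite mulnS addnC.
apply: (@differentiableB _ _ _ (fun u : R[i]^o => euler_sum euler_block (shifted_log s ((dyadic_scale k)%:C%C * u)) (j.+1 %/ 3)%N : R[i]^o)
  (fun u : R[i]^o => euler_sum euler_block (shifted_log s ((dyadic_scale k)%:C%C * u)) N : R[i]^o)).
  by rewrite E; apply: H.
exact: H.
Qed.

Lemma differentiable_log_piece p (v : R[i]^o) : plane_dom p v -> differentiable (log_piece p : R[i]^o -> R[i]^o) v.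
Proof.
move=> pv; apply: differentiable_bigsum => k _; apply: differentiable_mull.
by apply: differentiable_spaced_incr => //; rewrite -ltnS.
Qed.
End Pieces.

(** * The asymptotic expansion *)

Section LargeArguments.
Variables (R : realType) (s : R).
Hypotheses (s1 : 1 < s) (s2 : s < 2).
Implicit Types (x y : R) (p k j N : nat).

Local Notation euler_block := (euler_block s).
Local Notation logW := (logW s).
Local Notation dyadic_scale := (dyadic_scale s).
Local Notation log_piece := (log_piece s).
Local Notation spaced_incr := (spaced_incr s).
Local Notation spaced_sum := (spaced_sum s).

Let s0 : 0 < s. Proof. exact: lt_trans s1. Qed.

Definition real_sum j x : R := euler_sum euler_block (fun t => ln (x + t `^ (- s))) (j %/ 3)%N.

Lemma spaced_sum_real j x : 0 <= x -> spaced_sum j (x%:C)%C = ((real_sum j x)%:C)%C.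
Proof.
move=> x0; rewrite /real_sum -(euler_sum_morph (real_complex R)); apply: eq_euler_sum => m m0.
rewrite /shifted_log -rmorphD clog_real // ltr_wpDl // powR_gt0 // ltr0n //.
Qed.

Lemma spaced_incr_real k j x : 0 <= x ->
  spaced_incr k j (x%:C)%C = ((real_sum j.+1 (dyadic_scale k * x) - real_sum j (dyadic_scale k * x))%:C)%C.
Proof.
move=> x0; have h : 0 <= dyadic_scale k * x by rewrite mulr_ge0 // ltW // dyadic_scale_gt0.
by rewrite /spaced_incr -rmorphM !spaced_sum_real // rmorphB.
Qed.

Lemma Im_log_piece_real p x : 0 <= x -> Im (log_piece p (x%:C)%C) = 0.
Proof.
move=> x0; rewrite /log_piece; elim/big_ind : _ => //.
  by move=> u v u0 v0; rewrite ImD u0 v0 addr0.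
by move=> k _; rewrite spaced_incr_real // -rmorphM.
Qed.

Lemma Re_sum (I : Type) (r : seq I) (P : pred I) (F : I -> R[i]) :
  Re (\sum_(i <- r | P i) F i) = \sum_(i <- r | P i) Re (F i).
Proof. by apply: (big_morph (@complex.Re R)) => // u v; rewrite ReD. Qed.

Lemma plane_dom_real p x : 0 <= x < 3 / 2 -> plane_dom s p (x%:C)%C.
Proof.
move=> /andP[x0 x1]; rewrite /plane_dom normcR ger0_norm //; split=> //; left.
by rewrite /= -[leRHS]mul1r ler_wpM2r // lerNl; apply: sector_slope_geN1.
Qed.

Definition real_sum_lim y : R := 2 * logW y - logW (2 `^ s * y) + ln (2 `^ s * y) / 2.

Lemma dyadic_scale0 y : dyadic_scale 0 * y^-1 = (2 `^ s * y)^-1.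
Proof. by rewrite /dyadic_scale mulr1 powRN invfM. Qed.

Lemma log_piece_bounds : exists C rho : R, [/\ 0 <= C, 0 < rho < 1, 2^-1 <= rho ^+ 2,
  forall p v, plane_dom s p v -> normc (log_piece p v) <= C * rho ^+ p &
  forall j y, 1 <= y -> `|real_sum j (2 `^ s * y)^-1 - real_sum_lim y| <= C * rho ^+ j].
Proof.
have [C [rho [C0 /andP[r0 r1] r2 H]]] := log_piece_le s1 s2.
have i1 : 1 <= (1 - rho)^-1 by rewrite invf_ge1 ?subr_gt0 // gerBl ltW.
exists (C * (1 - rho)^-1), rho; split=> //.
- by rewrite mulr_ge0 // (le_trans ler01).
- by rewrite r0.
- move=> p v pv; have [h _] := H p v pv; apply: le_trans h _.
  by rewrite ler_wpM2r ?exprn_ge0 ?(ltW r0) // ler_peMr.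
move=> j y y1; have y0 : 0 < y by exact: lt_le_trans y1.
have yi : 0 <= y^-1 < 3 / 2.
  rewrite invr_ge0 (ltW y0) /=; apply: le_lt_trans (_ : 1 < _); first by rewrite invf_le1.
  lra.
have S n : `|real_sum n.+1 (2 `^ s * y)^-1 - real_sum n (2 `^ s * y)^-1| <= C * rho ^+ n.
  have [_ /(_ 0%N (leq0n _))] := H n _ (plane_dom_real n yi).
  by rewrite subn0 spaced_incr_real ?normcR ?dyadic_scale0 //; case/andP: yi.
have r01 : 0 <= rho < 1 by rewrite (ltW r0).
have [cu E] := cvg_geometric_steps r01 C0 S.
suff <- : limn (real_sum^~ (2 `^ s * y)^-1) = real_sum_lim y by rewrite mulrAC; exact: E.
(* The limit exists by the geometric steps; it is identified along a subsequence on which [real_sum]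
   is the Euler sum at the odd index [2 K + 1]. *)
have c1 : (fun K => real_sum (3 * (2 * K).+1) (2 `^ s * y)^-1) @ \oo --> limn (real_sum^~ (2 `^ s * y)^-1).
  apply: (cvg_comp (fun K => (3 * (2 * K).+1)%N) (real_sum^~ (2 `^ s * y)^-1)); last exact: cu.
  by apply: cvgn_le => n; clear; lia.
rewrite -(cvg_lim (@Rhausdorff R) c1); apply: (cvg_lim (@Rhausdorff R)).
rewrite (_ : (fun K => _) = (fun K => euler_sum euler_block (fun t => ln ((2 `^ s * y)^-1 + t `^ (- s))) (2 * K).+1)).
  exact: euler_sum_ln_cvg.
by apply/funext => K; rewrite /real_sum mulKn.
Qed.

Definition dyadic_arg k x : R := (2 `^ s) ^+ k * x.

Lemma dyadic_scale_arg k x : dyadic_scale k * x^-1 = (2 `^ s * dyadic_arg k x)^-1.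
Proof.
rewrite /dyadic_scale /dyadic_arg mulrA -exprS -powR_mulrn ?powR_ge0 // -powRrM invfM -powRN mulNr.
by [].
Qed.

Lemma dyadic_argS k x : 2 `^ s * dyadic_arg k x = dyadic_arg k.+1 x.
Proof. by rewrite /dyadic_arg mulrA -exprS. Qed.

Lemma ln_dyadic_arg k x : 0 < x -> ln (dyadic_arg k x) = k%:R * (s * ln 2) + ln x.
Proof.
by move=> x0; rewrite /dyadic_arg lnM ?posrE ?exprn_gt0 ?powR_gt0 // -powR_mulrn ?powR_ge0 // !ln_powR.
Qed.

Lemma dyadic_arg_ge1 k x : 1 <= x -> 1 <= dyadic_arg k x.
Proof.
move=> x1; rewrite /dyadic_arg -[leLHS]mul1r ler_pM // exprn_ege1 //.
rewrite -[leLHS](powRr0 2) ler_powR ?ler1n //; exact: ltW.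
Qed.

(** The terms in [logW] telescope. The logarithms contribute [(ln x + (k + 1) s ln 2) / 2] with
    weight [2^-(k + 1)], and [\sum_(k >= 0) (k + 1) 2^-(k + 1) = 2] explains the [s ln 2] left in
    the limit. *)
Lemma sum_real_sum_lim P x : 0 < x -> \sum_(k < P) 2^-1 ^+ k.+1 * real_sum_lim (dyadic_arg k x) =
  logW x - 2^-1 ^+ P * logW (dyadic_arg P x) + (1 - 2^-1 ^+ P) * (ln x / 2)
  + (1 - (P%:R / 2 + 1) * 2^-1 ^+ P) * (s * ln 2).
Proof.
move=> x0; elim: P => [|P IH].
  by rewrite big_ord0 /dyadic_arg !expr0 !mul1r; ring.
by rewrite big_ord_recr /= IH /real_sum_lim dyadic_argS ln_dyadic_arg // exprS -(natr1 P); field.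
Qed.

Lemma pow2_small : (fun P => (P%:R / 2 + 1) * 2^-1 ^+ P : R) @ \oo --> (0 : R).
Proof.
have H P : (P%:R / 2 + 1) * 2^-1 ^+ P <= (3 / 4) ^+ P :> R.
  elim: P => [|P IH]; first by rewrite mul0r add0r mul1r !expr0.
  rewrite !exprS; set a := 2^-1 ^+ P in IH *; set b := (3 / 4) ^+ P in IH *.
  have a0 : 0 <= a by rewrite exprn_ge0.
  have : 0 <= P%:R :> R by [].
  rewrite -natr1; nra.
apply: (@squeeze_cvgr _ _ _ _ (fun=> 0) (fun P => (3 / 4) ^+ P)).
- by near=> P; rewrite H andbT mulr_ge0 ?exprn_ge0.
- exact: cvg_cst.
- by apply: cvg_expr; rewrite ger0_norm; lra.
Unshelve. all: by end_near. Qed.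

(** The existence of [l] is a by-product: in the telescoped identity all the other terms
    converge. *)
Lemma log_piece_real_sum x : 1 <= x ->
  exists2 l, (fun P => 2^-1 ^+ P * logW (dyadic_arg P x)) @ \oo --> l &
  (fun P => \sum_(p < P) Re (log_piece p (x^-1%:C)%C)) @ \oo -->
    logW x - l + ln x / 2 + s * ln 2.
Proof.
move=> x1; have x0 : 0 < x by exact: lt_le_trans x1.
have xi0 : 0 <= x^-1 by rewrite invr_ge0 ltW.
have xi : 0 <= x^-1 < 3 / 2.
  rewrite xi0 /=; apply: le_lt_trans (_ : 1 < _); first by rewrite invf_le1.
  lra.
have [C [rho [C0 /andP[r0 r1] r2 HG HT]]] := log_piece_bounds.
have E P : \sum_(p < P) Re (log_piece p (x^-1%:C)%C) =
    \sum_(k < P) 2^-1 ^+ k.+1 * real_sum (P - k) (2 `^ s * dyadic_arg k x)^-1.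
  rewrite -Re_sum sum_log_piece // Re_sum; apply: eq_bigr => k _.
  have -> : (dyadic_scale k)%:C%C * (x^-1%:C)%C = ((2 `^ s * dyadic_arg k x)^-1%:C)%C by rewrite -dyadic_scale_arg -rmorphM.
  rewrite Re_scale spaced_sum_real //.
  by rewrite invr_ge0 mulr_ge0 ?powR_ge0 // (le_trans ler01) // dyadic_arg_ge1.
(* At scale [k] the Euler sum stops at [P - k], with an error of order [rho^(P - k)]; the weight, at
   most [rho^k rho^k], restores [rho^P] and leaves a summable factor. *)
have D P : `|\sum_(p < P) Re (log_piece p (x^-1%:C)%C) - \sum_(k < P) 2^-1 ^+ k.+1 * real_sum_lim (dyadic_arg k x)|
    <= C / (1 - rho) * rho ^+ P.
  rewrite E -sumrB; apply: le_trans (ler_norm_sum _ _ _) _.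
  apply: le_trans (_ : \sum_(k < P) C * rho ^+ P * rho ^+ k <= _); last first.
    rewrite -mulr_sumr [leRHS]mulrAC ler_wpM2l ?mulr_ge0 ?exprn_ge0 ?(ltW r0) //.
    by apply: sum_geom_le; rewrite (ltW r0).
  apply: ler_sum => k _; rewrite -mulrBr normrM ger0_norm ?exprn_ge0 //.
  have kP : (k <= P)%N by rewrite ltnW.
  apply: le_trans (_ : rho ^+ k * rho ^+ k * (C * rho ^+ (P - k)) <= _).
    apply: ler_pM; rewrite ?exprn_ge0 //; last by apply: HT; exact: dyadic_arg_ge1.
    rewrite -exprMn -expr2; apply: le_trans (_ : 2^-1 ^+ k <= _).
      rewrite exprS ler_piMl ?exprn_ge0 //; lra.
    by rewrite lerXn2r ?nnegrE ?exprn_ge0 ?(ltW r0).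
  have -> : rho ^+ P = rho ^+ k * rho ^+ (P - k) by rewrite -exprD subnKC.
  by rewrite le_eqVlt; apply/orP; left; apply/eqP; ring.
have D0 : (fun P => \sum_(p < P) Re (log_piece p (x^-1%:C)%C) -
     \sum_(k < P) 2^-1 ^+ k.+1 * real_sum_lim (dyadic_arg k x)) @ \oo --> (0 : R).
  apply/cvgr0Pnorm_le => e e0.
  have /cvgr0Pnorm_le/(_ e e0) : (fun P => C / (1 - rho) * rho ^+ P) @ \oo --> (0 : R).
    by apply: cvg_geometric; rewrite ger0_norm // ltW.
  by apply: filterS => P hP; apply: le_trans (D P) (le_trans (ler_norm _) hP).
have GC : cvgn (fun P => \sum_(p < P) Re (log_piece p (x^-1%:C)%C)).
  have -> : (fun P => \sum_(p < P) Re (log_piece p (x^-1%:C)%C)) = series (fun p => Re (log_piece p (x^-1%:C)%C)).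
    by apply/funext => P; rewrite /series /= big_mkord.
  apply: normed_cvg; apply: (@series_le_cvg _ _ (geometric C rho)) => //.
  - by move=> n; exact: normr_ge0.
  - by move=> n; rewrite /geometric /= mulr_ge0 ?exprn_ge0 ?(ltW r0).
  - by move=> n; apply: le_trans (Re_le_normc _) _; apply: HG; exact: plane_dom_real.
  - by apply: is_cvg_geometric_series; rewrite ger0_norm // ltW.
set g := limn (fun P => \sum_(p < P) Re (log_piece p (x^-1%:C)%C)) in GC *.
have half0 : (fun P => 2^-1 ^+ P : R) @ \oo --> (0 : R).
  by apply: cvg_expr; rewrite ger0_norm; lra.
have c : (fun P => logW x + (1 - 2^-1 ^+ P) * (ln x / 2)
  + (1 - (P%:R / 2 + 1) * 2^-1 ^+ P) * (s * ln 2) -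
   (\sum_(p < P) Re (log_piece p (x^-1%:C)%C)) + (\sum_(p < P) Re (log_piece p (x^-1%:C)%C) -
     \sum_(k < P) 2^-1 ^+ k.+1 * real_sum_lim (dyadic_arg k x))) @ \oo -->
   logW x + (1 - 0) * (ln x / 2) + (1 - 0) * (s * ln 2) - g + 0.
  apply: cvgD D0; apply: cvgB GC; apply: cvgD.
    apply: cvgD; first exact: cvg_cst.
    by apply: cvgMr_tmp; apply: cvgB; [exact: cvg_cst|exact: half0].
  by apply: cvgMr_tmp; apply: cvgB; [exact: cvg_cst|exact: pow2_small].
exists (logW x + (1 - 0) * (ln x / 2) + (1 - 0) * (s * ln 2) - g + 0).
  move: c; rewrite (_ : (fun P => _) = (fun P => 2^-1 ^+ P * logW (dyadic_arg P x))) //.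
  by apply/funext => P; rewrite sum_real_sum_lim //; ring.
have -> : logW x - (logW x + (1 - 0) * (ln x / 2) + (1 - 0) * (s * ln 2) - g + 0) + ln x / 2 + s * ln 2 = g by ring.
exact: GC.
Qed.

Definition leading_coef_at x : R := limn (fun P => 2^-1 ^+ P * logW (dyadic_arg P x)).

Lemma leading_coef_at_cvg x : 1 <= x -> (fun P => 2^-1 ^+ P * logW (dyadic_arg P x)) @ \oo --> leading_coef_at x.
Proof. by move=> x1; have [l /cvgP] := log_piece_real_sum x1. Qed.

(** [logW_growth] with factor [m 2^J] loses 1, hence only [2^-J] after division by [2^J]; then [J]
    tends to infinity. *)
Lemma leading_coef_at_ge y m : 1 <= y -> 0 <= m -> 1 <= m `^ s * y -> m * leading_coef_at y <= leading_coef_at (m `^ s * y).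
Proof.
move=> y1 m0 my.
have H J : (m - 2^-1 ^+ J) * leading_coef_at y <= leading_coef_at (m `^ s * y).
  have c1 : (fun K => (m - 2^-1 ^+ J) * (2^-1 ^+ K * logW (dyadic_arg K y))) @ \oo --> (m - 2^-1 ^+ J) * leading_coef_at y.
    by apply: cvgMl_tmp; exact: leading_coef_at_cvg.
  have c2 : (fun K => 2^-1 ^+ (K + J) * logW (dyadic_arg (K + J) (m `^ s * y))) @ \oo --> leading_coef_at (m `^ s * y).
    apply: (cvg_comp (fun K => (K + J)%N) (fun K => 2^-1 ^+ K * logW (dyadic_arg K (m `^ s * y)))).
      by apply: cvgn_le => n; rewrite leq_addr.
    exact: leading_coef_at_cvg.
  apply: ler_cvg_to c1 c2 _; near=> K.
  have Y0 : 0 <= dyadic_arg K y by rewrite (le_trans ler01) // dyadic_arg_ge1.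
  have M0 : 0 <= m * 2 ^+ J by rewrite mulr_ge0 ?exprn_ge0.
  have := logW_growth s1 M0 Y0.
  have -> : (m * 2 ^+ J) `^ s * dyadic_arg K y = dyadic_arg (K + J) (m `^ s * y).
    rewrite powRM ?exprn_ge0 // -(powR_mulrn J (ler0n _ 2)) -powRrM mulrC [J%:R * s]mulrC powRrM.
    by rewrite powR_mulrn ?powR_ge0 // /dyadic_arg exprD; ring.
  move/(ler_wpM2l (_ : 0 <= 2^-1 ^+ (K + J))); rewrite exprn_ge0 // => /(_ isT).
  apply: le_trans; rewrite le_eqVlt; apply/orP; left; apply/eqP.
  rewrite exprD [2^-1 ^+ J]exprVn.
  by field; rewrite expf_neq0.
have c : (fun J => (m - 2^-1 ^+ J) * leading_coef_at y) @ \oo --> (m - 0) * leading_coef_at y.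
  apply: cvgMr_tmp; apply: cvgB; first exact: cvg_cst.
  by apply: cvg_expr; rewrite ger0_norm; lra.
by rewrite subr0 in c; apply: (cvgr_to_le c); near=> J; exact: H.
Unshelve. all: by end_near. Qed.

(** [leading_coef_at_ge] is applied from 1 to [x] with the factor [x^(1/s)], and from [x] back to 1
    with its inverse. *)
Lemma leading_coef_at_pow x : 1 <= x -> leading_coef_at x = leading_coef_at 1 * x `^ s^-1.
Proof.
move=> x1; have x0 : 0 < x by exact: lt_le_trans x1.
have E : (x `^ s^-1) `^ s = x by rewrite -powRrM mulVf ?gt_eqF // powRr1 // ltW.
have m0 : 0 < x `^ s^-1 by rewrite powR_gt0.
apply/eqP; rewrite eq_le; apply/andP; split.
  have := @leading_coef_at_ge x (x `^ s^-1)^-1 x1; rewrite invr_ge0 (ltW m0) => /(_ isT).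
  rewrite -powR_inv1 ?(ltW m0) // -powRrM mulN1r powRN E mulVf ?gt_eqF // => /(_ (lexx _)).
  by rewrite powR_inv1 ?(ltW m0) // mulrC ler_pdivrMr.
have := @leading_coef_at_ge 1 (x `^ s^-1) (lexx _) (ltW m0); rewrite E mulr1 => /(_ x1).
by rewrite mulrC.
Qed.

Lemma logW_large x : 1 <= x ->
  (fun P => \sum_(p < P) Re (log_piece p (x^-1%:C)%C)) @ \oo -->
    logW x - leading_coef_at 1 * x `^ s^-1 + ln x / 2 + s * ln 2.
Proof.
move=> x1; have [l lc] := log_piece_real_sum x1.
by rewrite -(cvg_lim (@Rhausdorff R) lc) -/(leading_coef_at x) leading_coef_at_pow.
Qed.

End LargeArguments.

(** * The primitives *)

Section Primitives.
Variable R : realType.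
Local Notation C := (R[i]^o).

(** The midpoint of 1 and [1 / rho]: a weight [r > 1], as the class demands, with [r rho < 1] to
    keep the weighted series convergent. *)
Definition rho_r (rho : R) : R := (1 + rho^-1) / 2.

Definition datum1 (k rho phi : R) : datum R 1 :=
  Datum [set const_mx k] (const_mx (3 / 2)) (rho_r rho) phi.

Lemma rho_r_gt1 (rho : R) : 0 < rho < 1 -> 1 < rho_r rho /\ rho_r rho * rho < 1.
Proof.
move=> /andP[r0 r1]; have : 1 < rho^-1 by rewrite invf_gt1.
rewrite /rho_r => h; split; first by lra.
rewrite mulrAC mulrDl mul1r mulVf ?gt_eqF //; lra.
Qed.

Lemma cvg_complex (u : nat -> C) (a b : R) : (fun n => Re (u n)) @ \oo --> a ->
  (fun n => Im (u n)) @ \oo --> b -> u @ \oo --> ((a +i* b)%C : C).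
Proof.
move=> ua ub; apply/cvgrPdist_le => e e0.
have [r r0 ->] : exists2 r : R, 0 < r & e = (r%:C)%C.
  exists (Re e); first by move: e0; rewrite ltcE => /andP[].
  by move: e0; rewrite ltcE => /andP[/eqP i0 _]; case: e i0 => ? ? /= ->.
have r2 : 0 < r / 2 by rewrite divr_gt0.
have /cvgrPdist_le/(_ _ r2) ha := ua; have /cvgrPdist_le/(_ _ r2) hb := ub.
near=> n; rewrite normC_normc lecR; apply: le_trans (normc_le_ReIm _) _.
rewrite ReD ReN ImD ImN /=.
have -> : r = r / 2 + r / 2 by field.
by apply: lerD; near: n.
Unshelve. all: by end_near. Qed.

Lemma cvg_series_geometric_bound (u : nat -> R) (A rho : R) : 0 <= rho < 1 -> 0 <= A ->
  (forall p, `|u p| <= A * rho ^+ p) -> cvgn (series u).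
Proof.
move=> /andP[r0 r1] A0 H; apply: normed_cvg; apply: (@series_le_cvg _ _ (geometric A rho)) => //.
- by move=> n; exact: normr_ge0.
- by move=> n; rewrite /geometric /= mulr_ge0 ?exprn_ge0.
- by apply: is_cvg_geometric_series; rewrite ger0_norm.
Qed.

Lemma RG_series (k phi rho A : R) (g : nat -> C -> C) :
  0 <= k -> pi / 2 < phi < pi -> 0 < rho < 1 -> 0 <= A ->
  (forall p z, domS (datum1 k rho phi) p z ->
     differentiable (g p) (z 0 0) /\ normc (g p (z 0 0)) <= A * rho ^+ p) ->
  (forall x : R, domSinf (datum1 k rho phi) (const_mx (x%:C)%C) ->
     forall p, Im (g p (x%:C)%C) = 0) ->
  (forall x : R, 0 <= x <= 1 -> domSinf (datum1 k rho phi) (const_mx (x%:C)%C)) ->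
  exists2 f : 'rV[C]_1 -> C, RG (graph setT (restrict01 f)) &
    forall x : R, 0 <= x <= 1 ->
      series (fun p => Re (g p (x%:C)%C)) @ \oo --> restrict01 f (const_mx x).
Proof.
move=> k0 ph r01 A0 Hg Hreal H01; have /andP[r0 r1] := r01.
have [rr1 rr2] := rho_r_gt1 r01.
set tau := datum1 k rho phi in Hg Hreal H01 *.
have r01' : 0 <= rho < 1 by rewrite (ltW r0).
pose f (z : 'rV[C]_1) : C := (limn (series (fun p => Re (g p (z 0 0)))) +i*
   limn (series (fun p => Im (g p (z 0 0)))))%C.
have Rec z : domSinf tau z -> cvgn (series (fun p => Re (g p (z 0 0)))).
  move=> zd; apply: (cvg_series_geometric_bound r01' A0) => p.
  by have [_] := Hg p z (zd p I); apply: le_trans; exact: Re_le_normc.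
have Imc z : domSinf tau z -> cvgn (series (fun p => Im (g p (z 0 0)))).
  move=> zd; apply: (cvg_series_geometric_bound r01' A0) => p.
  by have [_] := Hg p z (zd p I); apply: le_trans; exact: Im_le_normc.
exists f; last first.
  move=> x x01; have := Rec _ (H01 x x01); rewrite mxE.
  suff -> : restrict01 f (const_mx x) = limn (series (fun p => Re (g p (x%:C)%C))) by [].
  rewrite /restrict01 (_ : [forall i, _] = true); last first.
    by apply/forallP => i; rewrite mxE.
  by rewrite /f /= /toC !mxE.
(* The point 0 lies in every [domS p], so the suprema below are over nonempty sets. *)
have T0 : domSinf tau (const_mx (0%:C)%C) by apply: H01; rewrite lexx ler01.
apply: (@RG_prim _ 1 tau) => //.
- split => //=.
  + split; [exact: finite_set1|by exists (const_mx k)|].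
    by move=> _ -> i; rewrite mxE.
  + by move=> i; rewrite mxE divr_gt0.
- by move=> i; rewrite mxE; lra.
- exists (fun p z => g p (z 0 0)); split.
  + move=> p z zp; have [dg _] := Hg p z zp.
    apply: (@differentiable_comp _ _ _ _ (fun N : 'rV[C]_1 => N 0 0 : C) (g p)) => //.
    exact: differentiable_coord.
  + by move=> p; exists (A * rho ^+ p) => z zp; have [] := Hg p z zp.
  + apply: (@cvg_series_geometric_bound _ A (rho_r rho * rho)) => //.
      by rewrite rr2 mulr_ge0 ?(ltW r0) // ltW // (lt_trans ltr01).
    move=> p; set S := [set _ | _ in _].
    have Sb : ubound S (A * rho ^+ p) by move=> _ [z zp <-]; have [] := Hg p z zp.
    have Sn : S !=set0 by exists (normc (g p ((const_mx (0%:C)%C : 'rV[C]_1) 0 0))); exists (const_mx (0%:C)%C) => //; exact: T0.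
    have S0 : 0 <= sup S.
      have [a Sa] := Sn; apply: le_trans (_ : a <= _); last by apply: ub_le_sup => //; exists (A * rho ^+ p).
      by case: Sa => z _ <-; exact: normc_ge0.
    have rp : 0 <= rho_r rho ^+ p by rewrite exprn_ge0 // ltW // (lt_trans ltr01).
    rewrite ger0_norm ?mulr_ge0 // [(rho_r rho * rho) ^+ p]exprMn [leRHS]mulrCA ler_wpM2l //.
    exact: ge_sup.
  + move=> z zd.
    have Er : (fun n => Re (series (fun p => g p (z 0 0)) n)) = series (fun p => Re (g p (z 0 0))).
      by apply/funext => n; rewrite /series /= (big_morph (@complex.Re R) (@ReD R) (erefl _)).
    have Ei : (fun n => Im (series (fun p => g p (z 0 0)) n)) = series (fun p => Im (g p (z 0 0))).
      by apply/funext => n; rewrite /series /= (big_morph (@complex.Im R) (@ImD R) (erefl _)).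
    by apply: cvg_complex; [rewrite Er; exact: Rec|rewrite Ei; exact: Imc].
- move=> x; rewrite /f /toC /= mxE => xd.
  rewrite (_ : (fun p => _) = (fun=> 0)).
    rewrite (_ : series _ = (fun=> 0)); first exact: lim_cst.
    by apply/funext => n; rewrite /series /= big1.
  apply/funext => p; apply: Hreal.
  rewrite (_ : const_mx _ = map_mx (real_complex R) x) //.
  by apply/rowP => i; rewrite !mxE ord1.
Qed.

End Primitives.

(** * The two primitives: at infinity and near 0 *)

Section LargePrimitive.
Variables (R : realType) (s : R).
Hypotheses (s1 : 1 < s) (s2 : s < 2).
Local Notation C := (R[i]^o).
Let s0 : 0 < s. Proof. exact: lt_trans s1. Qed.

(** The disc condition for the exponent [1/s] is raised to the power [s]. *)
Lemma domS_plane_dom (rho : R) p (z : 'rV[C]_1) :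
  domS (datum1 s^-1 rho (opening s)) p z -> plane_dom s p (z 0 0).
Proof.
move=> /(_ (const_mx s^-1) erefl) [[zp]|[zp]].
  rewrite big_ord1 mxE => sz; split; first by have := zp ord0; rewrite mxE.
  by left; exact: sector_Re.
have n0 := normc_ge0 (z 0 0).
rewrite !big_ord1 !mxE /= => h; split; first by have := zp ord0; rewrite mxE.
right; have p0 : 0 < p.+1%:R :> R by [].
move: h; rewrite mulrC ltr_pdivlMr // => h.
have e u : 0 <= u -> (u `^ s^-1) `^ s = u :> R.
  by move=> u0; rewrite -powRrM mulVf ?gt_eqF // powRr1.
have := gt0_ltr_powR s0 _ _ h; rewrite !nnegrE mulr_ge0 ?powR_ge0 // => /(_ isT isT).
by rewrite powRM ?powR_ge0 // !e //; lra.
Qed.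

Lemma large_primitive : exists2 f : 'rV[C]_1 -> C, RG (graph setT (restrict01 f)) &
  forall x : R, 1 <= x -> logW s x =
    leading_coef_at s 1 * x `^ s^-1 - ln x / 2 - s * ln 2 + restrict01 f (const_mx x^-1).
Proof.
have [A [rho [A0 r01 _ HG _]]] := log_piece_bounds s1 s2.
have [ph sph] := opening_bounds s1 s2.
have p0 := @pi_gt0 R.
have f0 : 0 < opening s by case/andP: ph => h _; lra.
have [||||f Hf fc] := @RG_series R s^-1 (opening s) rho A (log_piece s) _ ph r01 A0.
- by rewrite invr_ge0 ltW.
- move=> p z /domS_plane_dom zp; split; [exact: differentiable_log_piece|exact: HG].
(* A negative real has argument [pi], outside the sector since [s * opening < pi], and it leaves the
   discs for large [p]. Hence the real points of the domain are nonnegative. *)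
- move=> x xd p; apply: Im_log_piece_real => //; rewrite leNgt; apply/negP => x0.
  have cx : carg (x%:C)%C = pi.
    rewrite /carg eq_complex /= eqxx andbT (lt_eqF x0) lexx.
    rewrite expr0n addr0 sqrtr_sqr ltr0_norm // invrN mulrN divff ?lt_eqF //.
    by rewrite acosN1.
  (* [x] is in the disc of level [p] only if [p + 1 < t], which fails for [p] the integer part of
     [t]. *)
  pose t : R := (3 / 2) `^ s^-1 / `|x| `^ s^-1.
  have := xd (Num.truncn t) I (const_mx s^-1) erefl; case.
    move=> [_]; rewrite big_ord1 !mxE cx ger0_norm ?(ltW p0) // => h.
    by move: sph; rewrite mulrC -ltr_pdivlMr // mulrC ltNge ltW.
  move=> [_]; rewrite !big_ord1 !mxE normcR mulrC ltr_pdivlMr // mulrC.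
  have xp : 0 < `|x| `^ s^-1 by rewrite powR_gt0 // normr_gt0 lt_eqF.
  rewrite -ltr_pdivlMr // -/t => h.
  have t0 : 0 <= t by rewrite /t divr_ge0 ?powR_ge0.
  by have /andP[_] := truncn_itv t0; rewrite ltNge ltW.
- move=> x /andP[x0 x1] p _ _ ->; left; split.
    by move=> i; rewrite !mxE normcR ger0_norm //; lra.
  rewrite big_ord1 !mxE.
  have -> : carg (x%:C)%C = 0.
    by move: x0; rewrite le_eqVlt => /orP[/eqP <-|/carg_pos //]; rewrite /carg eqxx.
  by rewrite normr0 mulr0.
exists f => // x x1.
have x01 : 0 <= x^-1 <= 1 by rewrite invr_ge0 (le_trans ler01) //= invf_le1 // (lt_le_trans ltr01).
have c := fc _ x01.
have := logW_large s1 s2 x1.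
rewrite (_ : (fun P => _) = series (fun p => Re (log_piece s p (x^-1%:C)%C))); last first.
  by apply/funext => P; rewrite /series /= big_mkord.
move=> /(cvg_lim (@Rhausdorff R)); rewrite (cvg_lim (@Rhausdorff R) c) => ->; ring.
Qed.

(** For the exponent 0 the sector condition is void and the domain is the whole disc of radius
    [3/2]. Removing the factor [1 + x] removes the singularity [-1], the only one in that disc;
    grouping the other terms in dyadic blocks makes the pieces decay geometrically. *)
Lemma small_primitive : exists2 f : 'rV[C]_1 -> C, RG (graph setT (restrict01 f)) &
  forall x : R, 0 <= x <= 1 -> logW s x = ln (1 + x) + restrict01 f (const_mx x).
Proof.
(* The lower bound is repeated as a predicate so that the general lemmas on sums keep it for each
   term. *)
pose g p (v : C) : C := \sum_(2 ^ p.+1 <= m < 2 ^ p.+2 | (2 ^ p.+1 <= m)%N) clog (1 + ((weight s m)%:C)%C * v).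
have w2 m : (2 <= m)%N -> weight s m <= 1 / 2.
  move=> m2; apply: le_trans (weight_anti s1 (_ : (0 < 2 <= m)%N)) _; first by rewrite m2.
  rewrite /weight mul1r -[leRHS](powR_inv1 (ler0n _ 2)).
  by rewrite ler_powR ?ler1n // lerN2 ltW.
have two p m : (2 ^ p.+1 <= m)%N -> (2 <= m)%N.
  by apply: leq_trans; rewrite expnS leq_pmulr // expn_gt0.
have rb := block_ratio s1.
have Hn m (v : C) : (2 <= m)%N -> normc v < 3 / 2 ->
    normc (((weight s m)%:C)%C * v) <= 3 / 4 /\ normc (((weight s m)%:C)%C * v) <= 3 / 2 * weight s m.
  move=> m2 vn; have := w2 m m2; have := weight_ge0 s m; have := normc_ge0 v => n0 wg wl.
  by rewrite Normc.normcM normcR ger0_norm //; split; nra.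
have dn p (rho : R) (z : 'rV[C]_1) : domS (datum1 0 rho (opening s)) p z -> normc (z 0 0) < 3 / 2.
  by move=> /(_ (const_mx 0) erefl) [[zp _]|[zp _]]; have := zp ord0; rewrite mxE.
have Hs m (v : C) : (2 <= m)%N -> normc v < 3 / 2 -> 0 < Re (1 + ((weight s m)%:C)%C * v).
  move=> m2 vn; have [h _] := Hn m v m2 vn; rewrite ReD.
  have := Re_le_normc (((weight s m)%:C)%C * v); rewrite ler_norml => /andP[h1 _].
  by rewrite [Re 1]/=; lra.
have [ph sph] := opening_bounds s1 s2.
have p0 := @pi_gt0 R.
have f0 : 0 < opening s by case/andP: ph => h _; lra.
(* The constant is [12 = 8 * (3/2)]: 8 from [clog1D_le], [3/2] from the radius. *)
have [|||f Hf fc] := @RG_series R 0 (opening s) (2 `^ (1 - s)) 12 g (lexx _) ph rb (ler0n _ _).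
- move=> p z /dn zn; split.
    apply: differentiable_bigsum => m /two m2.
    apply: (@differentiable_comp _ _ _ _ (fun u : C => 1 + ((weight s m)%:C)%C * u : C) (@clog R : C -> C)).
      apply: (@differentiableD _ _ _ (fun=> (1 : C)) (fun u : C => ((weight s m)%:C)%C * u : C)).
        exact: differentiable_cst.
      by apply: (@differentiable_mull _ _ id).
    by apply: clog_differentiable; rewrite /slit Hs ?orbT.
  apply: le_trans (normc_sum _ _ _) _.
  apply: le_trans (_ : \sum_(2 ^ p.+1 <= m < 2 ^ p.+2) 12 * weight s m <= _).
    rewrite big_mkcond /=; apply: ler_sum_nat => m /andP[m1 _]; rewrite m1.
    have [h1 h2] := Hn m _ (two p m m1) zn.
    by apply: le_trans (clog1D_le h1) _; lra.
  rewrite -mulr_sumr ler_wpM2l //; apply: le_trans (weight_block s1 _) _.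
  by have /andP[r0 r1] := rb; rewrite exprS ler_piMl ?exprn_ge0 ?(ltW r0) ?(ltW r1).
- move=> x xd p; have := dn 0%N _ _ (xd 0%N I); rewrite mxE => xn.
  rewrite /g; elim/big_ind : _ => //.
    by move=> a b a0 b0; rewrite ImD a0 b0 addr0.
  move=> m /two m2; have := Hs m _ m2 xn; rewrite -rmorphM -(rmorph1 (real_complex R)) -rmorphD /= => h.
  by rewrite carg_pos.
- move=> x /andP[x0 x1] p _ _ ->; left; split.
    by move=> i; rewrite !mxE normcR ger0_norm //; lra.
  by rewrite big_ord1 !mxE mul0r.
exists f => // x x01; have /andP[x0 x1] := x01.
have c1 := fc x x01.
(* The first [P] blocks cover the indices from 2 to [2^(P + 1) - 1]; the term [m = 1] is the
   [ln (1 + x)] taken out. *)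
have c2 : (fun P => log_partial s x ((2 ^ P.+1).-1) - ln (1 + x)) @ \oo --> logW s x - ln (1 + x).
  apply: cvgB; last exact: cvg_cst.
  apply: (cvg_comp (fun P => (2 ^ P.+1).-1) (log_partial s x)); last exact: log_partial_logW.
  by apply: cvgn_le => n; rewrite -ltnS prednK ?expn_gt0 // ltnW // ltn_expl.
have E : series (fun p => Re (g p (x%:C)%C)) = (fun P => log_partial s x ((2 ^ P.+1).-1) - ln (1 + x)).
  apply/funext => P; rewrite /series /=; elim: P => [|P IH].
    by rewrite big_geq // /log_partial /= big_nat1 /weight powR1 mulr1 subrr.
  rewrite big_nat_recr //= IH addrAC; congr (_ - _).
  rewrite /log_partial !prednK ?expn_gt0 // [RHS](big_cat_nat (n := (2 ^ P.+1)%N)) ?expn_gt0 ?leq_exp2l //=.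
  congr (_ + _); rewrite /g (big_morph (@complex.Re R) (@ReD R) (erefl _)).
  rewrite big_mkcond; apply: eq_big_nat => m /andP[m1 _]; rewrite m1.
  have -> : 1 + ((weight s m)%:C)%C * (x%:C)%C = ((1 + x * weight s m)%:C)%C.
    by rewrite rmorphD rmorph1 rmorphM mulrC.
  rewrite clog_real //.
  by rewrite ltr_pwDl // mulr_ge0 ?weight_ge0.
have : restrict01 f (const_mx x) = logW s x - ln (1 + x).
  by rewrite -(cvg_lim (@Rhausdorff R) c1) E; exact: (cvg_lim (@Rhausdorff R) c2).
by move=> ->; ring.
Qed.
End LargePrimitive.

(** * Definability *)

Section Definability.
Variables (R : realType) (E : expansion R).
Implicit Types (P Q : (nat -> R) -> Prop) (f g : (nat -> R) -> R) (e : nat -> R).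

Definition upd (k : nat) (x : R) e : nat -> R := fun j => if j == k then x else e j.

(** Stated for predicates on assignments, so that closure properties concern meanings; variables
    keep explicit indices. *)
Definition definable P := exists phi : formula E, forall e, P e <-> sat e phi.

Definition polynomial_fun f := exists t : term R, forall e, f e = teval e t.

Lemma polynomial_var i : polynomial_fun (fun e => e i).
Proof. by exists (TVar _ i). Qed.

Lemma polynomial_const (c : R) : polynomial_fun (fun=> c).
Proof. by exists (TConst c). Qed.

Lemma polynomial_add f g : polynomial_fun f -> polynomial_fun g ->
  polynomial_fun (fun e => f e + g e).
Proof. by move=> [t ft] [u gu]; exists (TAdd t u) => e /=; rewrite ft gu. Qed.

Lemma polynomial_mul f g : polynomial_fun f -> polynomial_fun g ->
  polynomial_fun (fun e => f e * g e).
Proof. by move=> [t ft] [u gu]; exists (TMul t u) => e /=; rewrite ft gu. Qed.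

Lemma polynomial_opp f : polynomial_fun f -> polynomial_fun (fun e => - f e).
Proof. by move=> [t ft]; exists (TMul (TConst (-1)) t) => e /=; rewrite ft mulN1r. Qed.

Lemma definable_ext P Q : (forall e, P e <-> Q e) -> definable P -> definable Q.
Proof. by move=> PQ [phi H]; exists phi => e; rewrite -PQ. Qed.

Lemma definable_not P : definable P -> definable (fun e => ~ P e).
Proof. by move=> [phi H]; exists (FNot phi) => e /=; rewrite H. Qed.

Lemma definable_and P Q : definable P -> definable Q -> definable (fun e => P e /\ Q e).
Proof. by move=> [phi H] [psi K]; exists (FAnd phi psi) => e /=; rewrite H K. Qed.

Lemma definable_or P Q : definable P -> definable Q -> definable (fun e => P e \/ Q e).
Proof.
move=> dP dQ; apply: (@definable_ext (fun e => ~ (~ P e /\ ~ Q e))); last first.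
  by apply: definable_not; apply: definable_and; apply: definable_not.
by move=> e; rewrite not_andE !notK.
Qed.

Lemma definable_imp P Q : definable P -> definable Q -> definable (fun e => P e -> Q e).
Proof.
move=> dP dQ; apply: (@definable_ext (fun e => ~ P e \/ Q e)); last first.
  by apply: definable_or => //; apply: definable_not.
by move=> e; rewrite implyE.
Qed.

(** The first hypothesis says that the index [k] is fresh for [Q], so it can carry the bound
    variable. *)
Lemma definable_ex k (Q : (nat -> R) -> R -> Prop) :
  (forall e x a, Q (upd k x e) a <-> Q e a) ->
  definable (fun e => Q e (e k)) -> definable (fun e => exists a, Q e a).
Proof.
move=> Qk [phi H]; exists (FEx k phi) => e /=.
have ek x : upd k x e k = x by rewrite /upd eqxx.
have Qk' x a : Q (upd k x e) a = Q e a by apply/propext.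
by split=> -[x hx]; exists x; have := H (upd k x e); rewrite ek Qk' => -[h1 h2]; auto.
Qed.

Lemma definable_all k (Q : (nat -> R) -> R -> Prop) :
  (forall e x a, Q (upd k x e) a <-> Q e a) ->
  definable (fun e => Q e (e k)) -> definable (fun e => forall a, Q e a).
Proof.
move=> Qk dQ; apply: (@definable_ext (fun e => ~ exists a, ~ Q e a)); last first.
  apply: definable_not; apply: (@definable_ex k (fun e a => ~ Q e a)).
    by move=> e x a; rewrite (propext (Qk e x a)).
  exact: definable_not.
move=> e; split=> [H a|H [a na]]; last exact/na/H.
by apply: contrapT => na; apply: H; exists a.
Qed.

Lemma definable_eq f g : polynomial_fun f -> polynomial_fun g ->
  definable (fun e => f e = g e).
Proof. by move=> [t ft] [u gu]; exists (FEq _ t u) => e /=; rewrite ft gu. Qed.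

(** The order is not a primitive: [f e] is positive exactly when [a^2 * f e = 1] has a solution
    [a]. *)
Lemma definable_gt0 k f : (forall e x, f (upd k x e) = f e) -> polynomial_fun f ->
  definable (fun e => 0 < f e).
Proof.
move=> fk pf; apply: (@definable_ext (fun e => exists a, a * a * f e = 1)).
  move=> e; split=> [[a H]|f0].
    have [f1|f1|f1] := ltgtP 0 (f e); first by [].
      by have := mulr_ge0_le0 (sqr_ge0 a) (ltW f1); rewrite expr2 H ler10.
    by move: H; rewrite -f1 mulr0 => /eqP; rewrite eq_sym oner_eq0.
  exists (Num.sqrt (f e))^-1.
  by rewrite -expr2 exprVn sqr_sqrtr ?ltW // mulVf // gt_eqF.
apply: (@definable_ex k (fun e a => a * a * f e = 1)); first by move=> e x a; rewrite fk.
apply: definable_eq; last exact: polynomial_const.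
by apply: polynomial_mul => //; apply: polynomial_mul; exact: polynomial_var.
Qed.

Lemma definable_rel (A : set 'rV[R]_(1 + 1)) f g : E A -> polynomial_fun f -> polynomial_fun g ->
  definable (fun e => A (row_mx (const_mx (f e) : 'rV_1) (const_mx (g e) : 'rV_1))).
Proof.
move=> EA [t ft] [u gu].
exists (FRel EA (fun i : 'I_(1 + 1) => if i == 0 then t else u)) => e /=.
suff -> : row_mx (const_mx (f e) : 'rV_1) (const_mx (g e) : 'rV_1) =
  \row_i teval e (if i == 0 then t else u) by [].
apply/rowP => i; rewrite !mxE; case: splitP => j; rewrite (ord1 j) => ij; rewrite mxE ?ft ?gu.
  by rewrite (_ : i == 0) //; apply/eqP/val_inj.
by rewrite (_ : (i == 0) = false) //; apply/negP => /eqP i0; move: ij; rewrite i0.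
Qed.

Lemma definable_graph (F : 'rV[R]_1 -> R) f g : E (graph setT F) ->
  polynomial_fun f -> polynomial_fun g -> definable (fun e => g e = F (const_mx (f e))).
Proof.
move=> EF pf pg; apply: definable_ext (definable_rel EF pf pg) => e.
rewrite /graph /= row_mxKl row_mxKr mxE; split=> [[]|] //.
Qed.

Lemma definable_graph1 (D : set R) (F : R -> R) f g : E (graph1 D F) ->
  polynomial_fun f -> polynomial_fun g -> definable (fun e => D (f e) /\ g e = F (f e)).
Proof.
move=> EF pf pg; apply: definable_ext (definable_rel EF pf pg) => e.
by rewrite /graph1 /graph /= row_mxKl row_mxKr !mxE.
Qed.

Lemma definable_defines_graph1 (D : set R) (F : R -> R) :
  definable (fun e => D (e 0%N) /\ e 1%N = F (e 0%N)) -> defines E (graph1 D F).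
Proof.
move=> [phi H]; exists phi => z; rewrite -H /graph1 /graph /=.
have e0 : lsubmx z 0 0 = valuation z 0%N.
  rewrite /valuation; case: insubP => [i _ iv|] //=; rewrite mxE; congr (z _ _); exact/val_inj.
have e1 : rsubmx z 0 0 = valuation z 1%N.
  rewrite /valuation; case: insubP => [i _ iv|] //=; rewrite mxE; congr (z _ _); exact/val_inj.
by rewrite e0 e1.
Qed.

End Definability.

Ltac poly := repeat first
  [ apply: polynomial_add | apply: polynomial_mul | apply: polynomial_opp
  | apply: polynomial_var | apply: polynomial_const ].

(** * A first-order definition of the derivative *)

Section Derivative.
Variable R : realType.

(* [eps] and [del] bound squares, which avoids absolute values. *)
Definition has_deriv (S : R -> R -> Prop) (x y : R) := exists w0, S x w0 /\
  forall eps : R, 0 < eps -> exists del : R, 0 < del /\ forall h w1 : R,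
    S (x + h) w1 -> 0 < del - h * h ->
    ~ 0 < (w1 - w0 - h * y) * (w1 - w0 - h * y) - eps * (h * h).

Lemma has_derivP (D : set R) (F : R -> R) (S : R -> R -> Prop) (x d l y : R) :
  (forall u v, S u v <-> D u /\ v = F u) -> 0 < d ->
  (forall h, `|h| < d -> D (x + h)) -> is_derive x 1 F l ->
  has_deriv S x y <-> y = l.
Proof.
move=> SF d0 Dx [dF Fl].
have Dx0 : D x by have := Dx 0; rewrite normr0 addr0; apply.
have L : h^-1 *: (F (h *: 1 + x) - F x) @[h --> 0^'] --> l by rewrite -Fl.
have key (eps : R) : 0 < eps -> exists2 del : R, 0 < del & forall h : R, `|h| < del ->
    `|F (x + h) - F x - h * l| <= eps * `|h|.
  move=> e0; move/cvgrPdist_le : L => /(_ _ e0) [del /= del0 H].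
  exists del => // h hdel; have [->|h0] := eqVneq h 0.
    by rewrite addr0 subrr mul0r subrr normr0 mulr0.
  have := H h; rewrite /= sub0r normrN => /(_ hdel h0).
  have -> : h *: 1 + x = x + h by rewrite addrC; congr (_ + _); exact: mulr1.
  have hn : 0 < `|h| by rewrite normr_gt0.
  rewrite -(ler_pM2r hn) -normrM; apply: le_trans; rewrite le_eqVlt; apply/orP; left; apply/eqP.
  rewrite -normrN; congr (`|_|); rewrite mulrBl [_ *: _]mulrC divfK //.
  by ring.
split.
  move=> [w0 [/SF[_ ->] H]]; apply/eqP; rewrite -subr_eq0; apply/negPn/negP => yl.
  have yl0 : 0 < (y - l) ^+ 2 by rewrite exprn_even_gt0.
  (* With both errors at a quarter of [|y - l| h], the inequality [h^2 (y - l)^2 <= 2 u^2 + 2 v^2],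
     for [u = a - h l] and [v = a - h y], bounds the left side by a quarter of itself. *)
  have [del [del0 Hd]] := H ((y - l) ^+ 2 / 16) (divr_gt0 yl0 (ltr0n _ 16)).
  have yn : 0 < `|y - l| by rewrite normr_gt0.
  have [del' del'0 Hd'] := key (`|y - l| / 4) (divr_gt0 yn (ltr0n _ 4)).
  (* The bounds [1] and [del / 2] give [h^2 <= h < del], as the squared form of the definition
     requires. *)
  pose h := Num.min (Num.min (d / 2) (del' / 2)) (Num.min 1 (del / 2)).
  have h0 : 0 < h by rewrite !lt_min !divr_gt0 // ltr01.
  have [[hd hd'] [h1 hdel]] : (h <= d / 2 /\ h <= del' / 2) /\ (h <= 1 /\ h <= del / 2).
    by rewrite /h !ge_min !lexx ?orbT.
  have hD : D (x + h) by apply: Dx; rewrite gtr0_norm //; lra.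
  have A := Hd h (F (x + h)) (iffRL (SF _ _) (conj hD erefl)).
  have {}A := A (_ : 0 < del - h * h); have := Hd' h; rewrite gtr0_norm //.
  move=> /(_ (_ : h < del')) B.
  have {}B : `|F (x + h) - F x - h * l| <= `|y - l| / 4 * h by apply: B; lra.
  have {}A : ~~ (0 < (F (x + h) - F x - h * y) * (F (x + h) - F x - h * y) - (y - l) ^+ 2 / 16 * (h * h)).
    by apply/negP; apply: A; nra.
  move: A; rewrite -leNgt; set a := F (x + h) - F x in B *.
  have B2 : (a - h * l) ^+ 2 <= (y - l) ^+ 2 / 16 * (h * h).
    rewrite -(real_normK (num_real (a - h * l))).
    apply: le_trans (_ : (`|y - l| / 4 * h) ^+ 2 <= _).
      by rewrite lerXn2r ?nnegrE // mulr_ge0 ?divr_ge0 // ltW.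
    by rewrite !exprMn real_normK ?num_real // le_eqVlt; apply/orP; left; apply/eqP; field.
  have hh : 0 < h * h by rewrite mulr_gt0.
  have E : h * h * (y - l) ^+ 2 <= 2 * (a - h * l) ^+ 2 + 2 * ((a - h * y) * (a - h * y)).
    rewrite -subr_ge0; set X := _ - _.
    have -> : X = ((a - h * l) + (a - h * y)) ^+ 2 by rewrite /X; ring.
    exact: sqr_ge0.
  by move=> A; have := mulr_gt0 hh yl0; clear -B2 E A; lra.
move=> ->; exists (F x); split; first by apply/SF.
move=> eps e0; have s0 : 0 < Num.sqrt eps by rewrite sqrtr_gt0.
have [del del0 H] := key _ s0; exists (del ^+ 2); split; first by rewrite exprn_gt0.
move=> h w1 /SF[_ ->] hdel; apply/negP; rewrite -leNgt subr_le0.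
have hd : `|h| < del.
  rewrite -(ltr_pXn2r (n := 2)) ?nnegrE ?(ltW del0) // real_normK ?num_real // expr2.
  by rewrite -subr_gt0.
have : `|F (x + h) - F x - h * l| ^+ 2 <= (Num.sqrt eps * `|h|) ^+ 2.
  by rewrite lerXn2r ?nnegrE ?mulr_ge0 ?sqrtr_ge0 // H.
by rewrite exprMn !real_normK ?num_real // sqr_sqrtr ?(ltW e0) // -!expr2.
Qed.

End Derivative.

(** Variable 0 is the point and 8 the candidate derivative; 2 to 6 carry [w0], [eps], [del], [h],
    [w1], and 9 is the auxiliary root for positivity. *)
Lemma definable_deriv (R : realType) (E : expansion R) (S : R -> R -> Prop) :
  definable E (fun e => S (e 0%N) (e 2%N)) ->
  definable E (fun e => S (e 0%N + e 5%N) (e 6%N)) ->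
  definable E (fun e => has_deriv S (e 0%N) (e 8%N)).
Proof.
move=> S1 S2; rewrite /has_deriv.
apply: (@definable_ex _ _ 2); first by [].
apply: definable_and; first exact: S1.
apply: (@definable_all _ _ 3); first by [].
apply: definable_imp; first by apply: (@definable_gt0 _ _ 9) => //; poly.
apply: (@definable_ex _ _ 4); first by [].
apply: definable_and; first by apply: (@definable_gt0 _ _ 9) => //; poly.
apply: (@definable_all _ _ 5); first by [].
apply: (@definable_all _ _ 6); first by [].
apply: definable_imp; first exact: S2.
apply: definable_imp; first by apply: (@definable_gt0 _ _ 9) => //; poly.
by apply: definable_not; apply: (@definable_gt0 _ _ 9) => //; poly.
Qed.

(** * The two definability statements *)

Section WDefinable.
Variables (R : realType) (s : R).
Hypotheses (s1 : 1 < s) (s2 : s < 2).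

Let s0 : 0 < s. Proof. exact: lt_trans s1. Qed.

Lemma derive_W x : 0 < x -> derive1 (W s) x / W s x = derive1 (logW s) x.
Proof.
move=> x0; have dl := logW_derivable s1 x0.
have near_eq : \forall y \near x, W s y = (expR \o logW s) y.
  near=> y; apply: W_expR_logW => //; apply: ltW; near: y; exact: lt_nbhsr.
have [_ dW] : is_derive x 1 (expR \o logW s) (expR (logW s x) * derive1 (logW s) x).
  apply: is_derive1_comp.
  by rewrite derive1E; apply: DeriveDef.
rewrite derive1E (near_eq_derive _ near_eq) dW (W_expR_logW s1 (ltW x0)).
by rewrite mulrAC divff ?mul1r // gt_eqF // expR_gt0.
Unshelve. all: by end_near. Qed.

Lemma W_deriv_definable :
  defines (expand_by (@RG R) (graph1 [set x | 0 < x] (fun x => x `^ s)))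
          (graph1 [set x | 0 < x] (fun x => derive1 (W s) x / W s x)).
Proof.
have [f1 Rf1 L1] := large_primitive s1 s2.
have [f2 Rf2 L2] := small_primitive s1 s2.
set E := expand_by _ _.
have Ef1 : E _ (graph setT (restrict01 f1)) by left.
have Ef2 : E _ (graph setT (restrict01 f2)) by left.
have Es : E _ (graph1 [set x : R | 0 < x] (fun x => x `^ s)) by right.
set D := leading_coef_at s 1 in L1.
(* [a] stands for [x^(1/s)], obtained by inverting the primitive power, and [v] for [1 / x]. *)
pose S1 (x w : R) := 0 < x - 1 /\ exists a v : R, (0 < a /\ x = a `^ s) /\ x * v = 1 /\ w - D * a = restrict01 f1 (const_mx v).
pose S2 (x w : R) := 0 < x /\ 0 < 1 - x /\ w = restrict01 f2 (const_mx x).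
(* The logarithms sit on this side: [F1] and [F2] have definable graphs, and their derivatives
   differ from that of [logW] by the rational functions [1 / (2 x)] and [- 1 / (1 + x)]. *)
pose F1 x := logW s x + (ln x / 2 + s * ln 2).
pose F2 x := logW s x - ln (1 + x).
have S1E (x w : R) : S1 x w <-> 1 < x /\ w = F1 x.
  rewrite /S1 subr_gt0 /F1; split=> -[x1].
    move=> [a [v [[a0 xa] [xv /eqP]]]]; rewrite subr_eq => /eqP ->; split=> //.
    have x0 : 0 < x by exact: lt_trans x1.
    rewrite L1 ?ltW // {1}xa -powRrM mulfV ?gt_eqF // powRr1 ?ltW //.
    have -> : v = x^-1 by rewrite -[v](mulKf (lt0r_neq0 x0)) xv mulr1.
    ring.
  have x0 : 0 < x by exact: lt_trans x1.
  move=> ->; split=> //; exists (x `^ s^-1), x^-1; split; [split|split].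
  - by rewrite powR_gt0.
  - by rewrite -powRrM mulVf ?gt_eqF // powRr1 ?ltW.
  - by rewrite mulfV // gt_eqF.
  - by rewrite L1 ?ltW //; ring.
have S2E (x w : R) : S2 x w <-> 0 < x < 1 /\ w = F2 x.
  rewrite /S2 subr_gt0 /F2; split=> [[x0 [x1 ->]]|[/andP[x0 x1] ->]].
    by rewrite x0 x1 L2 ?(ltW x0) ?(ltW x1) // addrC addKr.
  by rewrite x0 x1 L2 ?(ltW x0) ?(ltW x1) // addrC addKr.
have d1 (x : R) : 1 < x -> is_derive x 1 F1 (derive1 (logW s) x + (2 * x)^-1).
  move=> x1; have x0 : 0 < x by exact: lt_trans x1.
  have dl := logW_derivable s1 x0.
  have h1 : is_derive x 1 (logW s) (derive1 (logW s) x) by rewrite derive1E; apply: DeriveDef.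
  have h2 := is_derive1_ln x0.
  rewrite (_ : F1 = logW s + (2^-1 *: @ln R + cst (s * ln 2))); last first.
    by apply/funext => u; rewrite /F1 /= mulrC.
  have -> : derive1 (logW s) x + (2 * x)^-1 = derive1 (logW s) x + (2^-1 *: x^-1 + 0).
    by rewrite addr0 invfM.
  by apply: is_deriveD.
have d2 (x : R) : 0 < x < 1 -> is_derive x 1 F2 (derive1 (logW s) x - (1 + x)^-1).
  move=> /andP[x0 x1]; have dl := logW_derivable s1 x0.
  have h1 : is_derive x 1 (logW s) (derive1 (logW s) x) by rewrite derive1E; apply: DeriveDef.
  have h2 : is_derive x 1 (@ln R \o (fun u => 1 + u)) (1 + x)^-1.
    rewrite -[(1 + x)^-1]mulr1; apply: is_derive1_comp; first by apply: is_derive1_ln; rewrite addr_gt0.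
    by rewrite -[X in is_derive _ _ _ X]add0r; apply: is_deriveD.
  exact: is_deriveB.
(* Neither graph contains a neighbourhood of 1; the value there is supplied as a constant of the
   language. *)
pose c := derive1 (logW s) 1.
apply: definable_defines_graph1.
(* Terms have no division: [v] carries the rational correction, and [y] gives the derivative of [F1]
   or [F2] a variable of its own. *)
apply: (@definable_ext _ _ (fun e =>
   (0 < e 0%N - 1 /\ exists v, v * (2 * e 0%N) = 1 /\ exists y, y = e 1%N + v /\ has_deriv S1 (e 0%N) y) \/
   (0 < e 0%N /\ 0 < 1 - e 0%N /\ exists v, v * (1 + e 0%N) = 1 /\ exists y, y = e 1%N - v /\ has_deriv S2 (e 0%N) y) \/
   (e 0%N = 1 /\ e 1%N = c))).
  move=> e; move: (e 0%N) (e 1%N) => x y.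
  have inv (u v : R) : 0 < u -> v * u = 1 -> v = u^-1.
    by move=> u0 h; rewrite -[v](mulfK (lt0r_neq0 u0)) h mul1r.
  have P1 u : 1 < x -> has_deriv S1 x u <-> u = derive1 (logW s) x + (2 * x)^-1.
    move=> x1; apply: (@has_derivP _ [set x | 1 < x] F1 _ _ (x - 1)) => //.
    - by rewrite subr_gt0.
    - by move=> h /=; rewrite ltr_norml => /andP[h1 h2]; lra.
    - exact: d1.
  have P2 u : 0 < x < 1 -> has_deriv S2 x u <-> u = derive1 (logW s) x - (1 + x)^-1.
    move=> x01; have /andP[x0 x1] := x01.
    apply: (@has_derivP _ [set x | 0 < x < 1] F2 _ _ (Num.min x (1 - x))) => //.
    - by rewrite lt_min x0 subr_gt0.
    - by move=> h /=; rewrite lt_min !ltr_norml => /andP[/andP[h1 h2] /andP[h3 h4]]; apply/andP; split; lra.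
    - exact: d2.
  rewrite /= !subr_gt0; split.
    move=> [[x1 [v [/inv xv [u [-> /P1 h]]]]]|[[x0 [x1 [v [/inv xv [u [-> /P2 h]]]]]]|[-> ->]]].
    - have x0 : 0 < x by exact: lt_trans x1.
      by split=> //; rewrite derive_W //; move: (h x1); rewrite xv ?mulr_gt0 // => /addIr.
    - split=> //; rewrite derive_W //; move: h; rewrite x0 x1 => /(_ isT).
      by rewrite xv ?addr_gt0 // => /addIr.
    - by split=> //; rewrite derive_W.
  move=> [x0 ->]; rewrite derive_W //; have [x1|x1|->] := ltgtP x 1.
  - right; left; split=> //; split=> //; exists (1 + x)^-1; rewrite mulVf ?gt_eqF ?addr_gt0 //.
    by split=> //; eexists; split; first reflexivity; apply/P2; rewrite ?x0 ?x1.
  - left; split=> //; exists (2 * x)^-1; rewrite mulVf ?gt_eqF ?mulr_gt0 //.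
    by split=> //; eexists; split; first reflexivity; apply/P1.
  - by right; right.
have S1d f g : (forall e x, f (upd 10 x e) = f e) -> (forall e x, f (upd 11 x e) = f e) ->
    (forall e x, f (upd 12 x e) = f e) ->
    (forall e x, g (upd 10 x e) = g e) -> (forall e x, g (upd 11 x e) = g e) ->
    polynomial_fun f -> polynomial_fun g -> definable E (fun e => S1 (f e) (g e)).
  move=> f10 f11 f12 g10 g11 pf pg; rewrite /S1.
  apply: definable_and; first by apply: (@definable_gt0 _ _ 12); [move=> *; rewrite f12|poly].
  apply: (@definable_ex _ _ 10); first by move=> e x a; rewrite f10 g10.
  apply: (@definable_ex _ _ 11); first by move=> e x a; rewrite f11 g11.
  apply: definable_and; first by apply: (definable_graph1 Es) => //; poly.
  apply: definable_and; first by apply: definable_eq; poly.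
  by apply: (definable_graph Ef1 (g := fun e => g e - D * e 10%N)); poly.
have S2d f g : (forall e x, f (upd 10 x e) = f e) ->
    polynomial_fun f -> polynomial_fun g -> definable E (fun e => S2 (f e) (g e)).
  move=> f10 pf pg; rewrite /S2.
  apply: definable_and; first exact: (@definable_gt0 _ _ 10).
  apply: definable_and; first by apply: (@definable_gt0 _ _ 10); [move=> *; rewrite f10|poly].
  exact: (definable_graph Ef2).
apply: definable_or; last apply: definable_or.
- apply: definable_and; first by apply: (@definable_gt0 _ _ 9) => //; poly.
  apply: (@definable_ex _ _ 7); first by [].
  apply: definable_and; first by apply: definable_eq; poly.
  apply: (@definable_ex _ _ 8); first by [].
  apply: definable_and; first by apply: definable_eq; poly.
  by apply: definable_deriv; apply: S1d => //; poly.
- apply: definable_and; first by apply: (@definable_gt0 _ _ 9) => //; poly.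
  apply: definable_and; first by apply: (@definable_gt0 _ _ 9) => //; poly.
  apply: (@definable_ex _ _ 7); first by [].
  apply: definable_and; first by apply: definable_eq; poly.
  apply: (@definable_ex _ _ 8); first by [].
  apply: definable_and; first by apply: definable_eq; poly.
  by apply: definable_deriv; apply: S2d => //; poly.
- by apply: definable_and; apply: definable_eq; poly.
Qed.

Lemma W_definable :
  defines (expand_by (@RG R) (graph1 setT expR)) (graph1 [set x | 0 < x] (W s)).
Proof.
have [f1 Rf1 L1] := large_primitive s1 s2.
have [f2 Rf2 L2] := small_primitive s1 s2.
set E := expand_by _ _.
have Ef1 : E _ (graph setT (restrict01 f1)) by left.
have Ef2 : E _ (graph setT (restrict01 f2)) by left.
have Ee : E _ (graph1 setT (@expR R)) by right.
set D := leading_coef_at s 1 in L1.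
apply: definable_defines_graph1.
(* For [x <= 1], [W] is [(1 + x)] times an exponential. For [x > 1], [t] is [ln x], read off from
   [x = expR t], and [a = expR (t / s)] is [x^(1/s)]. The conjuncts with [setT] are the domain
   conditions built into [graph1]. *)
apply: (@definable_ext _ _ (fun e =>
  (0 < e 0%N /\ ~ 0 < e 0%N - 1 /\ exists u, u = restrict01 f2 (const_mx (e 0%N)) /\
     exists g, (setT u /\ g = expR u) /\ e 1%N = (1 + e 0%N) * g) \/
  (0 < e 0%N - 1 /\ exists t, (setT t /\ e 0%N = expR t) /\ exists v, e 0%N * v = 1 /\
     exists u, u = restrict01 f1 (const_mx v) /\
     exists a, (setT (s^-1 * t) /\ a = expR (s^-1 * t)) /\
       setT (D * a + (- (2^-1 * t) + - (s * ln 2)) + u) /\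
       e 1%N = expR (D * a + (- (2^-1 * t) + - (s * ln 2)) + u)))).
  move=> e; move: (e 0%N) (e 1%N) => x y; rewrite /= subr_gt0; split.
    move=> [[x0 [/negP]]|[x1 [t [[_ xt] [v [xv [u [-> [a [[_ ->] [_ ->]]]]]]]]]]].
      rewrite -leNgt => x1 [u [-> [g [[_ ->] ->]]]]; split=> //.
      rewrite (W_expR_logW s1 (ltW x0)) L2 ?(ltW x0) // expRD lnK // posrE addr_gt0 //.
    have x0 : 0 < x by exact: lt_trans x1.
    split=> //; rewrite (W_expR_logW s1 (ltW x0)) L1 ?ltW //; congr expR.
    have -> : v = x^-1 by rewrite -[v](mulKf (lt0r_neq0 x0)) xv mulr1.
    rewrite /powR gt_eqF // xt expRK; ring.
  move=> [x0 ->]; have [x1|x1] := lerP x 1.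
    left; split=> //; split; first by [].
    eexists; split; first reflexivity; eexists; split; first by split.
    by rewrite (W_expR_logW s1 (ltW x0)) L2 ?(ltW x0) // expRD lnK // posrE addr_gt0.
  right; split=> //; exists (ln x); rewrite lnK ?posrE //; split=> //.
  exists x^-1; rewrite mulfV ?gt_eqF //; split=> //.
  eexists; split; first reflexivity; eexists; split; first by split.
  split=> //; rewrite (W_expR_logW s1 (ltW x0)) L1 ?ltW //; congr expR.
  rewrite /powR gt_eqF //; ring.
apply: definable_or.
- apply: definable_and; first by apply: (@definable_gt0 _ _ 9) => //; poly.
  apply: definable_and; first by apply: definable_not; apply: (@definable_gt0 _ _ 9) => //; poly.
  apply: (@definable_ex _ _ 2); first by [].
  apply: definable_and; first by apply: (definable_graph Ef2); poly.
  apply: (@definable_ex _ _ 3); first by [].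
  apply: definable_and; first by apply: (definable_graph1 Ee); poly.
  by apply: definable_eq; poly.
- apply: definable_and; first by apply: (@definable_gt0 _ _ 9) => //; poly.
  apply: (@definable_ex _ _ 2); first by [].
  apply: definable_and; first by apply: (definable_graph1 Ee); poly.
  apply: (@definable_ex _ _ 3); first by [].
  apply: definable_and; first by apply: definable_eq; poly.
  apply: (@definable_ex _ _ 4); first by [].
  apply: definable_and; first by apply: (definable_graph Ef1); poly.
  apply: (@definable_ex _ _ 5); first by [].
  apply: definable_and.
    by apply: (definable_graph1 Ee (f := fun e => s^-1 * e 2%N) (g := fun e => e 5%N)); poly.
  by apply: (definable_graph1 Ee
    (f := fun e => D * e 5%N + (- (2^-1 * e 2%N) + - (s * ln 2)) + e 4%N) (g := fun e => e 1%N)); poly.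
Qed.
End WDefinable.

Theorem theorem1p2 (R : realType) (s : R) (hs1 : 1 < s) (hs2 : s < 2) :
  defines (expand_by (@RG R) (graph1 [set x | 0 < x] (fun x => x `^ s)))
          (graph1 [set x | 0 < x] (fun x => derive1 (W s) x / W s x))
  /\
  defines (expand_by (@RG R) (graph1 setT expR))
          (graph1 [set x | 0 < x] (W s)).
Proof. by split; [exact: W_deriv_definable|exact: W_definable]. Qed.
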